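(* Let $n\ge 1$. For every curvature-like function $s\colon S^1\to(\mathbb{R}_+)^{n-1}\times\mathbb{R}$ and every real number $\varepsilon>0$ there exists a closed Frenet curve $\alpha\colon S^1\to\mathbb{R}^{n+1}$ that is a holonomic $\varepsilon$-approximation of $s$, i.e. $|s(t)-j_\alpha(t)|<\varepsilon$ for all $t\in S^1$. Moreover, $\alpha$ can be chosen to be an embedding.
   Context: $\mathbb{R}_+$ denotes the set of strictly positive real numbers and $|\cdot|$ the Euclidean norm. Functions on $S^1$ are regarded as periodic functions of a real parameter $t$, and derivatives are taken with respect to $t$. A closed Frenet curve in $\mathbb{R}^{n+1}$ is a $C^{n+1}$-differentiable map $\alpha\colon S^1\to\mathbb{R}^{n+1}$ such that for each $t\in S^1$ the derivatives $\alpha'(t),\alpha''(t),\dots,\alpha^{(n)}(t)$ are linearly independent (the curve need not be parametrized by arc length). The Gram-Schmidt process applied to $(\alpha',\dots,\alpha^{(n)})$ gives orthonormal vectors $e_1,\dots,e_n$, and there is a unique unit vector $e_{n+1}$ making $\{e_1,\dots,e_{n+1}\}$ a positively oriented orthonormal basis, called the Frenet frame. The curvatures $\kappa_1^\alpha,\dots,\kappa_n^\alpha$ are the functions of $t$ defined by the Frenet formulae $$\frac{1}{|\alpha'|}e_1'=\kappa_1^\alpha e_2,\qquad \frac{1}{|\alpha'|}e_{i+1}'=-\kappa_i^\alpha e_i+\kappa_{i+1}^\alpha e_{i+2}\ (i=1,\dots,n-1),\qquad \frac{1}{|\alpha'|}e_{n+1}'=-\kappa_n^\alpha e_n.$$ The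 curvatures $\kappa_1^\alpha,\dots,\kappa_{n-1}^\alpha$ are automatically strictly positive. A curvature-like function is a continuous map $S^1\to(\mathbb{R}_+)^{n-1}\times\mathbb{R}$. For a closed Frenet curve $\alpha$, put $j_\alpha(t)=(\kappa_1^\alpha(t),\dots,\kappa_n^\alpha(t))$. A closed Frenet curve $\alpha$ is a holonomic $\varepsilon$-approximation of a curvature-like function $s$ if $|s(t)-j_\alpha(t)|<\varepsilon$ for every $t\in S^1$. *)

(* Defs.v *)
From mathcomp Require Import all_boot all_order all_algebra.
From mathcomp Require Import all_classical all_reals all_analysis.

Set Implicit Arguments.
Unset Strict Implicit.
Unset Printing Implicit Defensive.

Import Order.TTheory GRing.Theory Num.Theory.
Import numFieldNormedType.Exports.

Local Open Scope classical_set_scope.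
Local Open Scope ring_scope.

(** Functions on the circle [S^1 = R / 2 pi Z] are represented by functions of
    a real parameter [t] that are periodic of period [2 pi]. *)
Definition on_circle (R : realType) (T : zmodType) (f : R -> T) : Prop :=
  periodic f (pi *+ 2).

Definition dotv (R : realType) (m : nat) (u v : 'rV[R]_m) : R :=
  \sum_(i < m) u 0 i * v 0 i.

(** The library norm [`|v|] on matrices is the sup norm, hence this
    definition. *)
Definition enorm (R : realType) (m : nat) (v : 'rV[R]_m) : R :=
  Num.sqrt (dotv v v).

Definition differentiable_C (R : realType) (m k : nat)
    (f : R -> 'rV[R]_m.+1) : Prop :=
  (forall (j : nat) (t : R), (j < k)%N -> derivable (derive1n j f) t 1) /\
  continuous (derive1n k f).

Definition closed_frenet_curve (R : realType) (n : nat)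
    (alpha : R -> 'rV[R]_n.+1) : Prop :=
  [/\ on_circle alpha,
      differentiable_C n.+1 alpha &
      forall t : R, row_free (\matrix_(i < n) derive1n i.+1 alpha t)].

(** Vectors, frames and curvatures are numbered from 1, as in the classical
    Frenet formulae: only [v k] and [e k] with [1 <= k <= n] matter here. *)
Definition gram_schmidt (R : realType) (m n : nat)
    (v e : nat -> 'rV[R]_m) : Prop :=
  forall k : nat, (1 <= k <= n)%N ->
    let u := v k - \sum_(1 <= j < k) dotv (v k) (e j) *: e j in
    e k = (enorm u)^-1 *: u.

(** [e 1 t], ..., [e n.+1 t] is the Frenet frame of [alpha] at [t]; it is
    positively oriented for the standard orientation of [R^(n+1)]. *)
Definition frenet_frame (R : realType) (n : nat) (alpha : R -> 'rV[R]_n.+1)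
    (e : nat -> R -> 'rV[R]_n.+1) : Prop :=
  forall t : R,
    [/\ gram_schmidt n (fun k => derive1n k alpha t) (fun k => e k t),
        forall i j : nat, (1 <= i <= n.+1)%N -> (1 <= j <= n.+1)%N ->
          dotv (e i t) (e j t) = (i == j)%:R &
        0 < \det (\matrix_(i < n.+1) e i.+1 t)].

(** The derivability of the frame is automatic for a Frenet curve of class
    C^(n+1); it is recorded because [derive1] is a total operator. *)
Definition frenet_formulae (R : realType) (n : nat) (alpha : R -> 'rV[R]_n.+1)
    (e : nat -> R -> 'rV[R]_n.+1) (kappa : nat -> R -> R) : Prop :=
  forall t : R,
    let D k := (enorm (derive1 alpha t))^-1 *: derive1 (e k) t in
    [/\ forall k : nat, (1 <= k <= n.+1)%N -> derivable (e k) t 1,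
        D 1%N = kappa 1%N t *: e 2%N t,
        forall i : nat, (1 <= i <= n.-1)%N ->
          D i.+1 = - kappa i t *: e i t + kappa i.+1 t *: e i.+2 t &
        D n.+1 = - kappa n t *: e n t].

(** For [1 <= n] and a closed Frenet curve [alpha], the frame [e] and the
    functions [kappa 1], ..., [kappa n] are uniquely determined, so that this
    relation is the graph of the assignment [alpha |-> j_alpha]. The component
    of index [i : 'I_n] of [j t] is the curvature number [i.+1]. *)
Definition is_curvature_map (R : realType) (n : nat)
    (alpha : R -> 'rV[R]_n.+1) (j : R -> 'rV[R]_n) : Prop :=
  exists (e : nat -> R -> 'rV[R]_n.+1) (kappa : nat -> R -> R),
    [/\ frenet_frame alpha e,
        frenet_formulae alpha e kappa &
        forall t : R, j t = \row_(i < n) kappa i.+1 t].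

(** The last component, [i.+1 = n], is unconstrained. *)
Definition curvature_like (R : realType) (n : nat) (s : R -> 'rV[R]_n) : Prop :=
  [/\ on_circle s,
      continuous s &
      forall (t : R) (i : 'I_n), (i.+1 < n)%N -> 0 < s t 0 i].

Definition holonomic_approximation (R : realType) (n : nat) (eps : R)
    (s : R -> 'rV[R]_n) (alpha : R -> 'rV[R]_n.+1) : Prop :=
  exists j : R -> 'rV[R]_n,
    is_curvature_map alpha j /\ forall t : R, enorm (s t - j t) < eps.

(** For a periodic [alpha] of class C^1: the induced map on the circle is an
    immersion, is injective, and is a homeomorphism onto its image (its inverse
    is continuous at each point [alpha t] of the image). *)
Definition circle_embedding (R : realType) (n : nat)
    (alpha : R -> 'rV[R]_n.+1) : Prop :=
  [/\ forall t : R, derive1 alpha t != 0,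
      forall t u : R, alpha t = alpha u ->
        exists k : int, u = t + (pi *+ 2) *~ k &
      forall (t : R) (U : set R), nbhs t U ->
        \forall y \near alpha t, forall u : R, alpha u = y ->
          exists k : int, U (u + (pi *+ 2) *~ k)].

(* Main.v *)
(* A curve with constant curvatures c_1, ..., c_n is the orbit of a one-parameter
   group; after a small perturbation of the speeds (and, if the Frenet matrix is
   singular, after bending the axis of the helix into a large circle) it becomes a closed
   embedded curve gamma of period P whose derivatives are, up to rotations, close
   to those of the model. So gamma approximates the value of s at t = 0. Now
   gamma is made polynomial near gamma(0) by a Taylor patch, and on the tiny
   window 0 < u < 2 pi d the monomials (u/d)^l/l! are replaced by iterated integrals f_l
   with respect to weights lam_1, lam_2, ...: in the rescaled variable
   t = u/d the curve is sum_l d^l f_l(t) gamma^(l)(0), a triangular combination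
   of vectors close to the derivatives of gamma at 0, and its k-th
   curvature is close to lam_k(t) c_k, that is, to s_k(t) for the right weights.
   Outside the window lam = 1 and the change is C^(n+1)-small, and its
   C^1-size is small everywhere, so the curve stays embedded. Finally
   the parametrization u(t) spends almost all of the circle inside the window
   and runs through the rest of gamma while t is close to 0. *)
Require Import Defs.
From mathcomp Require Import all_boot all_order all_algebra.
From mathcomp Require Import all_classical all_reals all_analysis.
From mathcomp Require Import perm spectral sesquilinear complex.
From mathcomp Require Import ring lra zify.
Import Order.TTheory GRing.Theory Num.Theory.
Import numFieldNormedType.Exports.
Local Open Scope ring_scope.
Set Implicit Arguments.
Unset Strict Implicit.
Unset Printing Implicit Defensive.
Local Open Scope classical_set_scope.

(** * Functions of class C^k on the line and their calculus *)

Section Calculus.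
Context {R : realType}.
Implicit Types (f g : R -> R) (k : nat) (t : R).

(** Closing up is a global condition that the curvatures do not control, so it is inherited from
    [gamma], and [s] enters only through a local change on a window whose length tends to 0. If each
    [v k] is a combination of [w 1], ..., [w k] with positive diagonal coefficients [b k k], both
    jets have the same frame, and the curvatures get multiplied by
    [b (k+1) (k+1) / (b k k * b 1 1)]. For iterated integrals [b k k = d^k lam_1 ... lam_(k-1)], so
    the factor is [lam_k]. Only [lam_1], ..., [lam_(n-1)] have to be positive, which lets the last
    curvature change sign; but [c_n] must be nonzero to be divided by. Keeping [lam_0 = 1] makes the
    change C^1-small even inside the window, where the higher derivatives do move. Beyond the window
    an iterated integral differs from the monomial by a polynomial of lower degree, which is O(d)
    after rescaling, so a fixed cutoff can remove it. Embeddedness is used in a quantitative form, a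
    lower Lipschitz bound for [gamma] modulo its period, which C^1-small changes preserve. *)

Fixpoint Ck k f : Prop :=
  if k is k'.+1 then (forall t : R, derivable f t 1) /\ Ck k' (derive1 f) else continuous f.

Lemma derivable_cont f : (forall t, derivable f t 1) -> continuous f.
Proof.
by move=> df t; apply/differentiable_continuous/derivable1_diffP.
Qed.

Lemma CkW k f : Ck k.+1 f -> Ck k f.
Proof.
by elim: k f => [|k IH] f [df Cf]; [exact: derivable_cont|split=> //; exact: IH].
Qed.

Lemma Ck_le k l f : (k <= l)%N -> Ck l f -> Ck k f.
Proof.
move=> /subnK <-; elim: (l - k)%N => [//|m IH] Cf; apply: IH.
exact: CkW.
Qed.

Lemma Ck_cont k f : Ck k f -> continuous f.
Proof. exact: (@Ck_le 0 k). Qed.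

(** [Ck] peels derivatives off the front, which suits induction on products and compositions; this
    equivalent form is that of [differentiable_C]. *)
Lemma CkP k f : Ck k f <->
  (forall j t, (j < k)%N -> derivable (derive1n j f) t 1) /\
  continuous (derive1n k f).
Proof.
elim: k f => [|k IH] f; first by split=> [|[]].
rewrite derive1Sn; split=> [[df /IH[dk ck]]|[dk ck]].
  split=> // -[|j] t jk; first exact: df.
  by rewrite derive1Sn; exact: dk.
split; first by move=> t; exact: (dk 0%N).
apply/IH; split=> // j t jk; rewrite -derive1Sn; exact: dk.
Qed.

Lemma Ck_ext k f g : f =1 g -> Ck k f -> Ck k g.
Proof. by move/funext=> ->. Qed.

Lemma is_derive_of f t : derivable f t 1 -> is_derive t 1 f ((derive1 f) t).
Proof. by move=> df; rewrite derive1E; exact: derivableP. Qed.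

Lemma derive1_is f t (d : R) : is_derive t 1 f d -> (derive1 f) t = d.
Proof. by move=> H; rewrite derive1E derive_val. Qed.

Lemma Ck_of_deriv k f g : (forall t, is_derive t 1 f (g t)) -> Ck k g -> Ck k.+1 f.
Proof.
move=> H Cg; split; first by move=> t; case: (H t).
by have -> : (derive1 f) = g by apply/funext => t; exact: derive1_is.
Qed.

Lemma Ck_derive1n k l f : Ck (k + l) f -> Ck l (derive1n k f).
Proof.
elim: k f => [//|k IH] f [_ Cf].
by rewrite derive1Sn; exact: IH.
Qed.

Lemma Ck_cst k (c : R) : Ck k (fun=> c).
Proof.
elim: k c => [|k IH] c; first by move=> ?; exact: cst_continuous.
by apply: (@Ck_of_deriv _ _ (fun=> 0)) => // t; exact: is_derive_cst.
Qed.

Lemma Ck_id k : Ck k (fun t => t).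
Proof.
case: k => [|k]; first by move=> ?; exact: cvg_id.
by apply: (@Ck_of_deriv _ _ (fun=> 1)); exact: Ck_cst.
Qed.

Lemma is_deriveDf f g t (a b : R) : is_derive t 1 f a -> is_derive t 1 g b ->
  is_derive t 1 (fun x => f x + g x) (a + b).
Proof. by move=> ? ?; exact: is_deriveD. Qed.

Lemma is_deriveMf f g t (a b : R) : is_derive t 1 f a -> is_derive t 1 g b ->
  is_derive t 1 (fun x => f x * g x) (a * g t + f t * b).
Proof.
move=> ? ?; apply: is_derive_eq.
by rewrite /= /GRing.scale /= addrC [a * _]mulrC.
Qed.

Lemma is_deriveZf f t (c a : R) : is_derive t 1 f a ->
  is_derive t 1 (fun x => c * f x) (c * a).
Proof.
move=> H; have := is_deriveMf (is_derive_cst c t 1) H.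
by rewrite mul0r add0r.
Qed.

Lemma is_deriveNf f t (a : R) : is_derive t 1 f a ->
  is_derive t 1 (fun x => - f x) (- a).
Proof. by move=> ?; exact: is_deriveN. Qed.

Lemma is_derive_compf f g t (a b : R) : is_derive t 1 f a -> is_derive (f t) 1 g b ->
  is_derive t 1 (fun x => g (f x)) (b * a).
Proof.
move=> [df <-] [dg <-]; apply: DeriveDef.
  by apply/derivable1_diffP/differentiable_comp; exact/derivable1_diffP.
by rewrite -!derive1E; exact: (@derive1_comp _ f g t).
Qed.

Lemma is_derive_sumf (I : Type) (r : seq I) (P : pred I) (F : I -> R -> R) (D : I -> R) t :
  (forall i, P i -> is_derive t 1 (F i) (D i)) ->
  is_derive t 1 (fun x => \sum_(i <- r | P i) F i x) (\sum_(i <- r | P i) D i).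
Proof.
move=> H; elim: r => [|i r IH].
  rewrite big_nil [X in is_derive _ _ X _](_ : _ = fun=> 0).
    exact: is_derive_cst.
  by apply/funext => x; rewrite big_nil.
rewrite big_cons [X in is_derive _ _ X _](_ : _ = fun x => if P i then F i x + \sum_(i <- r | P i) F i x else \sum_(i <- r | P i) F i x).
  by case Pi: (P i) => //; apply: is_deriveDf => //; exact: H.
by apply/funext => x; rewrite big_cons.
Qed.

Lemma CkD k f g : Ck k f -> Ck k g -> Ck k (fun t => f t + g t).
Proof.
elim: k f g => [|k IH] f g; first by move=> cf cg t; apply: cvgD; [exact: cf|exact: cg].
move=> [df Cf] [dg Cg].
refine (@Ck_of_deriv _ _ (fun t => (derive1 f) t + (derive1 g) t) _ _); last exact: IH.
by move=> t; apply: is_deriveDf; exact: is_derive_of.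
Qed.

Lemma CkM k f g : Ck k f -> Ck k g -> Ck k (fun t => f t * g t).
Proof.
elim: k f g => [|k IH] f g; first by move=> cf cg t; apply: cvgM; [exact: cf|exact: cg].
move=> Cf' Cg'; have [df Cf] := Cf'; have [dg Cg] := Cg'.
refine (@Ck_of_deriv _ _ (fun t => (derive1 f) t * g t + f t * (derive1 g) t) _ _).
  by move=> t; apply: is_deriveMf; exact: is_derive_of.
by apply: CkD; apply: IH => //; exact: CkW.
Qed.

Lemma CkZ k (c : R) f : Ck k f -> Ck k (fun t => c * f t).
Proof. by apply: CkM; exact: Ck_cst. Qed.

Lemma CkN k f : Ck k f -> Ck k (fun t => - f t).
Proof.
move=> Cf; apply: (@Ck_ext _ (fun t => -1 * f t)); last exact: CkZ.
by move=> t; rewrite mulN1r.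
Qed.

Lemma CkB k f g : Ck k f -> Ck k g -> Ck k (fun t => f t - g t).
Proof. by move=> Cf Cg; apply: CkD => //; exact: CkN. Qed.

Lemma Ck_sum k (I : Type) (r : seq I) (P : pred I) (F : I -> R -> R) :
  (forall i, P i -> Ck k (F i)) -> Ck k (fun t => \sum_(i <- r | P i) F i t).
Proof.
move=> H; elim: r => [|i r IH].
  by apply: (@Ck_ext _ (fun=> 0)); [move=> t; rewrite big_nil|exact: Ck_cst].
apply: (@Ck_ext _ (fun x => if P i then F i x + \sum_(i <- r | P i) F i x else \sum_(i <- r | P i) F i x)).
  by move=> x; rewrite big_cons.
by case Pi: (P i) => //; apply: CkD => //; exact: H.
Qed.

Lemma Ck_comp k f g : Ck k f -> Ck k g -> Ck k (fun t => g (f t)).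
Proof.
elim: k f g => [|k IH] f g.
  by move=> cf cg t; apply: continuous_comp; [exact: cf|exact: cg].
move=> Cf' Cg'; have [df Cf] := Cf'; have [dg Cg] := Cg'.
refine (@Ck_of_deriv _ _ (fun t => (derive1 g) (f t) * (derive1 f) t) _ _).
  by move=> t; apply: is_derive_compf; exact: is_derive_of.
by apply: CkM => //; apply: IH => //; exact: CkW.
Qed.

(** For functions that come with explicit formulas for all their derivatives, as the coordinates of
    [gamma] do. *)
Lemma Ck_seq k (F : nat -> R -> R) :
  (forall j t, (j < k)%N -> is_derive t 1 (F j) (F j.+1 t)) -> continuous (F k) ->
  Ck k (F 0%N) /\ forall j, (j <= k)%N -> derive1n j (F 0%N) = F j.
Proof.
move=> H cF; have E j : (j <= k)%N -> derive1n j (F 0%N) = F j.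
  elim: j => [//|j IH] jk; rewrite derive1nS IH ?(ltnW jk)//.
  by apply/funext => t; apply: derive1_is; exact: H.
split=> //; apply/CkP; split; last by rewrite E.
by move=> j t jk; rewrite E ?(ltnW jk)//; case: (H j t jk).
Qed.

Lemma near_derive1n f g t : {near t, f =1 g} ->
  forall k, {near t, derive1n k f =1 derive1n k g}.
Proof.
move=> fg; elim=> [//|k IH].
rewrite !derive1nS.
have := near_join IH; apply: filterS => x Hx.
by rewrite !derive1E; exact: near_eq_derive.
Qed.

Lemma near_Ck k f : (forall t, exists2 g, Ck k g & {near t, f =1 g}) -> Ck k f.
Proof.
move=> H; apply/CkP; split.
  move=> j t jk; have [g /CkP[dg _] fg] := H t.
  apply: (@near_eq_derivable _ _ _ (derive1n j g)); last exact: dg.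
  by apply: filterS (near_derive1n fg j) => x ->.
move=> t; have [g /CkP[_ cg] fg] := H t.
have E := near_derive1n fg k.
rewrite /continuous_at (nbhs_singleton E).
by apply: cvg_trans (cg t); apply: near_eq_cvg; apply: filterS E => x ->.
Qed.

Lemma derive1n_shift f (a : R) k t :
  derive1n k (fun x => f (x + a)) t = derive1n k f (t + a).
Proof.
elim: k t => [//|k IH] t; rewrite !derive1nS.
rewrite (_ : derive1n k (fun x => f (x + a)) = (fun x => derive1n k f (x + a))); last exact/funext.
rewrite /derive1; set F := (X in lim (X @ _)); set G := (X in _ = lim (X @ _)).
by have -> : F = G by apply/funext => h; rewrite /F /G addrA.
Qed.

Lemma derive0_cst f (a b : R) : (forall t, a < t < b -> is_derive t 1 f 0) ->
  forall x y, a < x < b -> a < y < b -> f x = f y.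
Proof.
move=> H; suff W x y : a < x < b -> a < y < b -> x <= y -> f x = f y.
  move=> x y hx hy; have [/W|/ltW/W] := leP x y; first exact.
  by move=> E; rewrite E.
move=> /andP[ax xb] /andP[ay yb] xy.
have [||c _ /eqP] := @MVT_segment R f (fun=> 0) x y xy.
- move=> z; rewrite in_itv /= => /andP[xz zy]; apply: H.
  by rewrite (lt_trans ax xz) (lt_trans zy yb).
- apply: derivable_within_continuous => z; rewrite in_itv /= => /andP[xz zy].
  have [] // := H z; by rewrite (lt_le_trans ax xz) (le_lt_trans zy yb).
- by rewrite mul0r subr_eq0 => /eqP ->.
Qed.

Lemma MVT_abs f (df : R -> R) (x y M : R) :
  (forall t, is_derive t 1 f (df t)) ->
  (forall t, Num.min x y <= t <= Num.max x y -> `|df t| <= M) ->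
  `|f x - f y| <= M * `|x - y|.
Proof.
move=> D; wlog xy : x y / x <= y => [W H|H].
  have [xy|/ltW yx] := leP x y; first exact: W.
  by rewrite distrC [`|x - y|]distrC; apply: W => // t; rewrite minC maxC; exact: H.
have [|c cab E] := @MVT_segment R f df x y xy.
  by apply: continuous_subspaceT; apply: derivable_cont => t; case: (D t).
rewrite distrC E normrM [`|x - y|]distrC ler_wpM2r// H//.
by move: cab; rewrite in_itv /= min_l// max_r.
Qed.

End Calculus.

(** * Primitives, cutoffs, smoothing by averages, periodic extension *)

Section Constructions.
Context {R : realType}.
Implicit Types (f g : R -> R) (k : nat) (t : R).

Lemma near_lt_eq (P : R -> Prop) (t r : R) : 0 < r ->
  (forall x, `|x - t| < r -> P x) -> \forall x \near t, P x.
Proof.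
move=> r0 H; apply/nbhs_ballP; exists r => //= x; rewrite /ball /= distrC; exact: H.
Qed.

Lemma antiderivative_gt (a : R) f : continuous f ->
  exists F : R -> R, forall t, a < t -> is_derive t 1 F (f t).
Proof.
move=> cf; exists (fun x => \int[lebesgue_measure]_(t in [set` `[a, x]]) f t)%R.
move=> t at_.
have [] := @continuous_FTC1 R f (BLeft a) t (t + 1) _ _ _ (cf t).
- by rewrite ltrDl.
- apply: continuous_compact_integrable; first exact: segment_compact.
  exact: continuous_subspaceT.
- by rewrite ?lte_fin.
by move=> d1 d2; apply: DeriveDef; [exact: d1|rewrite -derive1E; exact: d2].
Qed.

(** The integral from [-1] is a primitive on [t > -1], and its reflection for [f (- x)] one on
    [t < 1]. They differ by a constant on the overlap, so they glue. *)
Lemma antiderivative f : continuous f -> exists F : R -> R, forall t, is_derive t 1 F (f t).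
Proof.
move=> cf.
have [G HG] := antiderivative_gt (-1) cf.
have cfN : continuous (fun x => f (- x)).
  by move=> x; apply: continuous_comp; [exact: opp_continuous|exact: cf].
have [H HH] := antiderivative_gt (-1) cfN.
have HH' t : t < 1 -> is_derive t 1 (fun x => - H (- x)) (f t).
  move=> t1; have t2 : -1 < - t by rewrite ltrN2.
  have D := is_derive_compf (is_deriveNf (is_derive_id t 1)) (HH _ t2).
  by have := is_deriveNf D; rewrite mulrN1 !opprK.
have E x : -1 < x < 1 -> G x = - H (- x) + (G 0 + H 0).
  move=> x1; suff : G x + H (- x) = G 0 + H (- 0) by rewrite oppr0; lra.
  apply: (@derive0_cst _ (fun x => G x + H (- x)) (-1) 1) => // [t /andP[t1 t2]|].
    rewrite -(subrr (f t)); apply: is_deriveDf; first exact: HG.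
    have := is_deriveNf (HH' _ t2).
    by under eq_fun do rewrite opprK.
  by rewrite ltrN10 ltr01.
exists (fun x => if -1 < x then G x else - H (- x) + (G 0 + H 0)) => t.
have [t1|t1] := ltP (-1) t.
  apply: (@near_eq_is_derive _ _ _ G); last exact: HG.
  by near=> x; rewrite ifT//; near: x; exact: lt_nbhsr.
apply: (@near_eq_is_derive _ _ _ (fun x => - H (- x) + (G 0 + H 0))).
  near=> x; case: ifP => // x1; apply/esym/E; rewrite x1/=.
  near: x; apply: lt_nbhsl; lra.
rewrite -[f t]addr0; apply: is_deriveDf; first by apply: HH'; lra.
Unshelve. all: by end_near. Qed.

Lemma MVT_pos f (df : R -> R) (x y : R) : x < y -> (forall t, is_derive t 1 f (df t)) ->
  exists2 c, x < c < y & f y - f x = df c * (y - x).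
Proof.
move=> xy D; have [|c cab E] := @MVT R f df x y xy.
  by apply: continuous_subspaceT; apply: derivable_cont => t; case: (D t).
by exists c => //; move: cab; rewrite in_itv.
Qed.

Lemma ler_of_deriv f (df : R -> R) (x y : R) : (forall t, is_derive t 1 f (df t)) ->
  (forall t, 0 <= df t) -> x <= y -> f x <= f y.
Proof.
move=> D p; rewrite le_eqVlt => /predU1P[->//|xy].
have [c _ E] := MVT_pos xy D.
by rewrite -subr_ge0 E mulr_ge0// subr_ge0 ltW.
Qed.

(** Iterated primitives of [max 0 t]: up to a factor, the truncated power of degree [k.+1]. *)
Lemma flat_positive k : exists p : R -> R,
  [/\ Ck k p, forall t, t <= 0 -> p t = 0 & forall t, 0 < t -> 0 < p t].
Proof.
elim: k => [|k [p [Cp p0 pp]]].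
  exists (fun t => Num.max 0 t); split.
  - move=> t; apply: (@continuous_max _ _ (fun=> 0) (fun t => t)).
      exact: cst_continuous.
    exact: cvg_id.
  - by move=> t t0; rewrite max_l.
  - by move=> t t0; rewrite lt_max t0 orbT.
have [F D] := antiderivative (Ck_cont Cp).
exists (fun t => F t - F 0); split.
- apply: CkB; last exact: Ck_cst.
  exact: (Ck_of_deriv D).
- move=> t; rewrite le_eqVlt => /predU1P[->|t0]; first by rewrite subrr.
  have [c /andP[_ c0]] := MVT_pos t0 D.
  by rewrite p0 ?(ltW c0)// mul0r => /eqP; rewrite subr_eq0 => /eqP ->; rewrite subrr.
- move=> t t0; have [c /andP[c0 _] ->] := MVT_pos t0 D.
  by rewrite mulr_gt0 ?subr0// pp.
Qed.

(** The normalized primitive of the bump [p t * p (1 - t)], with [p] from [flat_positive]. *)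
Lemma cutoff k : exists b : R -> R,
  [/\ Ck k b, forall t, t <= 0 -> b t = 0, forall t, 1 <= t -> b t = 1,
      forall t, 0 <= b t <= 1 & forall t, derivable b t 1 /\ 0 <= derive1 b t].
Proof.
have [p [Cp p0 pp]] := flat_positive k.
have pge t : 0 <= p t by have [/p0->//|/pp/ltW] := leP t 0.
pose q t := p t * p (1 - t).
have q0 t : t <= 0 -> q t = 0 by move=> t0; rewrite /q p0// mul0r.
have q1 t : 1 <= t -> q t = 0 by move=> t1; rewrite /q [p (1 - t)]p0 ?mulr0//; lra.
have qge t : 0 <= q t by rewrite mulr_ge0.
have Cq : Ck k q.
  apply: CkM => //; apply: (@Ck_comp _ _ (fun t => 1 - t)) => //.
  by apply: CkB; [exact: Ck_cst|exact: Ck_id].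
have [F D] := antiderivative (Ck_cont Cq).
have F0 t : t <= 0 -> F t = F 0.
  rewrite le_eqVlt => /predU1P[->//|t0].
  have [c /andP[_ c0]] := MVT_pos t0 D.
  by rewrite q0 ?(ltW c0)// mul0r => /eqP; rewrite subr_eq0 => /eqP.
have F1 t : 1 <= t -> F t = F 1.
  rewrite le_eqVlt => /predU1P[<-//|t0].
  have [c /andP[c1 _]] := MVT_pos t0 D.
  by rewrite q1 ?(ltW c1)// mul0r => /eqP; rewrite subr_eq0 => /eqP.
have F01 : 0 < F 1 - F 0.
  have [c /andP[c0 c1] ->] := MVT_pos (@ltr01 R) D.
  by rewrite subr0 mulr1 mulr_gt0 ?pp//; lra.
pose A := (F 1 - F 0)^-1.
have A0 : 0 < A by rewrite invr_gt0.
have Db t : is_derive t 1 (fun t => A * (F t - F 0)) (A * q t).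
  apply: is_deriveZf; rewrite -[q t]subr0.
  by have := is_deriveDf (D t) (is_deriveNf (is_derive_cst (F 0) t 1)).
have mono x y : x <= y -> A * (F x - F 0) <= A * (F y - F 0).
  by apply: ler_of_deriv => // t; rewrite mulr_ge0 // ltW.
exists (fun t => A * (F t - F 0)); split.
- by apply: CkZ; apply: CkB; [exact: CkW (Ck_of_deriv D Cq)|exact: Ck_cst].
- by move=> t t0; rewrite F0// subrr mulr0.
- by move=> t t1; rewrite F1// /A mulVf// gt_eqF.
- move=> t; apply/andP; split.
    have [t0|/ltW t0] := leP t 0; first by rewrite F0// subrr mulr0.
    by have := mono _ _ t0; rewrite subrr mulr0.
  have E : A * (F 1 - F 0) = 1 by rewrite /A mulVf// gt_eqF.
  have [t1|/ltW t1] := leP t 1; first by rewrite -E mono.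
  by rewrite F1// E.
- by move=> t; split; [case: (Db t)|rewrite (derive1_is (Db t)) mulr_ge0// ltW].
Qed.

(* [g] is [f] averaged [k] times over a moving window of length [h]. *)
Lemma smoothing k f (h : R) : 0 < h -> continuous f -> exists g : R -> R,
  Ck k g /\ forall t a b, (forall y, t <= y <= t + h *+ k -> a <= f y <= b) -> a <= g t <= b.
Proof.
move=> h0 cf; elim: k => [|k [g [Cg Hg]]].
  by exists f; split => // t a b; apply; rewrite mulr0n addr0 lexx.
have [G D] := antiderivative (Ck_cont Cg).
exists (fun t => h^-1 * (G (t + h) - G t)); split.
  apply: CkZ; apply: CkB; last exact: (Ck_of_deriv D).
  apply: (@Ck_comp _ _ (fun t => t + h)); last exact: (Ck_of_deriv D).
  by apply: CkD; [exact: Ck_id|exact: Ck_cst].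
move=> t a b H.
have tth : t < t + h by rewrite ltrDl.
have [c /andP[c1 c2] ->] := MVT_pos tth D.
rewrite [t + h]addrC addrK mulrC mulfK ?gt_eqF//.
apply: Hg => y /andP[y1 y2]; apply: H; rewrite (le_trans (ltW c1) y1)/=.
by rewrite (le_trans y2)// mulrS addrA lerD2r ltW.
Qed.

(* The extension of [f], restricted to the period centred at [0], with
   [f (u + P) = f u + h]. *)
Definition qper (P h : R) f (u : R) : R :=
  let k := (Num.floor (u / P + 2^-1))%:~R in f (u - P * k) + k * h.

Lemma qper_shift (P h : R) f u : 0 < P -> qper P h f (u + P) = qper P h f u + h.
Proof.
move=> P0; rewrite /qper.
have -> : (u + P) / P + 2^-1 = u / P + 2^-1 + 1.
  by rewrite mulrDl divff ?gt_eqF// addrAC.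
rewrite (@floorDrz _ _ 1) ?intr1// floor1 intrD mulrDr mulr1 mulrDl mul1r addrA.
by congr (f _ + _ + _); lra.
Qed.

Lemma near_int (P u : R) : 0 < P -> exists k : int, `|u - P * k%:~R| <= P / 2.
Proof.
move=> P0; exists (Num.floor (u / P + 2^-1)).
have := floor_itv (u / P + 2^-1); set k := Num.floor _ => /andP[k1 k2].
have E : u = P * (u / P) by rewrite mulrC divfK// gt_eqF.
rewrite intrD in k2.
have h1 : P * k%:~R <= P * (u / P + 2^-1) by rewrite ler_pM2l.
have h2 : P * (u / P + 2^-1) < P * (k%:~R + 1) by rewrite ltr_pM2l.
rewrite ler_norml; apply/andP; lra.
Qed.

(** The extension is locally a single translate of [f], even at the seams halfway between multiples
    of [P]: there both neighbouring translates are constant, and adding [h] per period makes their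
    values agree. *)
Lemma qper_near (P h a : R) f u0 (k : int) : 0 <= a -> a < P / 2 ->
  (forall u, u <= - a -> f u = 0) -> (forall u, a <= u -> f u = h) ->
  `|u0 - P * k%:~R| <= P / 2 ->
  {near u0, qper P h f =1 fun u => f (u - P * k%:~R) + k%:~R * h}.
Proof.
move=> a0 aP f0 f1 uk.
have P0 : 0 < P by lra.
apply: (@near_lt_eq _ _ (P / 2 - a)) => [|u]; first lra.
rewrite /qper; have := floor_itv (u / P + 2^-1); set k' := Num.floor _ => /andP[k1 k2] uu.
have E : u = P * (u / P) by rewrite mulrC divfK// gt_eqF.
rewrite intrD in k2.
have h1 : P * k'%:~R <= P * (u / P + 2^-1) by rewrite ler_pM2l.
have h2 : P * (u / P + 2^-1) < P * (k'%:~R + 1) by rewrite ltr_pM2l.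
move: uk uu; rewrite ler_norml ltr_norml => /andP[u1 u2] /andP[v1 v2].
have [kk|kk|->//] := ltgtP k' k.
  have kk1 : (k'%:~R : R) + 1 <= k%:~R by rewrite -(intrD _ k' 1) ler_int lezD1.
  have kk1' : P * (k'%:~R + 1) <= P * k%:~R by rewrite ler_pM2l.
  have kk2 : k = k' + 1.
    apply/eqP; rewrite eq_le lezD1 kk andbT -ltzD1 -(ltr_int R) !intrD.
    by rewrite -(ltr_pM2l P0) !mulrDr !mulr1; lra.
  rewrite kk2 intrD f1; last by lra.
  rewrite f0; first by rewrite mulrDl mul1r; lra.
  lra.
have kk1 : (k%:~R : R) + 1 <= k'%:~R by rewrite -(intrD _ k 1) ler_int lezD1.
have kk1' : P * (k%:~R + 1) <= P * k'%:~R by rewrite ler_pM2l.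
have kk2 : k' = k + 1.
  apply/eqP; rewrite eq_le lezD1 kk andbT -ltzD1 -(ltr_int R) !intrD.
  by rewrite -(ltr_pM2l P0) !mulrDr !mulr1; lra.
rewrite kk2 intrD f0; last by rewrite kk2 intrD in h1 h2; lra.
rewrite f1; first by rewrite mulrDl mul1r; lra.
rewrite kk2 intrD in h1 h2; lra.
Qed.

Lemma Ck_shift k f (a : R) : Ck k f -> Ck k (fun x => f (x + a)).
Proof.
by apply: Ck_comp; apply: CkD; [exact: Ck_id|exact: Ck_cst].
Qed.

Lemma Ck_qper (P h a : R) f k : 0 <= a -> a < P / 2 ->
  (forall u, u <= - a -> f u = 0) -> (forall u, a <= u -> f u = h) -> Ck k f ->
  Ck k (qper P h f).
Proof.
move=> a0 aP f0 f1 Cf; apply: near_Ck => u.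
have P0 : 0 < P by lra.
have [m um] := near_int u P0.
exists (fun u => f (u - P * m%:~R) + m%:~R * h); last exact: (qper_near a0 aP f0 f1 um).
by apply: CkD; [exact: (Ck_shift (- (P * m%:~R)))|exact: Ck_cst].
Qed.

Lemma compact_unif_cont f (a b e : R) : continuous f -> 0 < e ->
  exists2 d, 0 < d & forall x y, a <= x <= b -> `|x - y| < d -> `|f x - f y| < e.
Proof.
move=> cf e0; have e20 : 0 < e / 2 by rewrite divr_gt0.
have := segment_compact (a := a) (b := b); rewrite compact_near_coveringP.
move=> /(_ R (at_right (0:R)) (fun d x => forall y, `|x - y| < d -> `|f x - f y| < e)).
case.
  move=> x _; have /nbhs_ballP[r /= r0 Hr] : nbhs (x : R) (fun t => `|f x - f t| < e / 2).
    exact: (cvgrPdist_lt _ _).1 (cf x) _ e20.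
  exists (ball x (r / 2), `]0, (r / 2)[%classic).
    split => /=; first by apply: nbhsx_ballx; rewrite divr_gt0.
    by near=> d => /=; rewrite in_itv/=; apply/andP; split; near: d;
      [exact: nbhs_right_gt|apply: nbhs_right_lt; rewrite divr_gt0].
  move=> [x' d] /= [bx]; rewrite in_itv/= => /andP[d0 dr] y yd.
  have h1 : `|f x - f x'| < e / 2.
    by apply: Hr; move: bx; rewrite /ball/= => bx; lra.
  have h2 : `|f x - f y| < e / 2.
    apply: Hr; move: bx; rewrite /ball/= => bx.
    by have := ler_distD x' x y; lra.
  by have := ler_distD (f x) (f x') (f y); rewrite [`|f x' - f x|]distrC; lra.
move=> r /= r0 Hr; exists (r / 2); first by rewrite divr_gt0.
have r20 : 0 < r / 2 by rewrite divr_gt0.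
have rb : ball_ [eta Num.Def.normr] 0 r (r / 2).
  by rewrite /ball_ /= sub0r normrN gtr0_norm//; lra.
by move=> x y xab; apply: (Hr _ rb r20); rewrite /= in_itv.
Unshelve. all: by end_near. Qed.

End Constructions.

(** * Higher derivatives: scaled bounds, divided powers, triangular systems *)

Section Jets.
Context {R : realType}.
Implicit Types (f g : R -> R) (k : nat) (t : R).

Lemma derive1nD k f g : Ck k f -> Ck k g ->
  derive1n k (fun t => f t + g t) = fun t => derive1n k f t + derive1n k g t.
Proof.
elim: k f g => [//|k IH] f g [df Cf] [dg Cg].
rewrite !derive1Sn -IH//; congr (derive1n k _); apply/funext => t.
by apply: derive1_is; apply: is_deriveDf; exact: is_derive_of.
Qed.

Lemma derive1nZ k (c : R) f : Ck k f ->
  derive1n k (fun t => c * f t) = fun t => c * derive1n k f t.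
Proof.
elim: k f => [//|k IH] f [df Cf].
rewrite !derive1Sn -IH//; congr (derive1n k _); apply/funext => t.
by apply: derive1_is; apply: is_deriveZf; exact: is_derive_of.
Qed.

Lemma derive1n_cst k (c : R) : derive1n k.+1 (fun=> c) = fun=> 0 :> R.
Proof.
have E (d : R) : derive1 (fun=> d) = fun=> 0 :> R.
  by apply/funext => t; apply: derive1_is; exact: is_derive_cst.
by elim: k => [|k IH]; [exact: E|rewrite derive1nS IH E].
Qed.

Lemma derive1n_sum k (I : Type) (r : seq I) (F : I -> R -> R) : (forall i, Ck k (F i)) ->
  derive1n k (fun t => \sum_(i <- r) F i t) = fun t => \sum_(i <- r) derive1n k (F i) t.
Proof.
move=> C; elim: r => [|i r IH].
  rewrite (_ : (fun t => _) = (fun=> 0)); last by apply/funext => t; rewrite big_nil.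
  rewrite [RHS](_ : _ = fun=> 0); last by apply/funext => t; rewrite big_nil.
  by case: k {C} => // k; rewrite derive1n_cst.
rewrite (_ : (fun t => _) = (fun t => F i t + \sum_(i <- r) F i t)); last first.
  by apply/funext => t; rewrite big_cons.
rewrite derive1nD//; last by apply: Ck_sum => j _; exact: C.
by apply/funext => t; rewrite IH big_cons.
Qed.

Lemma derive1n_dilate k (c : R) f : Ck k f ->
  derive1n k (fun t => f (c * t)) = fun t => c ^+ k * derive1n k f (c * t).
Proof.
elim: k f => [|k IH] f; first by move=> _; apply/funext => t; rewrite expr0 mul1r.
move=> [df Cf].
rewrite !derive1Sn (_ : derive1 (fun t => f (c * t)) = (fun t => c * derive1 f (c * t))).
  have C : Ck k (fun t => derive1 f (c * t)).
    by apply: (@Ck_comp _ _ (fun t => c * t)) => //; apply: CkZ; exact: Ck_id.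
  by rewrite derive1nZ// IH//; apply/funext => t; rewrite mulrA -exprS.
apply/funext => t; apply: derive1_is; rewrite mulrC.
have := is_derive_compf (is_deriveZf c (is_derive_id t 1)) (is_derive_of (df (c * t))).
by rewrite mulr1.
Qed.

Definition Jb k (A r : R) f t := forall i, (i <= k)%N -> `|derive1n i f t| <= A * r ^+ i.

(** Leibniz: the binomial coefficients of order [i] add up to [2 ^ i], which doubling [r]
    absorbs. *)
Lemma Jb_mul k (A B r : R) f g t : 0 <= r -> Ck k f -> Ck k g ->
  Jb k A r f t -> Jb k B r g t -> Jb k (A * B) (r *+ 2) (fun t => f t * g t) t.
Proof.
move=> r0; elim: k A B f g => [|k IH] A B f g Cf Cg Jf Jg [_|i ik].
- rewrite !expr0 mulr1 normrM; have := Jf 0%N isT; have := Jg 0%N isT.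
  by rewrite !expr0 !mulr1 => ? ?; exact: ler_pM.
- by [].
- rewrite !expr0 mulr1 normrM; have := Jf 0%N isT; have := Jg 0%N isT.
  by rewrite !expr0 !mulr1 => ? ?; exact: ler_pM.
have [df Cf'] := Cf; have [dg Cg'] := Cg.
have E : derive1 (fun t => f t * g t) = fun t => derive1 f t * g t + f t * derive1 g t.
  by apply/funext => x; apply: derive1_is; apply: is_deriveMf; exact: is_derive_of.
have Jf1 : Jb k (A * r) r (derive1 f) t.
  by move=> j jk; rewrite -derive1Sn -mulrA -exprS; exact: Jf.
have Jg1 : Jb k (B * r) r (derive1 g) t.
  by move=> j jk; rewrite -derive1Sn -mulrA -exprS; exact: Jg.
have Jf0 : Jb k A r f t by move=> j jk; apply: Jf; exact: leqW.
have Jg0 : Jb k B r g t by move=> j jk; apply: Jg; exact: leqW.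
have H1 := IH _ _ _ _ Cf' (CkW Cg) Jf1 Jg0 i ik.
have H2 := IH _ _ _ _ (CkW Cf) Cg' Jf0 Jg1 i ik.
rewrite derive1Sn E derive1nD.
- rewrite (le_trans (ler_normD _ _))// (le_trans (lerD H1 H2))// exprS.
  by rewrite le_eqVlt; apply/orP; left; apply/eqP; ring.
- by apply: (@Ck_le _ i k _ ik); apply: CkM => //; exact: CkW.
- by apply: (@Ck_le _ i k _ ik); apply: CkM => //; exact: CkW.
Qed.

(** Taylor's remainder estimate without the factorial, by descending from the [m]-th derivative with
    the mean value inequality. *)
Lemma flat_bound m f (M r : R) : Ck m f -> (forall i, (i < m)%N -> derive1n i f 0 = 0) ->
  (forall u, `|u| <= r -> `|derive1n m f u| <= M) ->
  forall i u, (i <= m)%N -> `|u| <= r -> `|derive1n i f u| <= M * `|u| ^+ (m - i).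
Proof.
elim: m f => [|m IH] f Cf f0 fM i u.
  by rewrite leqn0 => /eqP -> ur; rewrite subnn expr0 mulr1 fM.
have [df Cf'] := Cf.
have IH' := IH _ Cf' (fun i im => etrans (congr1 (fun F => F 0) (esym (derive1Sn f i))) (f0 i.+1 im)).
have {}IH' : forall i u, (i <= m)%N -> `|u| <= r -> `|derive1n i.+1 f u| <= M * `|u| ^+ (m - i).
  by move=> j v jm vr; rewrite derive1Sn; apply: IH' => // w wr; rewrite -derive1Sn; exact: fM.
case: i => [_|i im] ur; last by rewrite subSS; exact: IH'.
rewrite -[X in `|X|]subr0 -(f0 0%N isT) subn0 exprSr mulrA -[X in _ * `|X|](subr0 u).
apply: (@MVT_abs _ f (derive1 f)) => [t|t /andP[t1 t2]]; first exact: is_derive_of.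
have tu : `|t| <= `|u|.
  move: t1 t2; have [u0|u0] := leP 0 u.
    by move=> t1 t2; rewrite !ger0_norm.
  by move=> t1 t2; rewrite !ler0_norm ?lerN2 // ltW.
have M0 : 0 <= M by apply: le_trans (fM u ur).
apply: (@le_trans _ _ (M * `|t| ^+ m)); first by have := IH' 0%N t isT (le_trans tu ur); rewrite subn0.
by rewrite ler_wpM2l// lerXn2r.
Qed.

Definition pw l (u : R) : R := u ^+ l / l`!%:R.

Lemma is_derive_pw l (u : R) : is_derive u 1 (pw l) (if l is l'.+1 then pw l' u else 0).
Proof.
case: l => [|l].
  rewrite (_ : pw 0 = fun=> 1); first exact: is_derive_cst.
  by apply/funext => x; rewrite /pw expr0 fact0 divr1.
have D : is_derive u 1 (fun x : R => x ^+ l.+1) (l.+1%:R * u ^+ l).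
  apply: DeriveDef; first exact: exprn_derivable.
  by rewrite exp_derive /GRing.scale/= mulr1.
have := is_deriveZf (l.+1`!%:R)^-1 D.
rewrite (_ : (fun x => _) = pw l.+1); last by apply/funext => x; rewrite /pw mulrC.
rewrite (_ : _^-1 * _ = pw l u)// /pw factS natrM invfM.
have l0 : (l.+1%:R : R) != 0 by rewrite pnatr_eq0.
by rewrite mulrACA mulVf// mul1r mulrC.
Qed.

Lemma Ck_pw k l : Ck k (pw l).
Proof.
elim: k l => [|k IH] [|l].
- by apply: derivable_cont => t; case: (is_derive_pw 0 t).
- by apply: derivable_cont => t; case: (is_derive_pw l.+1 t).
- by refine (@Ck_of_deriv _ _ _ (fun=> 0) (is_derive_pw 0) _); exact: Ck_cst.
- by refine (@Ck_of_deriv _ _ _ (pw l) (is_derive_pw l.+1) _).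
Qed.

Lemma derive1n_pw k l : derive1n k (pw l) = if (k <= l)%N then pw (l - k) else fun=> 0.
Proof.
elim: k l => [|k IH] l; first by rewrite subn0.
rewrite derive1Sn; have -> : derive1 (pw l) = fun u => if l is l'.+1 then pw l' u else 0.
  by apply/funext => u; apply: derive1_is; exact: is_derive_pw.
case: l => [|l]; last by rewrite (_ : (fun u => pw l u) = pw l)// IH ltnS subSS.
by case: k {IH} => // k; rewrite derive1n_cst.
Qed.

Lemma pw0 l : pw l 0 = (l == 0%N)%:R.
Proof. by rewrite /pw expr0n; case: l => [|l]; rewrite ?fact0 ?divr1//= mul0r. Qed.

(* If [E_j' = l_j E_(j+1)] for all [j], the [k]-th derivative of [E_0] is
   [\sum_j bf l k j E_j]. *)
Fixpoint bf (l : nat -> R -> R) k (j : nat) : R -> R :=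
  if k is k'.+1 then
    fun t => derive1 (bf l k' j) t + (if j is j'.+1 then l j' t * bf l k' j' t else 0)
  else fun=> (j == 0%N)%:R.

Lemma Ck_bf (l : nat -> R -> R) m k j : (forall j, Ck (k + m) (l j)) -> Ck m (bf l k j).
Proof.
elim: k m j => [|k IH] m j C; first exact: Ck_cst.
have C' : forall j, Ck (k + m.+1) (l j) by move=> i; rewrite addnS -addSn.
apply: CkD; first by case: (IH m.+1 j C').
case: j => [|j]; first exact: Ck_cst.
apply: CkM; last by apply: CkW; exact: IH.
by apply: Ck_le (C j); rewrite leq_addl.
Qed.

Lemma bf_gt l k j t : (k < j)%N -> bf l k j t = 0.
Proof.
elim: k j t => [|k IH] [|j] t //= kj; rewrite IH//.
rewrite mulr0 addr0; rewrite (_ : bf l k j.+1 = fun=> 0); last by apply/funext => x; rewrite IH// ltnW.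
by apply: derive1_is; exact: is_derive_cst.
Qed.

(** These diagonal products are all that the curvatures see of the matrix [bf]; compare
    [tri_curv]. *)
Lemma bf_diag l k t : bf l k k t = \prod_(i < k) l i t.
Proof.
elim: k t => [|k IH] t; first by rewrite big_ord0.
rewrite /= IH big_ord_recr/= mulrC (_ : bf l k k.+1 = fun=> 0); last by apply/funext => x; rewrite bf_gt.
by rewrite (derive1_is (is_derive_cst _ _ _)) add0r.
Qed.

(** Derivatives of positive order do not involve [E_0], so the system is still triangular when
    indices start at 1, as [tri_curv] requires. *)
Lemma bf_S0 l k t : bf l k.+1 0 t = 0.
Proof.
have cst0 (c : R) : derive1 (fun=> c) t = 0.
  by apply: derive1_is; exact: is_derive_cst.
elim: k t cst0 => [|k IH] t cst0; first by rewrite /= addr0 cst0.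
rewrite [LHS](_ : _ = derive1 (bf l k.+1 0) t + 0)// (_ : bf l k.+1 0 = fun=> 0) ?cst0 ?addr0//.
apply/funext => x; apply: IH => c.
by apply: derive1_is; exact: is_derive_cst.
Qed.

Lemma derive1n_tri (l E : nat -> R -> R) M : (forall j, Ck M (l j)) ->
  (forall j t, (j < M)%N -> is_derive t 1 (E j) (l j t * E j.+1 t)) ->
  forall k t, (k <= M)%N -> derive1n k (E 0%N) t = \sum_(j < k.+1) bf l k j t * E j t.
Proof.
move=> C D; elim=> [|k IH] t kM; first by rewrite big_ord_recl big_ord0 /= mul1r addr0.
rewrite derive1nS (_ : derive1n k (E 0%N) = fun t => \sum_(j < k.+1) bf l k j t * E j t); last first.
  by apply/funext => x; apply: IH; exact: ltnW.
apply: derive1_is.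
have dbf j : is_derive t 1 (bf l k j) (derive1 (bf l k j) t).
  apply: is_derive_of; have [] // := @Ck_bf l 1 k j.
  by move=> i; apply: Ck_le (C i); rewrite addn1.
have DD (j : 'I_k.+1) : is_derive t 1 (fun t => bf l k j t * E j t)
    (derive1 (bf l k j) t * E j t + bf l k j t * (l j t * E j.+1 t)).
  by apply: is_deriveMf => //; apply: D; rewrite (leq_trans (ltn_ord j)).
have := @is_derive_sumf _ _ (index_enum 'I_k.+1) xpredT _ _ t (fun j _ => DD j).
rewrite [X in is_derive _ _ _ X -> _](_ : _ = \sum_(j < k.+2) bf l k.+1 j t * E j t)//.
rewrite big_split /= [RHS]big_ord_recl /= addr0.
under [in RHS]eq_bigr do rewrite mulrDl.
rewrite big_split /= addrA; congr (_ + _); last first.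
  by apply: eq_bigr => j _; rewrite mulrA [_ * l _ _]mulrC.
rewrite big_ord_recl/=; congr (_ + _).
rewrite [RHS]big_ord_recr /= (_ : bf l k k.+1 = fun=> 0); last by apply/funext => x; rewrite bf_gt.
by rewrite (derive1_is (is_derive_cst _ _ _)) mul0r addr0.
Qed.

End Jets.

(** * Gram-Schmidt, cross product and curvatures of an abstract jet *)

Section GramSchmidt.
Context {R : realType}.
Implicit Types m k : nat.

Lemma dotvC m (u v : 'rV[R]_m) : dotv u v = dotv v u.
Proof. by apply: eq_bigr => i _; rewrite mulrC. Qed.

Lemma dotvDl m (u v w : 'rV[R]_m) : dotv (u + v) w = dotv u w + dotv v w.
Proof. by rewrite -big_split; apply: eq_bigr => i _; rewrite mxE mulrDl. Qed.

Lemma dotvZl m (a : R) (u w : 'rV[R]_m) : dotv (a *: u) w = a * dotv u w.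
Proof. by rewrite /dotv big_distrr /=; apply: eq_bigr => i _; rewrite mxE mulrA. Qed.

Lemma dotvDr m (u v w : 'rV[R]_m) : dotv w (u + v) = dotv w u + dotv w v.
Proof. by rewrite dotvC dotvDl ![dotv w _]dotvC. Qed.

Lemma dotvZr m (a : R) (u w : 'rV[R]_m) : dotv w (a *: u) = a * dotv w u.
Proof. by rewrite dotvC dotvZl dotvC. Qed.

Lemma dotvNl m (u w : 'rV[R]_m) : dotv (- u) w = - dotv u w.
Proof. by rewrite -scaleN1r dotvZl mulN1r. Qed.

Lemma dotvBl m (u v w : 'rV[R]_m) : dotv (u - v) w = dotv u w - dotv v w.
Proof. by rewrite dotvDl dotvNl. Qed.

Lemma dotv0l m (w : 'rV[R]_m) : dotv 0 w = 0.
Proof. by rewrite -(scale0r 0) dotvZl mul0r. Qed.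

Lemma dotv0r m (w : 'rV[R]_m) : dotv w 0 = 0.
Proof. by rewrite dotvC dotv0l. Qed.

Lemma dotv_suml m (I : Type) (r : seq I) (P : pred I) (F : I -> 'rV[R]_m) w :
  dotv (\sum_(i <- r | P i) F i) w = \sum_(i <- r | P i) dotv (F i) w.
Proof.
by elim/big_rec2: _ => [|i y x _ <-]; [exact: dotv0l|rewrite dotvDl].
Qed.

Lemma dotvE m (u v : 'rV[R]_m) : dotv u v = (u *m v^T) 0 0.
Proof. by rewrite mxE; apply: eq_bigr => i _; rewrite mxE. Qed.

Lemma dotv_ge0 m (u : 'rV[R]_m) : 0 <= dotv u u.
Proof. by apply: sumr_ge0 => i _; rewrite -expr2 sqr_ge0. Qed.

Lemma dotv_eq0 m (u : 'rV[R]_m) : (dotv u u == 0) = (u == 0).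
Proof.
apply/eqP/eqP => [H|->]; last exact: dotv0l.
apply/rowP => i; rewrite mxE.
have /eqP := H; rewrite psumr_eq0 => [|j _]; last by rewrite -expr2 sqr_ge0.
by move=> /allP /(_ i (mem_index_enum i)); rewrite /= mulf_eq0 orbb => /eqP.
Qed.

Lemma enorm_sqr m (u : 'rV[R]_m) : enorm u ^+ 2 = dotv u u.
Proof. by rewrite sqr_sqrtr// dotv_ge0. Qed.

Lemma enorm_eq0 m (u : 'rV[R]_m) : (enorm u == 0) = (u == 0).
Proof. by rewrite -sqrf_eq0 enorm_sqr dotv_eq0. Qed.

Lemma enorm_gt0 m (u : 'rV[R]_m) : u != 0 -> 0 < enorm u.
Proof. by move=> u0; rewrite lt_def enorm_eq0 u0 sqrtr_ge0. Qed.

(* [gsu v k] tabulates the Gram-Schmidt vectors of index at most [k]; a direct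
   recursion for [gs] would not be structural. *)
Fixpoint gsu m (v : nat -> 'rV[R]_m) k (j : nat) : 'rV[R]_m :=
  if k is k'.+1 then
    if j == k then
      let u := v k - \sum_(1 <= i < k) dotv (v k) (gsu v k' i) *: gsu v k' i in
      (enorm u)^-1 *: u
    else gsu v k' j
  else 0.

Definition gs m v k : 'rV[R]_m := gsu v k k.

Definition gr m (v : nat -> 'rV[R]_m) k :=
  v k - \sum_(1 <= j < k) dotv (v k) (gs v j) *: gs v j.

Lemma gsu_le m (v : nat -> 'rV[R]_m) k j : (j <= k)%N -> gsu v k j = gs v j.
Proof.
elim: k => [|k IH]; first by rewrite leqn0 => /eqP ->.
rewrite leq_eqVlt => /predU1P[->//|jk].
by rewrite /= (ltn_eqF jk) IH.
Qed.

Lemma gsE m (v : nat -> 'rV[R]_m) k : (1 <= k)%N ->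
  gs v k = (enorm (gr v k))^-1 *: gr v k.
Proof.
case: k => // k _; rewrite {1}/gs /= eqxx.
have -> // : v k.+1 - \sum_(1 <= i < k.+1) dotv (v k.+1) (gsu v k i) *: gsu v k i = gr v k.+1.
congr (_ - _); rewrite big_nat_cond [RHS]big_nat_cond; apply: eq_bigr => i.
by rewrite andbT => /andP[_ ik]; rewrite gsu_le.
Qed.

Lemma gram_schmidt_gs m n (v : nat -> 'rV[R]_m) : gram_schmidt n v (gs v).
Proof. by move=> k /andP[k1 _]; exact: gsE. Qed.

(** Linear independence of [v 1], ..., [v n], in the form in which Gram-Schmidt meets it. *)
Definition gs_ok m n (v : nat -> 'rV[R]_m) :=
  forall k, (1 <= k <= n)%N -> gr v k != 0.

Lemma gs_orthonormal m n (v : nat -> 'rV[R]_m) : gs_ok n v ->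
  forall i j, (1 <= i <= n)%N -> (1 <= j <= n)%N ->
  dotv (gs v i) (gs v j) = (i == j)%:R.
Proof.
move=> ok; suff W k : forall i j, (1 <= i <= n)%N -> (1 <= j <= n)%N ->
    (i <= k)%N -> (j <= k)%N -> dotv (gs v i) (gs v j) = (i == j)%:R.
  by move=> i j hi hj; apply: (W n) => //; [case/andP: hi|case/andP: hj].
elim: k => [|k IH] i j hi hj.
  by rewrite leqn0 => /eqP i0; rewrite i0 in hi.
have low i' : (1 <= i' <= k)%N -> (1 <= k.+1 <= n)%N -> dotv (gs v k.+1) (gs v i') = 0.
  move=> hi' hk; rewrite (gsE v (k := k.+1))// dotvZl dotvBl dotv_suml.
  rewrite (bigD1_seq i') /=; last exact: iota_uniq.
    rewrite dotvZl IH ?eqxx ?mulr1; last by case/andP: hi'.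
      rewrite big_nat_cond big1 ?addr0 ?subrr ?mulr0// => l /andP[/andP[l1 lk] li].
      rewrite dotvZl IH//; last by case/andP: hi'.
        by rewrite (negbTE li) mulr0.
      by rewrite l1 -ltnS (leq_trans lk)// ltnW//; case/andP: hk.
      case/andP: hi' => -> ik; case/andP: hk => _ kn; exact: (leq_trans ik (ltnW kn)).
      case/andP: hi' => -> ik; case/andP: hk => _ kn; exact: (leq_trans ik (ltnW kn)).
      case/andP: hi' => -> ik; case/andP: hk => _ kn; exact: (leq_trans ik (ltnW kn)).
    by case/andP: hi'.
  by rewrite mem_index_iota ltnS.
rewrite leq_eqVlt => /predU1P[ik|ik]; rewrite leq_eqVlt => /predU1P[jk|jk].
- subst i j; rewrite eqxx gsE// dotvZl dotvZr -enorm_sqr.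
  have : enorm (gr v k.+1) != 0 by rewrite enorm_eq0 ok.
  by move=> e0; rewrite expr2 [X in _ * X]mulrA mulVf// mul1r mulVf.
- subst i; rewrite low//; last by case/andP: hj => ->.
  by rewrite eq_sym ltn_eqF.
- subst j; rewrite dotvC low//; last by case/andP: hi => ->.
  by rewrite ltn_eqF.
- exact: IH.
Qed.

Lemma gr_dec m (v : nat -> 'rV[R]_m) k : (1 <= k)%N -> gr v k != 0 ->
  gr v k = enorm (gr v k) *: gs v k.
Proof.
by move=> k1 g0; rewrite gsE// scalerA divff ?scale1r// enorm_eq0.
Qed.

Lemma v_dec m n (v : nat -> 'rV[R]_m) k : gs_ok n v -> (1 <= k <= n)%N ->
  v k = enorm (gr v k) *: gs v k + \sum_(1 <= j < k) dotv (v k) (gs v j) *: gs v j.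
Proof.
by move=> ok hk; rewrite -gr_dec ?ok ?subrK//; case/andP: hk.
Qed.

Lemma dotv_v_gs_gt m n (v : nat -> 'rV[R]_m) k w : gs_ok n v -> (1 <= k <= n)%N ->
  (forall j, (1 <= j <= k)%N -> dotv (gs v j) w = 0) -> dotv (v k) w = 0.
Proof.
move=> ok hk H; rewrite (v_dec ok hk) dotvDl dotvZl H; last by case/andP: hk => -> _ /=.
rewrite mulr0 add0r dotv_suml big_nat_cond big1// => j.
by rewrite andbT => /andP[j1 jk]; rewrite dotvZl H ?mulr0// j1 ltnW.
Qed.

Lemma dotv_v_gs m n (v : nat -> 'rV[R]_m) k : gs_ok n v -> (1 <= k <= n)%N ->
  dotv (v k) (gs v k) = enorm (gr v k).
Proof.
move=> ok hk; rewrite (v_dec ok hk) dotvDl dotvZl (gs_orthonormal ok)// eqxx mulr1.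
rewrite dotv_suml big_nat_cond big1 ?addr0 -?(v_dec ok hk)// => j.
rewrite andbT => /andP[j1 jk]; rewrite dotvZl (gs_orthonormal ok)//.
  by rewrite ltn_eqF// mulr0.
by rewrite j1; case/andP: hk => _; exact: (leq_trans (ltnW jk)).
Qed.

(* The generalized cross product of [e 1], ..., [e n]. *)
Definition cross n (e : nat -> 'rV[R]_n.+1) : 'rV[R]_n.+1 :=
  \row_j cofactor (\matrix_(i < n.+1) (if (i : nat) == n then 0 else e i.+1)) ord_max j.

(** Laplace expansion along the last row. The cofactors do not see that row, so [cross] may put 0
    there. *)
Lemma det_cross n (e : nat -> 'rV[R]_n.+1) x :
  \det (\matrix_(i < n.+1) (if (i : nat) == n then x else e i.+1)) = dotv x (cross e).
Proof.
rewrite (expand_det_row _ ord_max); apply: eq_bigr => j _; rewrite !mxE eqxx.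
congr (_ * _); rewrite /cofactor; congr (_ * \det _).
apply/matrixP => a b; rewrite !mxE; have := lift_max a => /= E.
by rewrite E !(ltn_eqF (ltn_ord a)).
Qed.

Lemma dotv_cross n (e : nat -> 'rV[R]_n.+1) k : (1 <= k <= n)%N -> dotv (e k) (cross e) = 0.
Proof.
case: k => // k /andP[_ kn]; rewrite -det_cross.
have i1 : inord k != ord_max :> 'I_n.+1.
  by rewrite -val_eqE /= inordK ?ltn_eqF// ltnS ltnW.
apply: (determinant_alternate i1) => j; rewrite !mxE eqxx.
by rewrite inordK ?(ltn_eqF kn)// ltnS ltnW.
Qed.

Lemma orth_compl m n (E : 'M[R]_(m, n.+1)) : (m <= n)%N ->
  exists2 x : 'rV[R]_n.+1, x != 0 & forall i, dotv (row i E) x = 0.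
Proof.
move=> mn; have : kermx E^T != 0.
  rewrite -mxrank_eq0 mxrank_ker -lt0n subn_gt0 mxrank_tr ltnS.
  exact: leq_trans (rank_leq_row E) mn.
case/rowV0Pn => x /sub_kermxP xE x0; exists x => // i.
have /matrixP /(_ 0 i) := xE; rewrite !mxE => H; rewrite dotvC -[RHS]H.
by apply: eq_bigr => j _; rewrite !mxE.
Qed.

Definition onb n (e : nat -> 'rV[R]_n.+1) k :=
  forall i j, (1 <= i <= k)%N -> (1 <= j <= k)%N -> dotv (e i) (e j) = (i == j)%:R.

Definition framemx n (e : nat -> 'rV[R]_n.+1) := \matrix_(i < n.+1) e i.+1.

Lemma onb_mx n (e : nat -> 'rV[R]_n.+1) : onb e n.+1 -> framemx e *m (framemx e)^T = 1%:M.
Proof.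
move=> H; apply/matrixP => i j; rewrite [RHS]mxE -(H i.+1 j.+1) ?ltn_ord//.
by rewrite mxE; apply: eq_bigr => k _; rewrite !mxE.
Qed.

Lemma dotv_mx m p (u v : 'rV[R]_m) (O : 'M[R]_(m, p)) : O *m O^T = 1%:M ->
  dotv (u *m O) (v *m O) = dotv u v.
Proof. by move=> H; rewrite !dotvE trmx_mul -mulmxA (mulmxA O) H mul1mx. Qed.

Lemma onb_dec n (e : nat -> 'rV[R]_n.+1) x : onb e n.+1 ->
  x = \sum_(i < n.+1) dotv x (e i.+1) *: e i.+1.
Proof.
move=> /onb_mx /mulmx1C H; rewrite -[LHS]mulmx1 -H mulmxA.
rewrite mulmx_sum_row; apply: eq_bigr => i _; rewrite rowK; congr (_ *: _).
by rewrite mxE; apply: eq_bigr => j _; rewrite !mxE.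
Qed.

(** A Gram determinant gives [dotv x (cross e) ^+ 2 = dotv x x] for every [x] orthogonal to all
    [e k]. A nonzero such [x] shows [cross e != 0]; then [x = cross e] gives [c ^+ 2 = c] for its
    squared length [c]. *)
Lemma cross_unit n (e : nat -> 'rV[R]_n.+1) : onb e n -> dotv (cross e) (cross e) = 1.
Proof.
move=> ob.
have sq x : (forall k, (1 <= k <= n)%N -> dotv (e k) x = 0) -> dotv x (cross e) ^+ 2 = dotv x x.
  move=> xe; rewrite -det_cross; set M := \matrix_i _.
  rewrite expr2 -[X in _ * X]det_tr -det_mulmx.
  have -> : M *m M^T = diag_mx (\row_(i < n.+1) if (i : nat) == n then dotv x x else 1).
    apply/matrixP => i j; rewrite [LHS](_ : _ = dotv (row i M) (row j M)); last first.
      by rewrite mxE; apply: eq_bigr => k _; rewrite !mxE.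
    rewrite !rowK !mxE.
    case: (i =P n :> nat) => [im|/eqP im]; case: (j =P n :> nat) => [jm|/eqP jm].
    - have -> : i = j by apply: val_inj; rewrite /= im jm.
      by rewrite eqxx.
    - rewrite dotvC xe; last by rewrite /= ltn_neqAle jm -ltnS ltn_ord.
      by case: eqP => // ij; rewrite -ij im eqxx in jm.
    - rewrite xe; last by rewrite /= ltn_neqAle im -ltnS ltn_ord.
      by case: eqP => // ij; rewrite ij jm eqxx in im.
    - by rewrite ob ?eqSS//= ltn_neqAle ?im ?jm -ltnS ltn_ord.
  rewrite det_diag (bigD1 ord_max)//= mxE eqxx big1 ?mulr1// => i im.
  rewrite mxE ifN//; apply: contra im => /eqP im; apply/eqP; exact: val_inj.
have [x x0 xe] := orth_compl (\matrix_(i < n) e i.+1) (leqnn n).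
have {}xe k : (1 <= k <= n)%N -> dotv (e k) x = 0.
  by case: k => // k /andP[_ kn]; rewrite -(xe (Ordinal kn)) rowK.
have c0 : cross e != 0.
  apply: contra x0 => /eqP c0; rewrite -dotv_eq0 -sq//.
  by rewrite c0 dotv0r expr0n.
have H : dotv (cross e) (cross e) ^+ 2 = dotv (cross e) (cross e).
  by apply: sq => k hk; exact: dotv_cross.
have d0 : dotv (cross e) (cross e) != 0 by rewrite dotv_eq0.
by apply: (mulfI d0); rewrite -expr2 H mulr1.
Qed.

(** The last vector comes from [cross] and not from [v n.+1], which depends on the others when the
    last curvature vanishes. *)
Definition fr n (v : nat -> 'rV[R]_n.+1) k := if k == n.+1 then cross (gs v) else gs v k.

(* For the jet [v] of a curve, [dd v k = <v_k, e_k>], and the [k]-th curvature is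
   [dd v k.+1 / (dd v k * dd v 1)]. *)
Definition dd n (v : nat -> 'rV[R]_n.+1) k := dotv (v k) (fr v k).

Definition curv n (v : nat -> 'rV[R]_n.+1) k := dd v k.+1 / (dd v k * dd v 1).

Lemma fr_gs n (v : nat -> 'rV[R]_n.+1) k : (k <= n)%N -> fr v k = gs v k.
Proof. by rewrite -ltnS => kn; rewrite /fr ltn_eqF. Qed.

Lemma fr_onb n (v : nat -> 'rV[R]_n.+1) : gs_ok n v -> onb (fr v) n.+1.
Proof.
move=> ok; have ob := gs_orthonormal ok => i j /andP[i1 i2] /andP[j1 j2].
move: i2; rewrite leq_eqVlt => /predU1P[->|ik]; move: j2; rewrite leq_eqVlt => /predU1P[->|jk].
- by rewrite /fr !eqxx cross_unit.
- by rewrite /fr eqxx (ltn_eqF jk) dotvC dotv_cross ?j1// eq_sym ltn_eqF.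
- by rewrite /fr eqxx (ltn_eqF ik) dotv_cross ?i1.
- by rewrite !fr_gs// ob ?i1 ?j1.
Qed.

Lemma det_fr n (v : nat -> 'rV[R]_n.+1) : gs_ok n v -> \det (framemx (fr v)) = 1.
Proof.
move=> ok; rewrite -(cross_unit (gs_orthonormal ok)) -det_cross; congr (\det _).
Qed.

Lemma ddE n (v : nat -> 'rV[R]_n.+1) k : gs_ok n v -> (1 <= k <= n)%N ->
  dd v k = enorm (gr v k).
Proof. by move=> ok hk; rewrite /dd fr_gs ?(dotv_v_gs ok)//; case/andP: hk. Qed.

Lemma dd_gt0 n (v : nat -> 'rV[R]_n.+1) k : gs_ok n v -> (1 <= k <= n)%N -> 0 < dd v k.
Proof. by move=> ok hk; rewrite ddE// enorm_gt0// ok. Qed.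

Lemma dotv_v_fr_gt n (v : nat -> 'rV[R]_n.+1) k l : gs_ok n v -> (1 <= k)%N ->
  (k < l <= n.+1)%N -> dotv (v k) (fr v l) = 0.
Proof.
move=> ok k1 /andP[kl ln].
have kn : (1 <= k <= n)%N by rewrite k1 -ltnS (leq_trans kl).
apply: (dotv_v_gs_gt ok kn) => j /andP[j1 jk].
have jn : (j <= n)%N by apply: leq_trans jk _; case/andP: kn.
rewrite -fr_gs// fr_onb// ?j1 ?(leqW jn) ?ln ?andbT//.
  by rewrite ltn_eqF// (leq_ltn_trans jk).
by rewrite (leq_ltn_trans _ kl).
Qed.

(** Multiplication by the transposed Gram-Schmidt vectors gives a lower triangular matrix with
    nonzero diagonal, hence a right inverse. *)
Lemma gs_ok_row_free n (v : nat -> 'rV[R]_n.+1) : gs_ok n v ->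
  row_free (\matrix_(i < n) v i.+1).
Proof.
move=> ok; set V := \matrix_i _; pose E : 'M[R]_(n, n.+1) := \matrix_(i < n) gs v i.+1.
pose L := V *m E^T.
have LE i j : L i j = dotv (v i.+1) (gs v j.+1).
  by rewrite mxE; apply: eq_bigr => k _; rewrite !mxE.
have Lu : L \in unitmx.
  rewrite unitmxE det_trig; last first.
    apply/is_trig_mxP => i j ij; rewrite LE -(@fr_gs n v)//.
    by rewrite dotv_v_fr_gt//= !ltnS ij ltnW.
  rewrite unitfE; apply/prodf_neq0 => i _; rewrite LE (dotv_v_gs ok) ?ltn_ord//.
  by rewrite enorm_eq0 ok ?ltn_ord.
by apply/row_freeP; exists (E^T *m invmx L); rewrite mulmxA mulmxV.
Qed.

(** A triangular change with positive diagonal preserves the flag of spans and its orientation, and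
    Gram-Schmidt depends on nothing else. *)
Lemma tri_gs m n (v w : nat -> 'rV[R]_m) (b : nat -> nat -> R) :
  gs_ok n w ->
  (forall k, (1 <= k <= n)%N -> 0 < b k k) ->
  (forall k, (1 <= k <= n)%N -> v k = \sum_(1 <= j < k.+1) b k j *: w j) ->
  forall k, (1 <= k <= n)%N -> gr v k = b k k *: gr w k /\ gs v k = gs w k.
Proof.
move=> ok b0 H k; elim/ltn_ind: k => k IH hk.
have k1 : (1 <= k)%N by case/andP: hk.
have kn : (k <= n)%N by case/andP: hk.
have E : gr v k = b k k *: gr w k.
  have E1 j : (1 <= j < k)%N -> gs v j = gs w j.
    move=> /andP[j1 jk]; apply: (IH j jk _).2; rewrite j1; exact: leq_trans (ltnW jk) kn.
  rewrite /gr (eq_big_nat _ _ (F2 := fun j => dotv (v k) (gs w j) *: gs w j)); last first.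
    by move=> j hj; rewrite E1.
  have P j : (1 <= j < k)%N -> w j = \sum_(1 <= i < k) dotv (w j) (gs w i) *: gs w i.
    move=> /andP[j1 jk]; have jn : (1 <= j <= n)%N by rewrite j1 (leq_trans (ltnW jk)).
    rewrite {1}(v_dec ok jn) [RHS](big_cat_nat (n := j))//=; last exact: ltnW.
    rewrite addrC; congr (_ + _); rewrite big_ltn// (dotv_v_gs ok)//.
    rewrite big_nat_cond big1 ?addr0// => i; rewrite andbT => /andP[ji ik].
    rewrite (dotv_v_gs_gt ok jn) ?scale0r// => l /andP[l1 lj].
    have li : (l < i)%N := leq_trans (lj : (l < j.+1)%N) ji.
    have hi : (1 <= i <= n)%N by rewrite (leq_trans _ li)//= (leq_trans (ltnW ik)).
    rewrite (gs_orthonormal ok) ?hi ?l1 ?ltn_eqF//=.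
    by rewrite (leq_trans (ltnW li))//; case/andP: hi.
  rewrite H// big_nat_recr//= addrC scalerBr -addrA; congr (_ + _).
  set B := \sum_(1 <= i < k) b k i *: w i.
  have -> : \sum_(1 <= i < k) dotv (b k k *: w k + B) (gs w i) *: gs w i =
      b k k *: (\sum_(1 <= j < k) dotv (w k) (gs w j) *: gs w j) + B.
    rewrite scaler_sumr.
    (* [B] lies in the span of the first [k - 1] Gram-Schmidt vectors, so projecting onto them
       returns it unchanged. *)
    have EB : B = \sum_(1 <= i < k) dotv B (gs w i) *: gs w i.
      rewrite {1}/B (eq_big_nat _ _ (F2 := fun i =>
        \sum_(1 <= j < k) dotv (b k i *: w i) (gs w j) *: gs w j)).
        by rewrite exchange_big; apply: eq_bigr => j _ /=; rewrite -scaler_suml -dotv_suml.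
      move=> j hj; rewrite {1}(P j hj) scaler_sumr; apply: eq_bigr => i _.
      by rewrite dotvZl scalerA.
    rewrite [in RHS]EB -big_split /=; apply: eq_bigr => i _.
    by rewrite scalerA -scalerDl -dotvZl -dotvDl.
  by rewrite opprD addrCA subrr addr0.
split=> //; rewrite !gsE// E.
have -> : enorm (b k k *: gr w k) = b k k * enorm (gr w k).
  by rewrite /enorm dotvZl dotvZr mulrA -expr2 sqrtrM ?sqr_ge0// sqrtr_sqr gtr0_norm// b0.
rewrite scalerA invfM mulrAC mulVf ?mul1r// gt_eqF// b0//.
Qed.

Lemma cross_ext n (e e' : nat -> 'rV[R]_n.+1) : (forall k, (1 <= k <= n)%N -> e k = e' k) ->
  cross e = cross e'.
Proof.
move=> H; apply/rowP => j; rewrite !mxE; congr (cofactor _ _ _).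
apply/row_matrixP => i; rewrite !rowK; case: eqP => // /eqP im.
by rewrite H//= ltn_neqAle im -ltnS ltn_ord.
Qed.

(** Both jets have the same frame, and pairing with its [k]-th vector kills all but the diagonal
    term. The sign of [b n.+1 n.+1] is free: this is how the last curvature can be changed to any
    real value. *)
Lemma tri_curv n (v w : nat -> 'rV[R]_n.+1) (b : nat -> nat -> R) :
  gs_ok n w ->
  (forall k, (1 <= k <= n)%N -> 0 < b k k) ->
  (forall k, (1 <= k <= n.+1)%N -> v k = \sum_(1 <= j < k.+1) b k j *: w j) ->
  gs_ok n v /\ forall k, (1 <= k <= n)%N ->
    curv v k = b k.+1 k.+1 / (b k k * b 1%N 1%N) * curv w k.
Proof.
move=> ok b0 H; have H' k : (1 <= k <= n)%N -> v k = \sum_(1 <= j < k.+1) b k j *: w j.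
  by move=> /andP[k1 kn]; apply: H; rewrite k1 leqW.
have T := tri_gs ok b0 H'.
have okv : gs_ok n v.
  by move=> k hk; rewrite (T k hk).1 scaler_eq0 gt_eqF ?b0//= ok.
have F k : (1 <= k <= n.+1)%N -> fr v k = fr w k.
  rewrite /fr => /andP[k1 kn]; case: eqP => [_|/eqP kne].
    by apply: cross_ext => j /T[].
  by have [] // := T k; rewrite k1/= -ltnS ltn_neqAle kne.
have D k : (1 <= k <= n.+1)%N -> dd v k = b k k * dd w k.
  move=> hk; have k1 : (1 <= k)%N by case/andP: hk.
  rewrite /dd F// H// big_nat_recr//= dotvDl dotvZl dotv_suml big_nat_cond big1 ?add0r// => j.
  rewrite andbT => /andP[j1 jk]; rewrite dotvZl dotv_v_fr_gt ?mulr0// jk.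
  by case/andP: hk.
split=> // k /andP[k1 kn].
have E1 := D 1%N isT; have Ek : dd v k = b k k * dd w k by apply: D; rewrite k1 leqW.
have Ek1 : dd v k.+1 = b k.+1 k.+1 * dd w k.+1 by apply: D.
rewrite /curv E1 Ek Ek1.
by rewrite !invfM !mulrA; ring.
Qed.

End GramSchmidt.

(** * Differentiating the frame: the Frenet formulae *)

Section Frenet.
Context {R : realType}.
Implicit Types (t : R).

Lemma is_derive_rowP m (M : R -> 'rV[R]_m) (dM : 'rV[R]_m) t :
  is_derive t 1 M dM <-> forall i, is_derive t 1 (fun x => M x 0 i) (dM 0 i).
Proof.
split=> [[d <-] i|H].
  apply: DeriveDef; first exact: (derivable_mxP _ _ _).1.
  by rewrite derive_mx// mxE.
have d : derivable M t 1.
  by apply/derivable_mxP => i j; rewrite ord1; case: (H j).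
apply: DeriveDef => //; rewrite derive_mx//; apply/rowP => i; rewrite mxE.
by case: (H i).
Qed.

Lemma derivable_rowP m (M : R -> 'rV[R]_m) t :
  derivable M t 1 <-> forall i, derivable (fun x => M x 0 i) t 1.
Proof.
rewrite derivable_mxP; split=> [H i|H i j]; first exact: H.
by rewrite ord1; exact: H.
Qed.

Lemma is_derive_vec m (M : R -> 'rV[R]_m) t : derivable M t 1 -> is_derive t 1 M (derive1 M t).
Proof. by move=> d; rewrite derive1E; exact: derivableP. Qed.

Lemma is_derive_dotv m (f g : R -> 'rV[R]_m) (df dg : 'rV[R]_m) t :
  is_derive t 1 f df -> is_derive t 1 g dg ->
  is_derive t 1 (fun x => dotv (f x) (g x)) (dotv df (g t) + dotv (f t) dg).
Proof.
move=> /is_derive_rowP Hf /is_derive_rowP Hg; rewrite -big_split /=.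
by apply: is_derive_sumf => i _; exact: is_deriveMf.
Qed.

Lemma derivableMf (f g : R -> R) t : derivable f t 1 -> derivable g t 1 ->
  derivable (fun x => f x * g x) t 1.
Proof.
by move=> df dg; case: (is_deriveMf (is_derive_of df) (is_derive_of dg)).
Qed.

Lemma derivableDf (f g : R -> R) t : derivable f t 1 -> derivable g t 1 ->
  derivable (fun x => f x + g x) t 1.
Proof.
by move=> df dg; case: (is_deriveDf (is_derive_of df) (is_derive_of dg)).
Qed.

Lemma derivable_sumf (I : Type) (r : seq I) (P : pred I) (F : I -> R -> R) t :
  (forall i, P i -> derivable (F i) t 1) -> derivable (fun x => \sum_(i <- r | P i) F i x) t 1.
Proof.
move=> H; have D i : P i -> is_derive t 1 (F i) (derive1 (F i) t).
  by move=> Pi; apply: is_derive_of; exact: H.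
by case: (is_derive_sumf r D).
Qed.

Lemma derivable_prodf (I : Type) (r : seq I) (F : I -> R -> R) t :
  (forall i, derivable (F i) t 1) -> derivable (fun x => \prod_(i <- r) F i x) t 1.
Proof.
move=> H; elim: r => [|i r IH].
  rewrite (_ : (fun x => _) = fun=> 1); last by apply/funext => x; rewrite big_nil.
  exact: derivable_cst.
rewrite (_ : (fun x => _) = fun x => F i x * \prod_(i <- r) F i x); last first.
  by apply/funext => x; rewrite big_cons.
exact: derivableMf.
Qed.

Lemma derivable_det p (M : R -> 'M[R]_p) t : (forall i j, derivable (fun x => M x i j) t 1) ->
  derivable (fun x => \det (M x)) t 1.
Proof.
move=> H; apply: derivable_sumf => s _; apply: derivableMf; first exact: derivable_cst.
by apply: derivable_prodf => i.
Qed.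

Lemma derivable_dotv m (f g : R -> 'rV[R]_m) t : derivable f t 1 -> derivable g t 1 ->
  derivable (fun x => dotv (f x) (g x)) t 1.
Proof.
by move=> /is_derive_vec df /is_derive_vec dg; case: (is_derive_dotv df dg).
Qed.

Lemma derivable_scale m (c : R -> R) (f : R -> 'rV[R]_m) t : derivable c t 1 -> derivable f t 1 ->
  derivable (fun x => c x *: f x) t 1.
Proof.
move=> dc /derivable_rowP df; apply/derivable_rowP => i.
rewrite (_ : (fun x => _) = fun x => c x * f x 0 i); last by apply/funext => x; rewrite mxE.
exact: derivableMf.
Qed.

Lemma derivable_gs m n (v : nat -> R -> 'rV[R]_m) t :
  (forall k, (1 <= k <= n)%N -> derivable (v k) t 1) -> gs_ok n (v^~ t) ->
  forall k, (1 <= k <= n)%N -> derivable (fun x => gs (v^~ x) k) t 1.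
Proof.
move=> dv ok k; elim/ltn_ind: k => k IH hk; have [k1 kn] := andP hk.
rewrite (_ : (fun x => _) = fun x => (enorm (gr (v^~ x) k))^-1 *: gr (v^~ x) k); last first.
  by apply/funext => x; rewrite gsE.
have dgr : derivable (fun x => gr (v^~ x) k) t 1.
  apply/derivable_rowP => i.
  rewrite (_ : (fun x => _) = fun x => v k x 0 i + -1 * \sum_(1 <= j < k)
     dotv (v k x) (gs (v^~ x) j) * gs (v^~ x) j 0 i); last first.
    apply/funext => x; rewrite /gr !mxE summxE mulN1r; congr (_ - _).
    by apply: eq_bigr => j _; rewrite mxE.
  apply: derivableDf; first by apply: (derivable_rowP _ _).1; exact: dv.
  apply: derivableMf; first exact: derivable_cst.
  rewrite (_ : (fun x => _) = fun x => \sum_(1 <= j < k | (1 <= j < k)%N)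
     dotv (v k x) (gs (v^~ x) j) * gs (v^~ x) j 0 i); last first.
    by apply/funext => x; rewrite [LHS]big_nat_cond [RHS]big_nat_cond; apply: eq_bigl => j; rewrite andbT andbb.
  apply: derivable_sumf => j /andP[j1 jk].
  have dj : derivable (fun x => gs (v^~ x) j) t 1.
    by apply: IH => //; rewrite j1 (leq_trans (ltnW jk)).
  apply: derivableMf; last exact: (derivable_rowP _ _).1.
  exact: (derivable_dotv (dv k hk) dj).
apply: derivable_scale => //.
have g0 := ok k hk.
have dn : derivable (fun x => enorm (gr (v^~ x) k)) t 1.
  have ds := is_derive_of (derivable_dotv dgr dgr).
  have p0 : 0 < dotv (gr (v^~ t) k) (gr (v^~ t) k).
    by rewrite lt_def dotv_eq0 g0 dotv_ge0.
  by case: (is_derive_compf ds (is_derive1_sqrt p0)).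
by apply: derivableV => //; rewrite enorm_eq0.
Qed.

Lemma derivable_fr n (v : nat -> R -> 'rV[R]_n.+1) t :
  (forall k, (1 <= k <= n)%N -> derivable (v k) t 1) -> gs_ok n (v^~ t) ->
  forall k, (1 <= k <= n.+1)%N -> derivable (fun x => fr (v^~ x) k) t 1.
Proof.
move=> dv ok k /andP[k1 kn]; have dg := derivable_gs dv ok.
rewrite /fr; case: eqP => [_|/eqP kne]; last first.
  by apply: dg; rewrite k1 -ltnS ltn_neqAle kne.
apply/derivable_rowP => j.
rewrite (_ : (fun x => _) = fun x => cofactor (\matrix_(i < n.+1)
   (if (i : nat) == n then 0 else gs (v^~ x) i.+1)) ord_max j); last first.
  by apply/funext => x; rewrite mxE.
apply: derivableMf; first exact: derivable_cst.
apply: derivable_det => a b.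
rewrite (_ : (fun x => _) = fun x => gs (v^~ x) a.+1 0 (lift j b)); last first.
  apply/funext => x; rewrite !mxE; have := lift_max a => /= E.
  by rewrite E (ltn_eqF (ltn_ord a)).
by apply: (derivable_rowP _ _).1; apply: dg; rewrite /= ltn_ord.
Qed.

Lemma onb_ext n (e : nat -> 'rV[R]_n.+1) x y : onb e n.+1 ->
  (forall l, (1 <= l <= n.+1)%N -> dotv x (e l) = dotv y (e l)) -> x = y.
Proof.
move=> ob H; rewrite (onb_dec x ob) (onb_dec y ob); apply: eq_bigr => i _.
by rewrite H//= ltn_ord.
Qed.

Section FrenetFrame.
Variables (n : nat) (v : nat -> R -> 'rV[R]_n.+1).
Hypothesis dv : forall k t, (1 <= k <= n)%N -> is_derive t 1 (v k) (v k.+1 t).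
Hypothesis ok : forall t, gs_ok n (v^~ t).
Let e k t := fr (v^~ t) k.

Let de k t : (1 <= k <= n.+1)%N -> is_derive t 1 (e k) (derive1 (e k) t).
Proof.
move=> hk; apply: is_derive_vec; apply: derivable_fr => // j hj.
by case: (dv t hj).
Qed.

Lemma frame_antisym i j t : (1 <= i <= n.+1)%N -> (1 <= j <= n.+1)%N ->
  dotv (derive1 (e i) t) (e j t) = - dotv (derive1 (e j) t) (e i t).
Proof.
move=> hi hj; have D := is_derive_dotv (de t hi) (de t hj).
rewrite (_ : (fun x => _) = fun=> (i == j)%:R) in D; last first.
  by apply/funext => x; rewrite fr_onb.
have := derive1_is D; rewrite (derive1_is (is_derive_cst _ _ _)).
by move=> /eqP; rewrite eq_sym addr_eq0 => /eqP ->; rewrite dotvC.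
Qed.

Let v_expand k t : (1 <= k <= n)%N ->
  v k t = \sum_(1 <= j < k.+1) dotv (v k t) (e j t) *: e j t.
Proof.
move=> hk; rewrite {1}(v_dec (@ok t) hk) addrC big_nat_recr/=; last by case/andP: hk.
have kn : (k <= n)%N by case/andP: hk.
congr (_ + _); last by rewrite /e fr_gs// (dotv_v_gs (@ok t)).
rewrite big_nat_cond [RHS]big_nat_cond; apply: eq_bigr => j; rewrite andbT => /andP[j1 jk].
by rewrite /e fr_gs// (leq_trans (ltnW jk)).
Qed.

(** Differentiate the expansion of [v k] in the frame and pair with [e l]: as [l > k], the terms
    with differentiated coefficients drop out by orthogonality. *)
Let pair_expand k l t : (1 <= k <= n)%N -> (k < l <= n.+1)%N ->
  dotv (v k.+1 t) (e l t) =
  \sum_(1 <= j < k.+1) dotv (v k t) (e j t) * dotv (derive1 (e j) t) (e l t).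
Proof.
move=> hk /andP[kl ln]; have [k1 kn] := andP hk.
pose c j x := dotv (v k x) (e j x).
have dc j : (1 <= j <= n.+1)%N -> is_derive t 1 (c j) (derive1 (c j) t).
  move=> hj; apply: is_derive_of; apply: derivable_dotv; first by case: (dv t hk).
  by case: (de t hj).
have D : is_derive t 1 (v k) (\sum_(1 <= j < k.+1 | (1 <= j < k.+1)%N)
    (derive1 (c j) t *: e j t + c j t *: derive1 (e j) t)).
  apply/is_derive_rowP => i.
  rewrite (_ : (fun x => _) = fun x => \sum_(1 <= j < k.+1 | (1 <= j < k.+1)%N) c j x * e j x 0 i); last first.
    apply/funext => x; rewrite {1}v_expand// summxE big_nat_cond [RHS]big_nat_cond.
    by apply: eq_big => [j|j _]; rewrite ?andbT ?andbb// mxE.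
  rewrite summxE; apply: is_derive_sumf => j /andP[j1 jk]; rewrite !mxE.
  have hj : (1 <= j <= n.+1)%N by rewrite j1 (leq_trans (ltnW jk)).
  apply: is_deriveMf; first exact: dc.
  exact: ((is_derive_rowP _ _ _).1 (de t hj)).
have [_ E1] := D; have [_ E2] := dv t hk; rewrite -E2 E1 dotv_suml.
rewrite big_nat_cond [RHS]big_nat_cond; apply: eq_big => [j|j]; first by rewrite andbT andbb.
move=> /andP[/andP[j1 jk] _]; rewrite dotvDl !dotvZl /e.
rewrite fr_onb//; first by rewrite ltn_eqF ?mulr0 ?add0r// (leq_ltn_trans _ kl).
  by rewrite j1 (leq_trans (ltnW jk)).
by rewrite ln andbT (leq_ltn_trans _ kl).
Qed.

(** In [pair_expand] the left side vanishes since [l > k.+1], and the terms [j < k] vanish by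
    induction. What remains is the wanted product times [dd k], which is positive. *)
Lemma frame_hessenberg k l t : (1 <= k <= n)%N -> (k.+1 < l <= n.+1)%N ->
  dotv (derive1 (e k) t) (e l t) = 0.
Proof.
elim/ltn_ind: k => k IH hk /andP[kl ln]; have [k1 kn] := andP hk.
have := @pair_expand k l t hk; rewrite (ltnW kl) ln => /(_ isT).
rewrite (dotv_v_fr_gt (@ok t))// ?kl// big_nat_recr//= big_nat_cond big1 ?add0r.
  move=> /esym/eqP; rewrite mulf_eq0 => /orP[|/eqP//].
  by rewrite -[dotv _ _]/(dd (v^~ t) k) gt_eqF// dd_gt0.
move=> j; rewrite andbT => /andP[j1 jk]; rewrite IH ?mulr0//.
  by rewrite j1 (leq_trans (ltnW jk)).
by rewrite ln andbT (leq_ltn_trans jk)// ltnW.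
Qed.

Lemma frame_super k t : (1 <= k <= n)%N ->
  dotv (derive1 (e k) t) (e k.+1 t) = dd (v^~ t) k.+1 / dd (v^~ t) k.
Proof.
move=> hk; have [k1 kn] := andP hk; have := @pair_expand k k.+1 t hk.
rewrite ltnSn ltnS kn => /(_ isT).
rewrite big_nat_recr//= big_nat_cond big1 ?add0r => [E|j].
  apply: (mulfI (lt0r_neq0 (dd_gt0 (@ok t) hk))).
  by rewrite -E mulrC divfK// gt_eqF// dd_gt0.
rewrite andbT => /andP[j1 jk]; rewrite frame_hessenberg ?mulr0//.
  by rewrite j1 (leq_trans (ltnW jk)).
by rewrite !ltnS jk.
Qed.

Lemma frame_frenet t : (1 <= n)%N ->
  let D k := (enorm (v 1%N t))^-1 *: derive1 (e k) t in
  [/\ forall k : nat, (1 <= k <= n.+1)%N -> derivable (e k) t 1,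
      D 1%N = curv (v^~ t) 1 *: e 2%N t,
      forall i : nat, (1 <= i <= n.-1)%N ->
        D i.+1 = - curv (v^~ t) i *: e i t + curv (v^~ t) i.+1 *: e i.+2 t &
      D n.+1 = - curv (v^~ t) n *: e n t].
Proof.
move=> n1 D; have ob := fr_onb (@ok t).
have E1 : enorm (v 1%N t) = dd (v^~ t) 1.
  by rewrite ddE// /gr big_geq// subr0.
have d1 : 0 < dd (v^~ t) 1 by exact: dd_gt0.
have dk k : (1 <= k <= n)%N -> (enorm (v 1%N t))^-1 * (dd (v^~ t) k.+1 / dd (v^~ t) k) = curv (v^~ t) k.
  by move=> hk; rewrite E1 /curv invfM mulrCA [_^-1 * (dd _ k)^-1]mulrC.
(* [frame_hessenberg] clears everything above the first superdiagonal, and antisymmetry the mirror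
   image and the diagonal. *)
have DS k l : (1 <= k <= n.+1)%N -> (1 <= l <= n.+1)%N -> dotv (D k) (e l t) =
    if l == k.+1 then curv (v^~ t) k else if k == l.+1 then - curv (v^~ t) l else 0.
  move=> hk hl; rewrite /D dotvZl.
  have [k1 kn] := andP hk; have [l1 ln] := andP hl.
  case: eqP => [lk|/eqP lk].
    by rewrite lk frame_super ?dk// k1 -ltnS -lk.
  case: eqP => [kl|/eqP kl].
    by rewrite kl frame_antisym ?frame_super ?mulrN ?dk// -?kl ?hk// ?l1 -ltnS -?kl.
  have [ltk|ltk|Ekl] := ltngtP l k.
  - rewrite frame_antisym// frame_hessenberg ?oppr0 ?mulr0//.
      by rewrite l1 -ltnS (leq_trans ltk).
    by rewrite kn andbT ltn_neqAle eq_sym kl.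
  - rewrite frame_hessenberg ?mulr0//.
      by rewrite k1 -ltnS (leq_trans ltk).
    by rewrite ln andbT ltn_neqAle eq_sym lk.
  - have := frame_antisym t hk hk; rewrite Ekl => /eqP; rewrite -addr_eq0 -mulr2n mulrn_eq0 /= => /eqP ->.
    by rewrite mulr0.
split.
- by move=> k hk; case: (de t hk).
- apply: (onb_ext ob) => l hl; rewrite DS// dotvZl /e fr_onb//.
  rewrite (eq_sym 2%N); case: (l =P 2%N) => [_|_]; first by rewrite mulr1.
  by rewrite mulr0; case: l hl.
- move=> i /andP[i1 i2].
  have hi : (1 <= i <= n)%N by rewrite i1 (leq_trans i2)// leq_pred.
  have hi2 : (i.+2 <= n.+1)%N by rewrite ltnS; rewrite -ltnS prednK// in i2.
  apply: (onb_ext ob) => l hl; rewrite DS ?ltnS//; last by case/andP: hi.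
  rewrite dotvDl !dotvZl /e !fr_onb//; last by rewrite i1 ltnW// ltnW.
  rewrite [i.+2 == l]eq_sym eqSS [i == l]eq_sym.
  case: eqP => [->|_].
    by rewrite (gtn_eqF (leqW (leqnn _)))// mulr0 add0r mulr1.
  rewrite mulr0 addr0 eq_sym; case: eqP => [->|_]; first by rewrite mulr1.
  by rewrite mulr0.
- apply: (onb_ext ob) => l hl; rewrite DS ?leqnn// dotvZl /e fr_onb//; last by rewrite n1 /=.
  have /andP[l1 ln] := hl.
  rewrite (ltn_eqF (n := n.+2))// eqSS; case: eqP => [<-|_]; first by rewrite mulr1.
  by rewrite mulr0.
Qed.

End FrenetFrame.

Lemma curvature_map n (alpha : R -> 'rV[R]_n.+1) : (1 <= n)%N ->
  differentiable_C n.+1 alpha ->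
  (forall t, gs_ok n (fun k => derive1n k alpha t)) ->
  is_curvature_map alpha (fun t => \row_(i < n) curv (fun k => derive1n k alpha t) i.+1).
Proof.
move=> n1 [da _] ok.
pose v k t := derive1n k alpha t.
have dv k t : (1 <= k <= n)%N -> is_derive t 1 (v k) (v k.+1 t).
  move=> /andP[k1 kn]; rewrite /v derive1nS; apply: is_derive_vec.
  by apply: da; rewrite ltnS.
exists (fun k t => fr (v^~ t) k), (fun k t => curv (v^~ t) k); split=> //.
  move=> t; split.
  - have := @gram_schmidt_gs R n.+1 n (v^~ t) => H k hk.
    have kn : (k <= n)%N by case/andP: hk.
    rewrite fr_gs// H//=; congr (_ *: _); last first.
      congr (_ - _); rewrite big_nat_cond [RHS]big_nat_cond; apply: eq_bigr => j.
      by rewrite andbT => /andP[j1 jk]; rewrite fr_gs// (leq_trans (ltnW jk)).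
    congr (enorm _)^-1; congr (_ - _); rewrite big_nat_cond [RHS]big_nat_cond; apply: eq_bigr => j.
    by rewrite andbT => /andP[j1 jk]; rewrite fr_gs// (leq_trans (ltnW jk)).
  - exact: fr_onb (ok t).
  - by have := det_fr (ok t); rewrite /framemx => ->; exact: ltr01.
move=> t; exact: (frame_frenet dv ok t n1).
Qed.

End Frenet.

(** * Continuity of the curvatures in the jet *)

Section Stability.
Context {R : realType}.

Section Limits.
Context {T : Type} {F : set_system T} {FF : ProperFilter F}.

Definition vlim m (f : T -> 'rV[R]_m) (l : 'rV[R]_m) := forall i, f x 0 i @[x --> F] --> l 0 i.

Lemma cvg_sumf (I : Type) (r : seq I) (P : pred I) (f : I -> T -> R) (l : I -> R) :
  (forall i, P i -> f i x @[x --> F] --> l i) ->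
  (\sum_(i <- r | P i) f i x) @[x --> F] --> \sum_(i <- r | P i) l i.
Proof.
move=> H; elim: r => [|i r IH].
  rewrite (_ : (fun x => _) = fun=> 0); last by apply/funext => x; rewrite big_nil.
  by rewrite big_nil; exact: cvg_cst.
rewrite (_ : (fun x => _) = fun x => if P i then f i x + \sum_(i <- r | P i) f i x
   else \sum_(i <- r | P i) f i x); last by apply/funext => x; rewrite big_cons.
by rewrite big_cons; case Pi: (P i) => //; apply: cvgD => //; exact: H.
Qed.

Lemma cvg_prodf (I : Type) (r : seq I) (f : I -> T -> R) (l : I -> R) :
  (forall i, f i x @[x --> F] --> l i) ->
  (\prod_(i <- r) f i x) @[x --> F] --> \prod_(i <- r) l i.
Proof.
move=> H; elim: r => [|i r IH].
  rewrite (_ : (fun x => _) = fun=> 1); last by apply/funext => x; rewrite big_nil.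
  by rewrite big_nil; exact: cvg_cst.
rewrite (_ : (fun x => _) = fun x => f i x * \prod_(i <- r) f i x); last by apply/funext => x; rewrite big_cons.
by rewrite big_cons; exact: cvgM.
Qed.

Lemma vlim_dotv m (f g : T -> 'rV[R]_m) a b : vlim f a -> vlim g b ->
  dotv (f x) (g x) @[x --> F] --> dotv a b.
Proof. by move=> fa gb; apply: cvg_sumf => i _; exact: cvgM. Qed.

Lemma vlim_enorm m (f : T -> 'rV[R]_m) a : vlim f a -> enorm (f x) @[x --> F] --> enorm a.
Proof.
move=> fa; apply: (cvg_comp (fun x => dotv (f x) (f x)) Num.sqrt); first exact: vlim_dotv.
exact: sqrt_continuous.
Qed.

Lemma vlim_gr m n (v : T -> nat -> 'rV[R]_m) w : gs_ok n w ->
  (forall k, (1 <= k <= n)%N -> vlim (v^~ k) (w k)) ->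
  forall k, (1 <= k <= n)%N -> vlim (fun x => gr (v x) k) (gr w k) /\ vlim (fun x => gs (v x) k) (gs w k).
Proof.
move=> ok H k; elim/ltn_ind: k => k IH hk; have [k1 kn] := andP hk.
have G : vlim (fun x => gr (v x) k) (gr w k).
  move=> i; rewrite /gr !mxE summxE big_nat_cond.
  rewrite (_ : (fun x => _) = fun x => v x k 0 i - \sum_(1 <= j < k | (1 <= j < k)%N && true)
     (dotv (v x k) (gs (v x) j) *: gs (v x) j) 0 i); last first.
    by apply/funext => x; rewrite !mxE summxE big_nat_cond.
  apply: cvgB; first exact: H.
  apply: cvg_sumf => j; rewrite andbT => /andP[j1 jk]; rewrite mxE /=.
  have [_ gj] : vlim (fun x => gr (v x) j) (gr w j) /\ vlim (fun x => gs (v x) j) (gs w j).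
    by apply: IH => //; rewrite j1 (leq_trans (ltnW jk)).
  rewrite (_ : (fun x => _) = fun x => dotv (v x k) (gs (v x) j) * gs (v x) j 0 i); last first.
    by apply/funext => x; rewrite mxE.
  apply: cvgM; last exact: gj.
  by apply: vlim_dotv => //; exact: H.
split=> // i; rewrite gsE// mxE.
rewrite (_ : (fun x => _) = fun x => (enorm (gr (v x) k))^-1 * gr (v x) k 0 i); last first.
  by apply/funext => x; rewrite gsE// mxE.
apply: cvgM; last exact: G.
by apply: cvgV; [rewrite enorm_eq0 ok|exact: vlim_enorm].
Qed.

Lemma vlim_fr n (v : T -> nat -> 'rV[R]_n.+1) w : gs_ok n w ->
  (forall k, (1 <= k <= n)%N -> vlim (v^~ k) (w k)) ->
  forall k, (1 <= k <= n.+1)%N -> vlim (fun x => fr (v x) k) (fr w k).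
Proof.
move=> ok H k /andP[k1 kn]; rewrite /fr; case: eqP => [_|/eqP kne]; last first.
  by apply: (vlim_gr ok H _).2; rewrite k1 -ltnS ltn_neqAle kne.
move=> j; rewrite mxE.
rewrite (_ : (fun x => _) = fun x => cofactor (\matrix_(i < n.+1)
   (if (i : nat) == n then 0 else gs (v x) i.+1)) ord_max j); last first.
  by apply/funext => x; rewrite mxE.
apply: cvgM; first exact: cvg_cst.
apply: cvg_sumf => s _; apply: cvgM; first exact: cvg_cst.
apply: cvg_prodf => i; rewrite !mxE.
have /= E := lift_max i; rewrite E (ltn_eqF (ltn_ord i)).
rewrite (_ : (fun x => _) = fun x => gs (v x) i.+1 0 (lift j (s i))); last first.
  by apply/funext => x; rewrite !mxE /= E (ltn_eqF (ltn_ord i)).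
by apply: (vlim_gr ok H _).2; rewrite /= ltn_ord.
Qed.

Lemma vlim_curv n (v : T -> nat -> 'rV[R]_n.+1) w : gs_ok n w ->
  (forall k, (1 <= k <= n.+1)%N -> vlim (v^~ k) (w k)) ->
  forall k, (1 <= k <= n)%N -> curv (v x) k @[x --> F] --> curv w k.
Proof.
move=> ok H k hk; have [k1 kn] := andP hk.
have D j : (1 <= j <= n.+1)%N -> dd (v x) j @[x --> F] --> dd w j.
  move=> hj; apply: vlim_dotv; first exact: H.
  apply: vlim_fr => // l /andP[l1 ln]; apply: H.
  by rewrite l1 leqW.
apply: cvgM; first by apply: D; rewrite ltnS.
apply: cvgV.
  rewrite mulf_neq0 ?gt_eqF ?dd_gt0// (leq_trans k1 kn)//.
by apply: cvgM; apply: D => //; rewrite k1 leqW.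
Qed.

End Limits.

(** Limits are taken along the filter of neighbourhoods of [w] in the vectors of index 1 to [n.+1];
    each of the finitely many conclusions holds on a member of that filter, and a common member
    provides [eta]. *)
Lemma curv_stable n (w : nat -> 'rV[R]_n.+1) (eps : R) : gs_ok n w -> 0 < eps ->
  exists2 eta, 0 < eta & forall v : nat -> 'rV[R]_n.+1,
    (forall k i, (1 <= k <= n.+1)%N -> `|v k 0 i - w k 0 i| < eta) ->
    gs_ok n v /\ forall k, (1 <= k <= n)%N -> `|curv v k - curv w k| < eps.
Proof.
move=> ok e0.
pose B (eta : R) : set (nat -> 'rV[R]_n.+1) :=
  [set v | forall k i, (1 <= k <= n.+1)%N -> `|v k 0 i - w k 0 i| < eta].
pose F := filter_from [set eta : R | 0 < eta] B.
have F0 : Filter F.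
  apply: filter_from_filter; first by exists 1 => /=.
  move=> a b /= a0 b0; exists (Num.min a b); first by rewrite /= lt_min a0.
  by move=> v Bv; split=> k i hk; have := Bv k i hk; rewrite lt_min => /andP[].
have FF : ProperFilter F.
  apply: filter_from_proper => eta /= eta0.
  by exists w => k i _; rewrite subrr normr0.
have H k : (1 <= k <= n.+1)%N -> vlim (F := F) (fun v => v k) (w k).
  move=> hk i; apply/cvgrPdist_lt => /= e epos; exists e => //= v Bv.
  by rewrite distrC; exact: Bv.
have H' k : (1 <= k <= n)%N -> vlim (F := F) (fun v => v k) (w k).
  by move=> /andP[k1 kn]; apply: H; rewrite k1 leqW.
have near1 k : (1 <= k <= n)%N -> F (fun v => gr v k != 0 /\ `|curv v k - curv w k| < eps).
  move=> hk; have h1 := vlim_enorm (vlim_gr ok H' hk).1.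
  have h2 := vlim_curv ok H hk.
  have e1 : 0 < enorm (gr w k) by rewrite enorm_gt0// ok.
  have n1 := (cvgrPdist_lt _ _).1 (h1 FF FF) _ e1.
  have n2 := (cvgrPdist_lt _ _).1 (h2 FF) _ e0.
  have n1' : F (fun v => `|enorm (gr w k) - enorm (gr v k)| < enorm (gr w k)) := n1 F0.
  have n2' : F (fun v => `|curv w k - curv v k| < eps) := n2 F0.
  apply: (@filterS _ F F0 _ _ _ (@filterI _ F F0 _ _ n1' n2')) => v [g1 g2].
  split; last by rewrite distrC.
  rewrite -enorm_eq0; apply/eqP => E; move: g1.
  by rewrite E subr0 gtr0_norm// ltxx.
have nearn m : (m <= n)%N -> F (fun v => forall k, (1 <= k <= m)%N ->
    gr v k != 0 /\ `|curv v k - curv w k| < eps).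
  elim: m => [_|m IH mn]; first by exists 1; [exact: ltr01|move=> v _ [|k]].
  have h1 : (1 <= m.+1 <= n)%N by [].
  apply: (@filterS _ F F0 _ _ _ (@filterI _ F F0 _ _ (IH (ltnW mn)) (near1 _ h1))).
  move=> v [g1 g2] k /andP[k1]; rewrite leq_eqVlt => /predU1P[->//|km].
  by apply: g1; rewrite k1.
have [eta eta0 Heta] := nearn n (leqnn n); exists eta => // v Bv.
by split=> k /(Heta v Bv)[].
Qed.

End Stability.

(** * Invariance under rotations *)

Section Invariance.
Context {R : realType}.

Lemma gs_orth m (v : nat -> 'rV[R]_m) (O : 'M[R]_m) : O *m O^T = 1%:M ->
  forall k, (1 <= k)%N -> gr (fun k => v k *m O) k = gr v k *m O /\
    gs (fun k => v k *m O) k = gs v k *m O.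
Proof.
move=> HO; elim/ltn_ind => k IH k1.
have E : gr (fun k => v k *m O) k = gr v k *m O.
  rewrite /gr mulmxBl mulmx_suml big_nat_cond [in RHS]big_nat_cond; congr (_ - _).
  apply: eq_bigr => j; rewrite andbT => /andP[j1 jk].
  by rewrite (IH j jk j1).2 dotv_mx// scalemxAl.
by split=> //; rewrite !gsE// E scalemxAl /enorm dotv_mx.
Qed.

Lemma cross_orth n (e : nat -> 'rV[R]_n.+1) (O : 'M[R]_n.+1) : O *m O^T = 1%:M -> \det O = 1 ->
  cross (fun k => e k *m O) = cross e *m O.
Proof.
move=> HO dO; apply/rowP => j.
have H x : dotv (x *m O) (cross (fun k => e k *m O)) = dotv (x *m O) (cross e *m O).
  rewrite dotv_mx// -!det_cross -[RHS]mulr1 -dO -det_mulmx; congr (\det _).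
  apply/row_matrixP => i; rewrite row_mul !rowK.
  by case: ifP.
have {}H y : dotv y (cross (fun k => e k *m O)) = dotv y (cross e *m O).
  by have := H (y *m O^T); rewrite -mulmxA (mulmx1C HO) mulmx1.
have dl w : dotv (delta_mx 0 j) w = w 0 j :> R.
  rewrite /dotv (bigD1 j)//= mxE !eqxx mul1r big1 ?addr0// => i ij.
  by rewrite mxE (negbTE ij) mul0r.
by have := H (delta_mx 0 j); rewrite !dl.
Qed.

Lemma curv_orth n (v w : nat -> 'rV[R]_n.+1) (O : 'M[R]_n.+1) : O *m O^T = 1%:M -> \det O = 1 ->
  (forall k, (1 <= k <= n.+1)%N -> v k = w k *m O) -> gs_ok n w ->
  gs_ok n v /\ forall k, (1 <= k <= n)%N -> curv v k = curv w k.
Proof.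
move=> HO dO H ok.
have O1 : injective (mulmxr O : 'rV[R]_n.+1 -> 'rV[R]_n.+1).
  by move=> x y /= /(congr1 (mulmxr O^T)) /=; rewrite -!mulmxA HO !mulmx1.
pose w' k := w k *m O.
have [okv C] : gs_ok n v /\ forall k, (1 <= k <= n)%N -> curv v k = curv w' k.
  have T : gs_ok n w'.
    move=> k hk; rewrite (gs_orth _ HO _).1; last by case/andP: hk.
    by rewrite -(mul0mx _ O) (inj_eq O1) ok.
  (* The identity matrix as [b] replaces [v], known only at indices 1 to [n.+1], by the sequence
     [w']. *)
  have [||okv C] := @tri_curv R n v w' (fun i j => (i == j)%:R) T.
  - by move=> k _; rewrite eqxx ltr01.
  - move=> k /andP[k1 kn]; rewrite big_nat_recr//= eqxx scale1r big_nat_cond big1 ?add0r.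
      by apply: H; rewrite k1.
    by move=> i; rewrite andbT => /andP[_ ik]; rewrite gtn_eqF// scale0r.
  by split=> // k hk; rewrite C// !eqxx mulr1 divr1 mul1r.
split=> // k hk; rewrite C//.
have F j : (1 <= j <= n.+1)%N -> fr w' j = fr w j *m O.
  move=> /andP[j1 jn]; rewrite /fr; case: eqP => [_|_]; last exact: (gs_orth w HO j1).2.
  rewrite -cross_orth//; apply: cross_ext => l /andP[l1 _].
  exact: (gs_orth w HO l1).2.
have D j : (1 <= j <= n.+1)%N -> dd w' j = dd w j.
  by move=> hj; rewrite /dd F// dotv_mx.
have [k1 kn] := andP hk.
by rewrite /curv !D// k1 leqW.
Qed.

Lemma orth_entry m (O : 'M[R]_m) a b : O *m O^T = 1%:M -> `|O a b| <= 1.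
Proof.
move=> HO; have : (O *m O^T) a a = 1 by rewrite HO mxE eqxx.
rewrite mxE (bigD1 b)//= mxE -expr2 => E.
have : O a b ^+ 2 <= 1.
  by rewrite -E lerDl sumr_ge0// => j _; rewrite mxE -expr2 sqr_ge0.
by rewrite -[X in _ <= X -> _](expr1n _ 2) -real_normK ?num_real// ler_sqr ?nnegrE.
Qed.

Lemma curv_near_orth n (v w : nat -> 'rV[R]_n.+1) (O : 'M[R]_n.+1) (eta : R) :
  O *m O^T = 1%:M ->
  (forall k i, (1 <= k <= n.+1)%N -> `|v k 0 i - (w k *m O) 0 i| < eta) ->
  forall k i, (1 <= k <= n.+1)%N -> `|(v k *m O^T) 0 i - w k 0 i| <= n.+1%:R * eta.
Proof.
move=> HO H k i hk.
have -> : w k = w k *m O *m O^T by rewrite -mulmxA HO mulmx1.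
have -> : (v k *m O^T) 0 i - (w k *m O *m O^T) 0 i = ((v k - w k *m O) *m O^T) 0 i.
  by rewrite mulmxBl !mxE.
rewrite mxE; apply: le_trans (ler_norm_sum _ _ _) _.
rewrite mulr_natl -[X in _ <= _ *+ X]card_ord -sumr_const ler_sum// => j _.
rewrite !mxE normrM -[leRHS]mulr1 ler_pM//; last exact: orth_entry.
by have := H k j hk; rewrite mxE => /ltW.
Qed.

End Invariance.

(** * Spectral decomposition of an antisymmetric matrix *)

Section Spectral.
Context {R : realType}.

(** The complex spectral theorem, followed by real parts: [S] and its eigenvalues are real, so the
    real part of an eigenvector is an eigenvector or 0. Components with the same eigenvalue are
    added up to make [l] duplicate free. *)
Lemma sym_decomp m (S : 'M[R]_m) (v : 'rV[R]_m) : S^T = S ->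
  exists (l : seq R) (x : R -> 'rV[R]_m), [/\ uniq l,
    forall a, x a *m S = a *: x a & v = \sum_(a <- l) x a].
Proof.
move=> Ssym; pose C := R[i]; pose A : 'M[C]_m := map_mx (real_complex R) S.
have Aherm : A \is hermsymmx.
  apply: realsym_hermsym.
    apply/is_hermitianmxP; rewrite expr0 scale1r map_mx_id//.
    by apply/matrixP => i j; rewrite !mxE -[in LHS]Ssym mxE.
  apply/mxOverP => i j; rewrite mxE; by apply/complex_realP; exists (S i j).
have AE := orthomx_spectralP (hermitian_normalmx Aherm).
have Dreal := hermitian_spectral_diag_real Aherm.
set P := spectralmx A in AE; set D := spectral_diag A in AE Dreal.
have PA i : row i P *m A = D 0 i *: row i P.
  rewrite AE -row_mul !mulmxA mulmxV ?spectral_unit// mul1mx.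
  by rewrite row_mul row_diag_mx -scalemxAl -rowE.
pose vC : 'rV[C]_m := map_mx (real_complex R) v.
pose c := vC *m invmx P.
have vE : vC = \sum_i c 0 i *: row i P.
  by rewrite -mulmx_sum_row /c mulmxKV// spectral_unit.
pose lam i : R := complex.Re (D 0 i).
have lamE i : D 0 i = (lam i)%:C%C.
  have /mxOverP /(_ 0 i) /complex_realP [r rE] := Dreal.
  by rewrite /lam rE.
pose z i : 'rV[R]_m := map_mx (@complex.Re R) (c 0 i *: row i P).
have ReD (a b : C) : complex.Re (a + b) = complex.Re a + complex.Re b by case: a; case: b.
have Re0 : complex.Re (0 : C) = 0 by [].
have ReM (a : C) (b : R) : complex.Re (a * b%:C%C) = complex.Re a * b.
  by case: a => p q /=; rewrite mulr0 subr0.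
have zS i : z i *m S = lam i *: z i.
  have E : (c 0 i *: row i P) *m A = D 0 i *: (c 0 i *: row i P).
    by rewrite -scalemxAl PA !scalerA mulrC.
  apply/rowP => j; have /rowP /(_ j) /(congr1 (@complex.Re R)) := E.
  rewrite lamE [in RHS]mxE mulrC ReM => E'; rewrite [RHS]mxE [RHS]mulrC [z i 0 j]mxE -E'.
  rewrite mxE [in RHS]mxE (big_morph _ ReD Re0); apply: eq_bigr => k _.
  by rewrite [A k j]mxE ReM [z i 0 k]mxE.
have vz : v = \sum_i z i.
  apply/rowP => j; have /rowP /(_ j) /(congr1 (@complex.Re R)) := vE.
  rewrite mxE /= => ->; rewrite !summxE (big_morph _ ReD Re0).
  by apply: eq_bigr => i _; rewrite [RHS]mxE.
exists (undup [seq lam i | i <- enum 'I_m]), (fun a => \sum_(i | lam i == a) z i).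
split; first exact: undup_uniq.
  by move=> a; rewrite mulmx_suml scaler_sumr; apply: eq_bigr => i /eqP <-.
rewrite vz; under [RHS]eq_bigr do rewrite big_mkcond.
rewrite exchange_big /=; apply: eq_bigr => i _.
rewrite (bigD1_seq (lam i)) ?undup_uniq//=; last first.
  by rewrite mem_undup map_f// mem_enum.
rewrite eqxx big1 ?addr0// => a ai.
by rewrite eq_sym (negbTE ai).
Qed.

Lemma eig_orth m (S : 'M[R]_m) (u w : 'rV[R]_m) (a b : R) : S^T = S ->
  u *m S = a *: u -> w *m S = b *: w -> a != b -> dotv u w = 0.
Proof.
move=> Ssym uS wS ab.
have : dotv (u *m S) w = dotv u (w *m S).
  by rewrite !dotvE trmx_mul Ssym mulmxA.
rewrite uS wS dotvZl dotvZr => /eqP; rewrite -subr_eq0 -mulrBl mulf_eq0 subr_eq0 (negbTE ab).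
by move=> /eqP.
Qed.

(** The matrix [- K ^ 2] is symmetric and nonnegative. Its kernel is that of [K], and a component
    [x a] of [v] with eigenvalue [a ^+ 2 > 0] spans with [y a = x a K / a] a plane in which [K] acts
    as a quarter turn times [a]. One plane per frequency is enough for a single [v]. *)
Lemma antisym_decomp m (K : 'M[R]_m) (v : 'rV[R]_m) : K^T = - K ->
  exists (l : seq R) (x y : R -> 'rV[R]_m) (x0 : 'rV[R]_m),
  [/\ uniq l, forall a, a \in l -> 0 < a, v = x0 + \sum_(a <- l) x a, x0 *m K = 0 &
   [/\ forall a, a \in l -> x a *m K = a *: y a /\ y a *m K = - a *: x a,
      forall a, a \in l -> 0 < dotv (x a) (x a) /\ dotv (y a) (y a) = dotv (x a) (x a),
      forall a, a \in l -> [/\ dotv (x a) (y a) = 0, dotv x0 (x a) = 0 & dotv x0 (y a) = 0] &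
      forall a b, a \in l -> b \in l -> a != b -> [/\ dotv (x a) (x b) = 0,
        dotv (x a) (y b) = 0 & dotv (y a) (y b) = 0]]].
Proof.
move=> KT; pose S := - (K *m K).
have ST : S^T = S by rewrite /S linearN /= trmx_mul KT mulmxN mulNmx opprK.
have [l0 [z [ul0 zS vz]]] := sym_decomp v ST.
have Kanti u w : dotv (u *m K) w = - dotv u (w *m K).
  by rewrite !dotvE trmx_mul KT mulNmx mulmxN mulmxA [X in - X]mxE opprK.
have zpos a : a * dotv (z a) (z a) = dotv (z a *m K) (z a *m K).
  by rewrite Kanti -dotvZl -zS /S mulmxN mulmxA dotvNl dotvC.
(* Zero components are dropped so that every remaining [x a] spans a genuine plane. *)
pose l1 := [seq a <- l0 | (0 < a) && (z a != 0)].
pose l := [seq Num.sqrt a | a <- l1].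
have lP a : a \in l -> [/\ 0 < a, a ^+ 2 \in l0 & z (a ^+ 2) != 0].
  case/mapP => b; rewrite mem_filter => /andP[/andP[b0 zb] bl] ->.
  by rewrite sqrtr_gt0 b0 sqr_sqrtr// ltW.
pose x a := z (a ^+ 2); pose y a := a^-1 *: (x a *m K).
pose x0 := if 0 \in l0 then z 0 else 0.
have x0S : x0 *m S = 0.
  by rewrite /x0; case: ifP => _; rewrite ?mul0mx// zS scale0r.
have x0K : x0 *m K = 0.
  apply/eqP; rewrite -dotv_eq0 Kanti; move: x0S; rewrite /S mulmxN mulmxA => /eqP.
  by rewrite oppr_eq0 => /eqP ->; rewrite dotv0r oppr0.
have xS a : x a *m S = a ^+ 2 *: x a by exact: zS.
have yS a : y a *m S = a ^+ 2 *: y a.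
  rewrite /y -scalemxAl scalerA mulrC -scalerA; congr (_ *: _).
  by rewrite scalemxAl -xS /S !mulmxN mulNmx !mulmxA.
exists l, x, y, x0; split=> //.
- rewrite map_inj_in_uniq ?filter_uniq// => a b.
  rewrite !mem_filter => /andP[/andP[a0 _] _] /andP[/andP[b0 _] _] E.
  by rewrite -(sqr_sqrtr (ltW a0)) E sqr_sqrtr// ltW.
- by move=> a /lP[].
- have -> : \sum_(a <- l) x a = \sum_(a <- l0 | (0 < a) && (z a != 0)) z a.
    rewrite big_map big_filter big_seq_cond [RHS]big_seq_cond; apply: eq_bigr => a.
    by move=> /andP[_ /andP[a0 _]]; rewrite /x sqr_sqrtr// ltW.
  have -> : x0 = \sum_(a <- l0) (if a == 0 then z a else 0).
    rewrite /x0; case: ifP => l00.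
      rewrite (bigD1_seq 0)//= eqxx big1 ?addr0// => a a0.
      by rewrite (negbTE a0).
    rewrite big_seq_cond big1// => a /andP[al _]; case: eqP => // a0.
    by rewrite -a0 al in l00.
  rewrite vz [X in _ + X]big_mkcond -big_split /=; apply: eq_bigr => a _.
  have [->|za] := eqVneq (z a) 0; first by rewrite andbF addr0; case: ifP.
  rewrite andbT; have [->|a0] := eqVneq a 0; first by rewrite ltxx addr0.
  rewrite add0r ifT// lt_def a0/=.
  have zz : 0 < dotv (z a) (z a) by rewrite lt_def dotv_eq0 za dotv_ge0.
  by rewrite -(pmulr_lge0 _ zz) zpos dotv_ge0.
split.
- move=> a /lP[a0 _ _]; split; first by rewrite /y scalerA divff ?scale1r// gt_eqF.
  have := xS a; rewrite /S mulmxN mulmxA => /eqP; rewrite eqr_oppLR => /eqP E.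
  rewrite /y -scalemxAl E scalerN scalerA expr2 mulrA mulVf ?gt_eqF// mul1r.
  by rewrite scaleNr.
- move=> a /lP[a0 _ za]; split; first by rewrite lt_def dotv_eq0 za dotv_ge0.
  rewrite /y dotvZl dotvZr -zpos mulrA -/(x a) mulrA -invfM -expr2 mulVf ?mul1r//.
  by rewrite sqrf_eq0 gt_eqF.
- move=> a /lP[a0 _ za]; have a2 : 0 != a ^+ 2 by rewrite eq_sym sqrf_eq0 gt_eqF.
  have x00 : x0 *m S = 0 *: x0 by rewrite scale0r.
  split; last 2 first.
  + exact: eig_orth ST x00 (xS a) a2.
  + exact: eig_orth ST x00 (yS a) a2.
  rewrite /y dotvZr; have := Kanti (x a) (x a); rewrite dotvC => /eqP.
  by rewrite -addr_eq0 -mulr2n mulrn_eq0 /= => /eqP ->; rewrite mulr0.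
- move=> a b /lP[a0 _ _] /lP[b0 _ _] ab.
  have ab2 : a ^+ 2 != b ^+ 2 by rewrite eqrXn2// ltW.
  split; [exact: eig_orth ST (xS a) (xS b) ab2|exact: eig_orth ST (xS a) (yS b) ab2|].
  exact: eig_orth ST (yS a) (yS b) ab2.
Qed.

End Spectral.

(** * Plane rotations as explicit exponentials *)

Section Rotations.
Context {R : realType}.

(* [exp (f A)] when [A ^ 3 = - A] (Rodrigues). *)
Definition rotmx n (A : 'M[R]_n) (f : R) : 'M[R]_n :=
  1%:M + sin f *: A + (1 - cos f) *: (A *m A).

Definition rot_gen n (A : 'M[R]_n) := A^T = - A /\ A *m A *m A = - A.

Lemma rotmxD n (A : 'M[R]_n) f g : rot_gen A -> rotmx A f *m rotmx A g = rotmx A (f + g).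
Proof.
move=> [_ A3]; rewrite /rotmx !mulmxDl !mulmxDr !mulmx1 !mul1mx.
rewrite -!scalemxAl -!scalemxAr !mulmxA A3 !mulNmx sinD cosD.
by apply/matrixP => i j; rewrite !mxE; ring.
Qed.

Lemma rotmx0 n (A : 'M[R]_n) : rotmx A 0 = 1%:M.
Proof. by rewrite /rotmx sin0 cos0 subrr !scale0r !addr0. Qed.

Lemma rotmxT n (A : 'M[R]_n) f : rot_gen A -> (rotmx A f)^T = rotmx A (- f).
Proof.
move=> [AT _]; rewrite /rotmx !linearD /= !linearZ /= trmx1 trmx_mul AT mulNmx mulmxN opprK.
by rewrite sinN cosN scaleNr scalerN.
Qed.

Lemma rot_orth n (A : 'M[R]_n) f : rot_gen A -> rotmx A f *m (rotmx A f)^T = 1%:M.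
Proof. by move=> gA; rewrite rotmxT// rotmxD// subrr rotmx0. Qed.

(** The rotation is the square of [r = rotmx A (f / 2)], and the determinant of the square of [r] is
    that of [r] times its transpose, the identity. *)
Lemma rot_det n (A : 'M[R]_n) f : rot_gen A -> \det (rotmx A f) = 1.
Proof.
move=> gA; have := rotmxD (f / 2) (f / 2) gA; rewrite -splitr => <-.
have := congr1 (@determinant R n) (rot_orth (f / 2) gA).
by rewrite !det_mulmx det_tr det1.
Qed.

Lemma rot_kill n (A : 'M[R]_n) f (u : 'rV[R]_n) : u *m A = 0 -> u *m rotmx A f = u.
Proof.
move=> uA; rewrite /rotmx !mulmxDr mulmx1 -!scalemxAr mulmxA uA mul0mx !scaler0.
by rewrite !addr0.
Qed.

Lemma rot_act n (A : 'M[R]_n) f (u w : 'rV[R]_n) : u *m A = w -> w *m A = - u ->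
  u *m rotmx A f = cos f *: u + sin f *: w.
Proof.
move=> uA wA; rewrite /rotmx !mulmxDr mulmx1 -!scalemxAr mulmxA uA wA.
by apply/rowP => i; rewrite !mxE; ring.
Qed.

(* The generator of the rotation turning [u] to [w], for [u], [w] orthogonal of
   equal length. *)
Definition plane n (u w : 'rV[R]_n) : 'M[R]_n := (dotv u u)^-1 *: (u^T *m w - w^T *m u).

Lemma plane_act n (u w z : 'rV[R]_n) :
  z *m plane u w = (dotv u u)^-1 *: (dotv z u *: w - dotv z w *: u).
Proof.
have P (a b : 'rV[R]_n) : z *m (a^T *m b) = dotv z a *: b.
  by rewrite mulmxA [z *m a^T]mx11_scalar mul_scalar_mx dotvE.
by rewrite /plane -scalemxAr mulmxBr !P.
Qed.

Section Plane.
Variables (n : nat) (u w : 'rV[R]_n).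
Hypotheses (u0 : 0 < dotv u u) (uw : dotv u w = 0) (ww : dotv w w = dotv u u).

Lemma plane_u : u *m plane u w = w.
Proof. by rewrite plane_act uw scale0r subr0 scalerA mulVf ?scale1r// gt_eqF. Qed.

Lemma plane_w : w *m plane u w = - u.
Proof.
by rewrite plane_act dotvC uw scale0r sub0r ww scalerN scalerA mulVf ?scale1r// gt_eqF.
Qed.

Lemma plane_kill z : dotv z u = 0 -> dotv z w = 0 -> z *m plane u w = 0.
Proof. by move=> zu zw; rewrite plane_act zu zw !scale0r subrr scaler0. Qed.

Lemma plane_gen : rot_gen (plane u w).
Proof.
split.
  rewrite /plane linearZ /= linearB /= !trmx_mul !trmxK.
  by rewrite -scalerN opprB.
apply/row_matrixP => i; rewrite [RHS]linearN /= !row_mul; set z := row i (plane u w).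
have [a [b ->]] : exists a b, z = a *: u + b *: w.
  rewrite /z rowE plane_act; eexists; eexists; rewrite scalerBr !scalerA -scaleNr addrC.
  by [].
by rewrite !mulmxDl -!scalemxAl plane_u plane_w !mulNmx plane_u !scalerN opprD.
Qed.

End Plane.

End Rotations.

(** * Calculus of vector-valued functions *)

Section VectorCalculus.
Context {R : realType}.
Implicit Types (t : R).

(** The l^1 norm, for estimates: it adds up coordinate bounds directly and dominates [enorm]. *)
Definition n1 m (u : 'rV[R]_m) : R := \sum_i `|u 0 i|.

Lemma n1_ge0 m (u : 'rV[R]_m) : 0 <= n1 u.
Proof. exact: sumr_ge0. Qed.

Lemma n1_coord m (u : 'rV[R]_m) i : `|u 0 i| <= n1 u.
Proof. by rewrite /n1 (bigD1 i)//= lerDl sumr_ge0. Qed.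

Lemma n1D m (u v : 'rV[R]_m) : n1 (u + v) <= n1 u + n1 v.
Proof. by rewrite -big_split; apply: ler_sum => i _; rewrite mxE ler_normD. Qed.

Lemma n1Z m (c : R) (u : 'rV[R]_m) : n1 (c *: u) = `|c| * n1 u.
Proof. by rewrite /n1 mulr_sumr; apply: eq_bigr => i _; rewrite mxE normrM. Qed.

Lemma n1_sum m (I : Type) (r : seq I) (F : I -> 'rV[R]_m) :
  n1 (\sum_(i <- r) F i) <= \sum_(i <- r) n1 (F i).
Proof.
elim: r => [|i r IH]; first by rewrite !big_nil /n1 big1// => i _; rewrite mxE normr0.
by rewrite !big_cons (le_trans (n1D _ _))// lerD2l.
Qed.

Lemma n1_mulmx m (u : 'rV[R]_m) (B : 'M[R]_m) :
  n1 (u *m B) <= (\sum_j \sum_k `|B k j|) * n1 u.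
Proof.
rewrite mulr_suml; apply: ler_sum => j _; rewrite mxE.
apply: le_trans (ler_norm_sum _ _ _) _.
rewrite mulr_suml; apply: ler_sum => k _.
by rewrite normrM mulrC ler_wpM2l// n1_coord.
Qed.

Lemma orth_coord m (u : 'rV[R]_m) (O : 'M[R]_m) i : O *m O^T = 1%:M ->
  `|(u *m O) 0 i| <= n1 u.
Proof.
move=> HO; rewrite mxE; apply: le_trans (ler_norm_sum _ _ _) _.
apply: ler_sum => j _; rewrite normrM -[leRHS]mulr1 ler_wpM2l//.
exact: orth_entry.
Qed.

Lemma n1_dotv m (u v : 'rV[R]_m) : `|dotv u v| <= n1 u * n1 v.
Proof.
apply: le_trans (ler_norm_sum _ _ _) _.
rewrite /n1 mulr_suml; apply: ler_sum => i _.
by rewrite normrM ler_wpM2l// n1_coord.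
Qed.

Lemma is_deriveDv m (f g : R -> 'rV[R]_m) (a b : 'rV[R]_m) t : is_derive t 1 f a ->
  is_derive t 1 g b -> is_derive t 1 (fun x => f x + g x) (a + b).
Proof. by move=> ? ?; exact: is_deriveD. Qed.

Lemma is_derive_scalev m (c : R -> R) (f : R -> 'rV[R]_m) (dc : R) (df : 'rV[R]_m) t :
  is_derive t 1 c dc -> is_derive t 1 f df ->
  is_derive t 1 (fun x => c x *: f x) (dc *: f t + c t *: df).
Proof.
move=> Dc /is_derive_rowP Df; apply/is_derive_rowP => i.
rewrite (_ : (fun x => _) = fun x => c x * f x 0 i); last by apply/funext => x; rewrite mxE.
by rewrite !mxE; exact: is_deriveMf.
Qed.

Lemma is_derive_scalecv m (c : R -> R) (u : 'rV[R]_m) (dc : R) t :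
  is_derive t 1 c dc -> is_derive t 1 (fun x => c x *: u) (dc *: u).
Proof.
move=> Dc; have := is_derive_scalev Dc (is_derive_cst u t 1).
by rewrite scaler0 addr0.
Qed.

Lemma is_derive_scalevc m (c : R) (f : R -> 'rV[R]_m) (df : 'rV[R]_m) t :
  is_derive t 1 f df -> is_derive t 1 (fun x => c *: f x) (c *: df).
Proof.
move=> Df; have := is_derive_scalev (is_derive_cst c t 1) Df.
by rewrite scale0r add0r.
Qed.

Lemma is_derive_sumv m (I : Type) (r : seq I) (F : I -> R -> 'rV[R]_m) (D : I -> 'rV[R]_m) t :
  (forall i, is_derive t 1 (F i) (D i)) ->
  is_derive t 1 (fun x => \sum_(i <- r) F i x) (\sum_(i <- r) D i).
Proof.
move=> H; apply/is_derive_rowP => j.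
rewrite (_ : (fun x => _) = fun x => \sum_(i <- r) F i x 0 j); last first.
  by apply/funext => x; rewrite summxE.
rewrite summxE; apply: is_derive_sumf => i _.
exact: ((is_derive_rowP _ _ _).1 (H i)).
Qed.

Lemma is_derive_mulmx m p (f : R -> 'rV[R]_m) (df : 'rV[R]_m) (M : 'M[R]_(m, p)) t :
  is_derive t 1 f df -> is_derive t 1 (fun x => f x *m M) (df *m M).
Proof.
move=> /is_derive_rowP Df; apply/is_derive_rowP => j.
rewrite (_ : (fun x => _) = fun x => \sum_i f x 0 i * M i j); last first.
  by apply/funext => x; rewrite mxE.
rewrite mxE; apply: is_derive_sumf => i _; rewrite mulrC.
have := is_deriveZf (M i j) (Df i).
by under eq_fun do rewrite mulrC.
Qed.

End VectorCalculus.

(** * Derivatives and common periods of sine and cosine *)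

Section Trig.
Context {R : realType}.

(* The [k]-th derivatives of [cos] and [sin]. *)
Definition cs k (s : R) := cos (s + k%:R * (pi / 2)).
Definition sn k (s : R) := sin (s + k%:R * (pi / 2)).

Lemma csS k s : cs k.+1 s = - sn k s.
Proof. by rewrite /cs /sn -natr1 mulrDl mul1r addrA cosDpihalf. Qed.

Lemma snS k s : sn k.+1 s = cs k s.
Proof. by rewrite /cs /sn -natr1 mulrDl mul1r addrA sinDpihalf. Qed.

Lemma cs0 s : cs 0 s = cos s. Proof. by rewrite /cs mul0r addr0. Qed.
Lemma sn0 s : sn 0 s = sin s. Proof. by rewrite /sn mul0r addr0. Qed.

Lemma cs4 s : cs 4 s = cos s. Proof. by rewrite !(csS, snS) opprK cs0. Qed.
Lemma sn4 s : sn 4 s = sin s. Proof. by rewrite !(csS, snS) opprK sn0. Qed.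

Lemma csD k s s' : cs k (s + s') = cs k s * cos s' - sn k s * sin s'.
Proof. by rewrite /cs /sn [X in cos X = _]addrAC [LHS]cosD. Qed.

Lemma snD k s s' : sn k (s + s') = sn k s * cos s' + cs k s * sin s'.
Proof. by rewrite /cs /sn [X in sin X = _]addrAC [LHS]sinD. Qed.

Lemma is_derive_cs k (c s : R) : is_derive s 1 (fun s => cs k (c * s)) (c * cs k.+1 (c * s)).
Proof.
have D : is_derive s 1 (fun s => c * s + k%:R * (pi / 2)) (c + 0).
  rewrite -[X in X + _](mulr1 c).
  exact: (is_deriveDf (is_deriveZf c (is_derive_id s 1)) (is_derive_cst _ s 1)).
have := is_derive_compf D (is_derive_cos (c * s + k%:R * (pi / 2))).
by rewrite addr0 csS (mulrC c (- _)).
Qed.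

Lemma is_derive_sn k (c s : R) : is_derive s 1 (fun s => sn k (c * s)) (c * sn k.+1 (c * s)).
Proof.
have D : is_derive s 1 (fun s => c * s + k%:R * (pi / 2)) (c + 0).
  rewrite -[X in X + _](mulr1 c).
  exact: (is_deriveDf (is_deriveZf c (is_derive_id s 1)) (is_derive_cst _ s 1)).
have := is_derive_compf D (is_derive_sin (c * s + k%:R * (pi / 2))).
by rewrite addr0 snS (mulrC c (cs _ _)).
Qed.

Lemma cos_2pin (x : R) m : cos (x + (pi *+ 2) *+ m) = cos x.
Proof. by rewrite (periodicn (@cosD2pi R)). Qed.

Lemma sin_2pin (x : R) m : sin (x + (pi *+ 2) *+ m) = sin x.
Proof. by rewrite (periodicn (@sinD2pi R)). Qed.

Lemma cs_2pin k (x : R) m : cs k (x + (pi *+ 2) *+ m) = cs k x.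
Proof. by rewrite /cs addrAC cos_2pin. Qed.

Lemma sn_2pin k (x : R) m : sn k (x + (pi *+ 2) *+ m) = sn k x.
Proof. by rewrite /sn addrAC sin_2pin. Qed.

Lemma cos_eq1 (z : R) : `|z| <= pi -> cos z = 1 -> z = 0.
Proof.
move=> zpi z1; apply/normr0_eq0; apply: cos_inj.
- by rewrite in_itv /= normr_ge0.
- by rewrite in_itv /= lexx pi_ge0.
- by rewrite cos_norm z1 cos0.
Qed.

Lemma cosB_eq1 (s t : R) : cos s = cos t -> sin s = sin t -> cos (s - t) = 1.
Proof. by move=> c1 s1; rewrite cosB c1 s1 -!expr2 cos2Dsin2. Qed.

Lemma cos1D (s t : R) : cos s = 1 -> cos t = 1 -> cos (s + t) = 1.
Proof.
move=> c1 c2; rewrite cosD c1 c2 [sin s]cos1sin0 ?c1 ?normr1//.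
by rewrite mul0r subr0 mulr1.
Qed.

Lemma cos1Mn (s : R) m : cos s = 1 -> cos (s *+ m) = 1.
Proof.
by move=> c1; elim: m => [|m IH]; [rewrite mulr0n cos0|rewrite mulrS cos1D].
Qed.

(** Bézout: the angles with cosine 1 are closed under sums and negation. *)
Lemma cos1_gcd (u : R) (ms : seq nat) : (forall m, m \in ms -> cos (u *+ m) = 1) ->
  cos (u *+ \big[gcdn/0%N]_(m <- ms) m) = 1.
Proof.
elim: ms => [|m ms IH] H; first by rewrite big_nil mulr0n cos0.
rewrite big_cons; have h1 : cos (u *+ m) = 1 by apply: H; rewrite mem_head.
have h2 := IH (fun k hk => H k (mem_behead (s := m :: ms) hk)).
set g := \big[_/_]_(_ <- _) _ in h2 *.
case: m h1 {H} => [|m] h1; first by rewrite gcd0n.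
case: (@egcdnP m.+1 g) => // km kn E _.
have -> : u *+ gcdn m.+1 g = u *+ m.+1 *+ km + - (u *+ g *+ kn).
  by rewrite -!mulrnA [(m.+1 * km)%N]mulnC E mulnC mulrnDr addrAC subrr add0r.
by apply: cos1D; [exact: cos1Mn|rewrite cosN; exact: cos1Mn].
Qed.

End Trig.

(** * Helices at perturbed speeds around a bent axis *)

Section BaseCurve.
Context {R : realType}.

Lemma pow_diff (a : R) k : 0 <= a -> exists2 C, 0 <= C & forall b, a <= b <= a + 1 ->
  0 <= b ^+ k - a ^+ k <= C * (b - a).
Proof.
move=> a0; elim: k => [|k [C C0 IH]]; first by exists 0 => // b _; rewrite !expr0 subrr mul0r lexx.
exists ((a + 1) * C + a ^+ k); first by rewrite addr_ge0 ?exprn_ge0// mulr_ge0//; lra.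
move=> b hb; have /andP[i1 i2] := IH b hb; move: hb => /andP[b1 b2].
have ak : 0 <= a ^+ k by rewrite exprn_ge0.
have -> : b ^+ k.+1 - a ^+ k.+1 = b * (b ^+ k - a ^+ k) + (b - a) * a ^+ k.
  by rewrite !exprS; ring.
apply/andP; split; first by rewrite addr_ge0// mulr_ge0//; lra.
rewrite [leRHS]mulrDl [(b - a) * _]mulrC lerD2r.
rewrite -mulrA; apply: ler_pM => //; lra.
Qed.

Variables (m : nat) (l : seq R) (x y : R -> 'rV[R]_m) (x0 : 'rV[R]_m) (B : 'M[R]_m).
Hypothesis lpos : forall a, a \in l -> 0 < a.
Implicit Types (wt : R -> R) (s th rho : R) (p : 'rV[R]_m).

(* [Hj wt k] is the [k]-th derivative of
   [\sum_a (sin (wt a s) x_a - cos (wt a s) y_a) / wt a]: a curve whose first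
   derivative is the orbit of [\sum_a x_a] under rotations at speeds [wt a]. *)
Definition Hj (wt : R -> R) k (s : R) : 'rV[R]_m :=
  \sum_(a <- l) (wt a ^+ k / wt a) *:
    (cs (k + 3) (wt a * s) *: x a + sn (k + 3) (wt a * s) *: y a).

Definition wt_ok (wt : R -> R) (rho : R) := forall a, a \in l -> a <= wt a <= a + rho.

Lemma is_derive_Hj wt k s : (forall a, a \in l -> 0 < wt a) ->
  is_derive s 1 (Hj wt k) (Hj wt k.+1 s).
Proof.
move=> w0; rewrite /Hj big_seq.
rewrite (_ : (fun s => _) = fun s => \sum_(a <- l) if a \in l then (wt a ^+ k / wt a) *:
    (cs (k + 3) (wt a * s) *: x a + sn (k + 3) (wt a * s) *: y a) else 0); last first.
  by apply/funext => z; rewrite -big_mkcond -big_seq.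
rewrite big_mkcond; apply: is_derive_sumv => a; case: ifP => al; last exact: is_derive_cst.
have wa0 : wt a != 0 by rewrite gt_eqF// w0.
have -> : (wt a ^+ k.+1 / wt a) *: (cs (k.+1 + 3) (wt a * s) *: x a + sn (k.+1 + 3) (wt a * s) *: y a)
  = (wt a ^+ k / wt a) *: ((wt a * cs (k + 3).+1 (wt a * s)) *: x a + (wt a * sn (k + 3).+1 (wt a * s)) *: y a).
  by rewrite exprS addSn; apply/rowP => i; rewrite !mxE; ring.
apply: is_derive_scalevc; apply: is_deriveDv; apply: is_derive_scalecv.
  exact: is_derive_cs.
exact: is_derive_sn.
Qed.

Lemma Hj_bound k : exists C, forall wt s, wt_ok wt 1 -> n1 (Hj wt k s) <= C.
Proof.
exists (\sum_(a <- l) ((a + 1) ^+ k / a) * (n1 (x a) + n1 (y a))) => wt s ok.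
apply: le_trans (n1_sum _ _) _; rewrite !big_seq; apply: ler_sum => a al.
have /andP[w1 w2] := ok a al; have a0 := lpos al.
have w0 : 0 < wt a by lra.
rewrite n1Z; apply: ler_pM => //; first exact: n1_ge0.
  have wk0 : 0 <= wt a ^+ k by rewrite exprn_ge0// ltW.
  have wi0 : 0 <= (wt a)^-1 by rewrite invr_ge0 ltW.
  rewrite ger0_norm; last exact: mulr_ge0.
  apply: ler_pM => //; last by rewrite lef_pV2.
  by rewrite lerXn2r ?nnegrE; lra.
apply: le_trans (n1D _ _) _; rewrite !n1Z; apply: lerD.
  by rewrite -[leRHS]mul1r ler_wpM2r ?n1_ge0// cos_max.
by rewrite -[leRHS]mul1r ler_wpM2r ?n1_ge0// sin_max.
Qed.

(* When [wt = id] and [x0] is the kernel part of [v], [Tj] gives the jets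
   of the (unbounded) curve with constant curvatures; a drift along [x0] is
   replaced below by a slow rotation [exp (th s B)] with [th p B = x0]. *)
Definition Tj wt k s := Hj wt k s + (k == 1)%:R *: x0.

(* The [k]-th derivative of [(Hj wt d + [d = 0] p) exp (th s B)] is
   [Zj p wt th k d s exp (th s B)]; [rj] collects the terms of order [th]. *)
Fixpoint Zj (p : 'rV[R]_m) wt (th : R) k d (s : R) : 'rV[R]_m :=
  if k is k'.+1 then Zj p wt th k' d.+1 s + th *: (Zj p wt th k' d s *m B)
  else Hj wt d s + (d == 0%N)%:R *: p.

Fixpoint rj wt (th : R) k d (s : R) : 'rV[R]_m :=
  if k is k'.+1 then rj wt th k' d.+1 s + Tj wt (k'.+1 + d) s *m B + th *: (rj wt th k' d s *m B)
  else Hj wt d s *m B.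

(** Since [th p B = x0], the rotation of [p] contributes to the first derivative exactly the drift
    [x0] of the model; all other effects of the bending are of order [th]. *)
Lemma Zj_rj p wt th k d s : th *: (p *m B) = x0 ->
  Zj p wt th k.+1 d s = Tj wt (k.+1 + d) s + th *: rj wt th k d s.
Proof.
move=> pB; elim: k d => [|k IH] d.
  rewrite /= /Tj add1n eqSS !scale0r addr0 mulmxDl scalerDr.
  by rewrite -scalemxAl scalerA mulrC -scalerA pB addrA addrAC.
rewrite [LHS](_ : _ = Zj p wt th k.+1 d.+1 s + th *: (Zj p wt th k.+1 d s *m B))//.
rewrite !IH [rj wt th k.+1 d s]/= addnS -addSn -addrA; congr (_ + _).
by rewrite mulmxDl -scalemxAl !scalerDr addrA.
Qed.

Lemma is_derive_Zj p wt th k d s : (forall a, a \in l -> 0 < wt a) ->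
  is_derive s 1 (Zj p wt th k d) (Zj p wt th k d.+1 s).
Proof.
move=> w0; elim: k d => [|k IH] d.
  rewrite /= scale0r.
  exact: (is_deriveDv (is_derive_Hj d s w0) (is_derive_cst _ s 1)).
exact: (is_deriveDv (IH d.+1) (is_derive_scalevc th (is_derive_mulmx B (IH d)))).
Qed.

Lemma rj_bound k d : exists C, forall wt th s, wt_ok wt 1 -> 0 <= th <= 1 ->
  n1 (rj wt th k d s) <= C.
Proof.
set b := \sum_j \sum_k `|B k j|.
have b0 : 0 <= b by apply: sumr_ge0 => ? _; exact: sumr_ge0.
elim: k d => [|k IH] d.
  have [C HC] := Hj_bound d; exists (b * C) => wt th s ok _ /=.
  by apply: le_trans (n1_mulmx _ _) _; rewrite ler_wpM2l// HC.
have [C1 H1] := IH d.+1; have [C2 H2] := IH d; have [C3 H3] := Hj_bound (k.+1 + d).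
exists (C1 + b * (C3 + n1 x0) + b * C2) => wt th s ok hth /=.
apply: le_trans (n1D _ _) _; apply: lerD.
  apply: le_trans (n1D _ _) _; apply: lerD; first exact: H1.
  apply: le_trans (n1_mulmx _ _) _; rewrite ler_wpM2l//.
  apply: le_trans (n1D _ _) _; apply: lerD; first exact: H3.
  rewrite n1Z -[leRHS]mul1r ler_wpM2r ?n1_ge0//.
  by case: (_ == _); rewrite ?normr1 ?normr0.
move/andP: (hth) => [th0 th1].
rewrite n1Z ger0_norm// -[leRHS]mul1r; apply: ler_pM => //; first exact: n1_ge0.
by apply: le_trans (n1_mulmx _ _) _; rewrite ler_wpM2l// H2.
Qed.

Definition gj p wt th k s := Zj p wt th k 0 s *m rotmx B (th * s).
Lemma is_derive_gj p wt th k s : (forall a, a \in l -> 0 < wt a) -> rot_gen B ->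
  is_derive s 1 (gj p wt th k) (gj p wt th k.+1 s).
Proof.
move=> w0 [_ B3]; have DZ := is_derive_Zj p th k 0 s w0.
pose f s := Zj p wt th k 0 s.
have E z : gj p wt th k z = f z + sin (th * z) *: (f z *m B) + (1 - cos (th * z)) *: (f z *m (B *m B)).
  by rewrite /gj /rotmx !mulmxDr mulmx1 -!scalemxAr.
have {}E : gj p wt th k = fun z => f z + sin (th * z) *: (f z *m B) + (1 - cos (th * z)) *: (f z *m (B *m B)).
  exact/funext.
rewrite E.
have Dth : is_derive s 1 (fun z => th * z) th.
  by rewrite -[X in is_derive _ _ _ X](mulr1 th); exact: is_deriveZf (is_derive_id s 1).
have Ds := is_derive_compf Dth (is_derive_sin (th * s)).
have Dc := is_deriveDf (is_derive_cst (1 : R) s 1) (is_deriveNf (is_derive_compf Dth (is_derive_cos (th * s)))).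
have D := is_deriveDv (is_deriveDv DZ (is_derive_scalev Ds (is_derive_mulmx B DZ)))
  (is_derive_scalev Dc (is_derive_mulmx (B *m B) DZ)).
case: D => d1 d2; apply: DeriveDef => //; rewrite d2.
rewrite /gj [Zj p wt th k.+1 0 s]/= /rotmx !mulmxDr !mulmx1 -!scalemxAr !mulmxDl -!scalemxAl.
rewrite -/(f s) !mulmxA.
have -> : f s *m B *m B *m B = - (f s *m B).
  by rewrite -mulmxN -B3 !mulmxA.
rewrite -[cst 1 s]/(1 : R); set f1 := Zj _ _ _ _ _ _.
move: (f1 *m B *m B) (f s *m B *m B) (f1 *m B) (f s *m B) => g1 g2 g3 g4.
by apply/rowP => i; rewrite !mxE; ring.
Qed.

Section Comparison.
Variables (K : 'M[R]_m) (v : 'rV[R]_m).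
Hypothesis ul : uniq l.
Hypothesis vE : v = x0 + \sum_(a <- l) x a.
Hypothesis x0K : x0 *m K = 0.
Hypothesis xyK : forall a, a \in l -> x a *m K = a *: y a /\ y a *m K = - a *: x a.
Hypothesis xx : forall a, a \in l -> 0 < dotv (x a) (x a) /\ dotv (y a) (y a) = dotv (x a) (x a).
Hypothesis x0xy : forall a, a \in l -> [/\ dotv (x a) (y a) = 0, dotv x0 (x a) = 0 & dotv x0 (y a) = 0].
Hypothesis xyb : forall a b, a \in l -> b \in l -> a != b ->
  [/\ dotv (x a) (x b) = 0, dotv (x a) (y b) = 0 & dotv (y a) (y b) = 0].

(** The derivatives at 0 of a curve with velocity [v exp (s K)]: the first one is [v], whence
    [k.-1]; the value at index 0 is a default. *)
Definition wv k := iter k.-1 (mulmxr K) v.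

(** An offset of 4 is a full turn, so [cs (k + 4)] is the [k]-th derivative of [cos]; it is written
    this way to match the terms of [Hj wt k.+1]. *)
Lemma wvE k : wv k.+1 = (k == 0%N)%:R *: x0 +
  \sum_(a <- l) a ^+ k *: (cs (k + 4) 0 *: x a + sn (k + 4) 0 *: y a).
Proof.
elim: k => [|k IH].
  rewrite /wv /= vE scale1r; congr (_ + _); apply: eq_bigr => a _.
  by rewrite expr0 cs4 sn4 cos0 sin0 scale0r addr0 !scale1r.
rewrite [LHS](_ : _ = wv k.+1 *m K)// IH mulmxDl -scalemxAl x0K scaler0 scale0r !add0r.
rewrite mulmx_suml !big_seq; apply: eq_bigr => a al; have [xK yK] := xyK al.
rewrite -scalemxAl mulmxDl -!scalemxAl xK yK exprSr -scalerA; congr (_ *: _).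
by rewrite addSn csS snS; apply/rowP => i; rewrite !mxE; ring.
Qed.

(** Plays the part of [exp (s K)], at the perturbed speeds [wt a] and only in the planes that [v]
    meets. *)
Definition Xm (wt : R -> R) s : 'M[R]_m :=
  \big[mulmx/1%:M]_(a <- l) rotmx (plane (x a) (y a)) (wt a * s).

Lemma gen_plane a : a \in l -> rot_gen (plane (x a) (y a)).
Proof.
by move=> al; have [? ?] := xx al; have [? _ _] := x0xy al; exact: plane_gen.
Qed.

Lemma Xm_orth wt s : Xm wt s *m (Xm wt s)^T = 1%:M /\ \det (Xm wt s) = 1.
Proof.
rewrite /Xm big_seq; elim/big_rec: _ => [|a M al [IH1 IH2]].
  by rewrite trmx1 mulmx1 det1.
rewrite trmx_mul mulmxA -(mulmxA _ M) IH1 mulmx1 rot_orth; last exact: gen_plane.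
by rewrite det_mulmx IH2 mulr1 rot_det//; exact: gen_plane.
Qed.

Lemma Xm_kill (r : seq R) (F : R -> R) (u : 'rV[R]_m) : (forall a, a \in r -> u *m plane (x a) (y a) = 0) ->
  u *m (\big[mulmx/1%:M]_(a <- r) rotmx (plane (x a) (y a)) (F a)) = u.
Proof.
elim: r => [|a r IH] H; first by rewrite big_nil mulmx1.
rewrite big_cons mulmxA rot_kill; last by apply: H; rewrite mem_head.
by apply: IH => b br; apply: H; rewrite in_cons br orbT.
Qed.

Lemma x_kill a b : a \in l -> b \in l -> a != b ->
  x a *m plane (x b) (y b) = 0 /\ y a *m plane (x b) (y b) = 0.
Proof.
move=> al bl ab; have [h1 h2 h3] := xyb al bl ab.
have ba : b != a by rewrite eq_sym.
have [_ h4 _] := xyb bl al ba.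
by split; apply: plane_kill => //; rewrite dotvC.
Qed.

Lemma prod_rot_act (r : seq R) (F : R -> R) a (u w : 'rV[R]_m) : uniq r -> a \in r ->
  (forall b, b \in r -> b != a -> u *m plane (x b) (y b) = 0 /\ w *m plane (x b) (y b) = 0) ->
  u *m plane (x a) (y a) = w -> w *m plane (x a) (y a) = - u ->
  u *m (\big[mulmx/1%:M]_(b <- r) rotmx (plane (x b) (y b)) (F b)) =
  cos (F a) *: u + sin (F a) *: w.
Proof.
move=> + + + uw wu; elim: r => [//|b r IH] /= /andP[br ur]; rewrite in_cons big_cons mulmxA.
have [ab _ H|ab /= ar H] := eqVneq a b.
  move: br H; rewrite -{b}ab => br H; rewrite (rot_act _ uw wu) mulmxDl -!scalemxAl.
  have H' c : c \in r -> u *m plane (x c) (y c) = 0 /\ w *m plane (x c) (y c) = 0.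
    move=> cr; apply: H; first by rewrite in_cons cr orbT.
    by apply: contraNneq br => <-.
  by rewrite !Xm_kill// => c /H'[].
have ba : b != a by rewrite eq_sym.
have [ub _] := H b (mem_head _ _) ba.
rewrite rot_kill// IH// => c cr ca.
by apply: H => //; rewrite in_cons cr orbT.
Qed.

Lemma Xm_act wt s a : a \in l ->
  x a *m Xm wt s = cos (wt a * s) *: x a + sin (wt a * s) *: y a /\
  y a *m Xm wt s = cos (wt a * s) *: y a - sin (wt a * s) *: x a.
Proof.
move=> al.
have [xp xy2] := xx al; have [xy0 _ _] := x0xy al.
have pu := plane_u xp xy0; have pw := plane_w xp xy0 xy2.
have U b : b \in l -> b != a -> x a *m plane (x b) (y b) = 0 /\ y a *m plane (x b) (y b) = 0.
  by move=> bl ba; apply: x_kill; rewrite // eq_sym.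
split; first exact: prod_rot_act.
rewrite (@prod_rot_act l (fun a => wt a * s) a (y a) (- x a))// ?scalerN//.
  by move=> b bl ba; have [h1 h2] := U b bl ba; rewrite mulNmx h1 oppr0.
by rewrite mulNmx pu.
Qed.

Lemma wv_Xm wt s k : wv k.+1 *m Xm wt s = (k == 0%N)%:R *: x0 +
  \sum_(a <- l) a ^+ k *: (cs (k + 4) (wt a * s) *: x a + sn (k + 4) (wt a * s) *: y a).
Proof.
rewrite wvE mulmxDl -scalemxAl Xm_kill; last first.
  by move=> a al; have [_ ? ?] := x0xy al; exact: plane_kill.
congr (_ + _); rewrite mulmx_suml !big_seq; apply: eq_bigr => a al.
have [xX yX] := Xm_act wt s al.
rewrite -scalemxAl mulmxDl -!scalemxAl xX yX -[wt a * s]add0r csD snD !add0r; congr (_ *: _).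
by apply/rowP => i; rewrite !mxE; ring.
Qed.

(** [Xm wt s] turns at the perturbed speeds themselves, so all angles agree and only the factors
    [wt a ^+ k] and [a ^+ k] differ. This is why the bound is uniform in [s], although the two
    motions drift apart. *)
Lemma Tj_close k : exists2 C, 0 <= C & forall wt rho s, wt_ok wt rho -> 0 <= rho <= 1 ->
  n1 (Tj wt k.+1 s - wv k.+1 *m Xm wt s) <= C * rho.
Proof.
pose Ck a := if pselect (0 <= a) is left a0 then s2val (cid2 (pow_diff k a0)) else 0.
have CkP a : a \in l -> 0 <= Ck a /\ forall b, a <= b <= a + 1 -> 0 <= b ^+ k - a ^+ k <= Ck a * (b - a).
  move=> al; rewrite /Ck; case: pselect => [a0|na]; first by case: cid2.
  by exfalso; apply: na; rewrite ltW// lpos.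
exists (\sum_(a <- l) Ck a * (n1 (x a) + n1 (y a))).
  rewrite big_seq sumr_ge0// => a al; rewrite mulr_ge0 ?addr_ge0 ?n1_ge0//.
  by have [] := CkP a al.
move=> wt rho s ok /andP[r0 r1]; rewrite wv_Xm /Tj eqSS [_ *: x0 + _]addrC opprD addrACA subrr addr0.
rewrite /Hj -sumrB mulr_suml.
apply: le_trans (n1_sum _ _) _; rewrite !big_seq; apply: ler_sum => a al.
have /andP[w1 w2] := ok a al; have a0 := lpos al; have [C0 HC] := CkP a al.
have w0 : wt a != 0 by rewrite gt_eqF//; lra.
rewrite exprSr mulfK// addSn -addnS -scalerBl n1Z.
have := HC (wt a); rewrite w1 (le_trans w2) ?lerD2l// => /(_ isT) /andP[h1 h2].
rewrite ger0_norm// mulrAC; apply: ler_pM => //; first exact: n1_ge0.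
  by apply: le_trans h2 _; rewrite ler_wpM2l//; lra.
apply: le_trans (n1D _ _) _; rewrite !n1Z; apply: lerD.
  by rewrite -[leRHS]mul1r ler_wpM2r ?n1_ge0// cos_max.
by rewrite -[leRHS]mul1r ler_wpM2r ?n1_ge0// sin_max.
Qed.

Hypothesis gB : rot_gen B.

Lemma gj_close M : exists2 C, 0 <= C & forall p wt th rho s,
  wt_ok wt rho -> 0 <= rho <= 1 -> 0 <= th <= 1 -> th *: (p *m B) = x0 ->
  exists2 O : 'M[R]_m, O *m O^T = 1%:M /\ \det O = 1 &
  forall k i, (k < M)%N -> `|gj p wt th k.+1 s 0 i - (wv k.+1 *m O) 0 i| <= C * (rho + th).
Proof.
have H1 k : exists2 C, 0 <= C & forall p wt th rho s, wt_ok wt rho -> 0 <= rho <= 1 -> 0 <= th <= 1 ->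
    th *: (p *m B) = x0 -> n1 (Zj p wt th k.+1 0 s - wv k.+1 *m Xm wt s) <= C * (rho + th).
  have [C1 C10 HC1] := Tj_close k; have [C2 HC2] := rj_bound k 0.
  exists (C1 + `|C2|) => [|p wt th rho s ok r01 t01 pB]; first by rewrite addr_ge0.
  have ok1 : wt_ok wt 1.
    move=> a al; have /andP[w1 w2] := ok a al; rewrite w1 (le_trans w2)// lerD2l.
    by case/andP: r01.
  rewrite Zj_rj// addn0 addrAC; apply: le_trans (n1D _ _) _.
  have h1 := HC1 _ _ s ok r01.
  have h2 := HC2 _ _ s ok1 t01.
  have {}h2 : n1 (rj wt th k 0 s) <= `|C2| by apply: le_trans h2 (ler_norm _).
  move: r01 t01 => /andP[r0 r1] /andP[t0 t1].
  rewrite n1Z (ger0_norm t0) mulrDl; apply: lerD.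
    by apply: le_trans h1 _; rewrite ler_wpM2l// lerDl.
  rewrite mulrC; apply: ler_pM => //; first exact: n1_ge0.
  by rewrite lerDr.
have [C C0 HC] : exists2 C, 0 <= C & forall k, (k < M)%N -> forall p wt th rho s, wt_ok wt rho -> 0 <= rho <= 1 -> 0 <= th <= 1 ->
    th *: (p *m B) = x0 -> n1 (Zj p wt th k.+1 0 s - wv k.+1 *m Xm wt s) <= C * (rho + th).
  elim: M => [|M [C C0 IH]]; first by exists 0.
  have [C1 C10 HC1] := H1 M; exists (C + C1); first by rewrite addr_ge0.
  move=> k; rewrite ltnS leq_eqVlt => /predU1P[->|kM] p wt th rho s ok r01 t01 pB.
    apply: le_trans (HC1 _ _ _ _ s ok r01 t01 pB) _; rewrite ler_wpM2r ?lerDr//.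
    by case/andP: r01 => ? _; case/andP: t01 => ? _; rewrite addr_ge0.
  apply: le_trans (IH k kM _ _ _ _ s ok r01 t01 pB) _; rewrite ler_wpM2r ?lerDl//.
  by case/andP: r01 => ? _; case/andP: t01 => ? _; rewrite addr_ge0.
exists C => // p wt th rho s ok r01 t01 pB.
have [X1 X2] := Xm_orth wt s; have R1 := rot_orth (th * s) gB; have R2 := rot_det (th * s) gB.
exists (Xm wt s *m rotmx B (th * s)).
  split; last by rewrite det_mulmx X2 R2 mulr1.
  by rewrite trmx_mul mulmxA -(mulmxA _ (rotmx _ _)) R1 mulmx1.
move=> k i kM; have := HC k kM _ _ _ _ s ok r01 t01 pB; apply: le_trans.
have -> : gj p wt th k.+1 s 0 i - (wv k.+1 *m (Xm wt s *m rotmx B (th * s))) 0 i =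
   ((Zj p wt th k.+1 0 s - wv k.+1 *m Xm wt s) *m rotmx B (th * s)) 0 i.
  by rewrite /gj mulmxA [in RHS]mulmxBl [RHS]mxE; congr (_ + _); rewrite [RHS]mxE.
exact: orth_coord.
Qed.

Lemma gj_periodic p wt th P k s : (forall a, a \in l -> exists j : nat, wt a * P = (pi *+ 2) *+ j) ->
  (exists j : nat, th * P = (pi *+ 2) *+ j) -> gj p wt th k (s + P) = gj p wt th k s.
Proof.
move=> HP [j0 Hth].
have HH d z : Hj wt d (z + P) = Hj wt d z.
  rewrite /Hj !big_seq; apply: eq_bigr => a al; have [j Hja] := HP a al.
  by rewrite mulrDr Hja cs_2pin sn_2pin.
have HZ d : forall z, Zj p wt th k d (z + P) = Zj p wt th k d z.
  by elim: k d => [|k IH] d z /=; rewrite ?HH ?IH ?IH.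
by rewrite /gj HZ mulrDr Hth /rotmx sin_2pin cos_2pin.
Qed.

Lemma dotv_Hj wt s a : a \in l ->
  dotv (Hj wt 0 s) (x a) = (wt a)^-1 * cs 3 (wt a * s) * dotv (x a) (x a) /\
  dotv (Hj wt 0 s) (y a) = (wt a)^-1 * sn 3 (wt a * s) * dotv (x a) (x a).
Proof.
move=> al; have [xy0 _ _] := x0xy al; have [_ yy] := xx al.
have Z b : b \in l -> b != a -> [/\ dotv (x b) (x a) = 0, dotv (y b) (x a) = 0,
    dotv (x b) (y a) = 0 & dotv (y b) (y a) = 0].
  move=> bl ba; have [h1 h2 h3] := xyb bl al ba.
  have ab : a != b by rewrite eq_sym.
  by have [_ h4 _] := xyb al bl ab; split=> //; rewrite dotvC.
rewrite /Hj !dotv_suml; split; rewrite (bigD1_seq a)//= big_seq_cond big1 ?addr0.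
- by rewrite dotvZl dotvDl !dotvZl [dotv (y a) _]dotvC xy0 expr0; ring.
- by move=> b /andP[bl ba]; have [h1 h2 _ _] := Z b bl ba; rewrite dotvZl dotvDl !dotvZl h1 h2 !mulr0 addr0 mulr0.
- by rewrite dotvZl dotvDl !dotvZl xy0 yy expr0; ring.
- by move=> b /andP[bl ba]; have [_ _ h1 h2] := Z b bl ba; rewrite dotvZl dotvDl !dotvZl h1 h2 !mulr0 addr0 mulr0.
Qed.

Lemma Hj_inj wt s s' a : a \in l -> 0 < wt a -> Hj wt 0 s = Hj wt 0 s' ->
  cos (wt a * (s - s')) = 1.
Proof.
move=> al w0 E; have [h1 h2] := dotv_Hj wt s al; have [h1' h2'] := dotv_Hj wt s' al.
have [xp _] := xx al.
have wi0 : (wt a)^-1 != 0 by rewrite invr_neq0 ?gt_eqF.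
have xp0 : dotv (x a) (x a) != 0 by rewrite gt_eqF.
move: h1 h2; rewrite E h1' h2' => /(mulIf xp0)/(mulfI wi0) e1 /(mulIf xp0)/(mulfI wi0) e2.
have := cosB_eq1 (esym e1) (esym e2).
by rewrite mulrBr opprD addrACA subrr addr0.
Qed.

End Comparison.
End BaseCurve.

(** * A closed embedded curve close to the model *)

Section BaseExists.
Context {R : realType}.

(* Rounds [a] up to a multiple of [th], so that all speeds are commensurable. *)
Definition rfreq (th a : R) : R := th * (Num.truncn (a / th)).+1%:R.

Lemma rfreq_ok (th a : R) : 0 < th -> 0 < a -> a <= rfreq th a <= a + th.
Proof.
move=> t0 a0; have at0 : 0 <= a / th by rewrite divr_ge0 ?ltW.
have /andP[h1 h2] := truncn_itv at0.
rewrite /rfreq -natr1 mulrDr mulr1; set q := (Num.truncn _)%:R in h1 h2 *.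
have E : a = th * (a / th) by rewrite mulrC divfK// gt_eqF.
have h1' : th * q <= th * (a / th) by rewrite ler_pM2l.
have h2' : th * (a / th) < th * (q + 1) by rewrite ltr_pM2l// /q natr1.
by apply/andP; lra.
Qed.

Lemma base_curve n (K : 'M[R]_n.+1) (v : 'rV[R]_n.+1) (eta : R) : (1 <= n)%N ->
  K^T = - K -> v != 0 -> 0 < eta ->
  exists (P : R) (g : nat -> R -> 'rV[R]_n.+1),
  [/\ 0 < P, forall k (s : R), is_derive s 1 (g k) (g k.+1 s), forall k s, g k (s + P) = g k s,
     forall s s', `|s - s'| <= P / 2 -> g 0%N s = g 0%N s' -> s = s' &
     forall s, exists2 O : 'M[R]_n.+1, O *m O^T = 1%:M /\ \det O = 1 &
       forall k i, (1 <= k <= n.+1)%N -> `|g k s 0 i - (wv K v k *m O) 0 i| < eta].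
Proof.
move=> hn KT v0 eta0.
have [l [x [y [x0 [ul lpos vE x0K [xyK xx x0xy xyb]]]]]] := antisym_decomp v KT.
have pi20 : 0 < pi *+ 2 :> R by rewrite pmulrn_lgt0// pi_gt0.
(* Without drift the orbit closes up as soon as its speeds are commensurable, and no axis has to be
   bent: [B = 0]. *)
have [x00|x00] := eqVneq x0 0.
  have gB : rot_gen (0 : 'M[R]_n.+1) by split; rewrite ?trmx0 ?mulmx0 oppr0.
  have [C C0 HC] := gj_close lpos ul vE x0K xyK xx x0xy xyb gB n.+1.
  pose th := Num.min 1 (eta / (C + 1) / 2).
  have C1 : 0 < C + 1 by lra.
  have th0 : 0 < th by rewrite lt_min ltr01 !divr_gt0.
  have th1 : th <= 1 by rewrite ge_min lexx.
  have thC : C * th < eta.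
    have : th <= eta / (C + 1) / 2 by rewrite ge_min lexx orbT.
    have E : eta = eta / (C + 1) * (C + 1) by rewrite divfK// gt_eqF.
    have e1 : 0 < eta / (C + 1) by rewrite divr_gt0.
    by set q := eta / (C + 1) in E e1 *; nra.
  pose wt := rfreq th; have ok : wt_ok l wt th by move=> a al; apply: rfreq_ok => //; exact: lpos.
  have wp a : a \in l -> 0 < wt a.
    by move=> al; have /andP[h _] := ok a al; apply: lt_le_trans h; exact: lpos.
  pose mf a := (Num.truncn (a / th)).+1.
  pose ms := [seq mf a | a <- l].
  (* All speeds are multiples [mf a] of [th]. Their gcd gives the least common period; a larger [P]
     would violate injectivity within half a period. *)
  pose gg := (\big[gcdn/0]_(m <- ms) m)%N.
  have gdiv a : a \in l -> (gg %| mf a)%N.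
    move=> al; have : mf a \in ms by exact: map_f.
    rewrite /gg; elim: (ms) => [//|b r IH]; rewrite in_cons big_cons => /predU1P[->|/IH h].
      exact: dvdn_gcdl.
    exact: dvdn_trans (dvdn_gcdr _ _) h.
  have g0 : (0 < gg)%N.
    have [a al] : exists a, a \in l.
      case: l vE {ul lpos xyK xx x0xy xyb HC ok wp ms gg gdiv} => [|a r _]; last by exists a; rewrite mem_head.
      by rewrite big_nil addr0 x00 => v00; rewrite v00 eqxx in v0.
    exact: dvdn_gt0 (ltn0Sn _) (gdiv a al).
  pose P := (pi *+ 2) / (th * gg%:R).
  have tg0 : 0 < th * gg%:R by rewrite mulr_gt0// ltr0n.
  have P0 : 0 < P by rewrite divr_gt0.
  exists P, (gj l x y 0 0 wt 0); split=> //.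
  - by move=> k s; exact: is_derive_gj.
  - move=> k s; apply: gj_periodic; last by exists 0%N; rewrite mul0r mulr0n.
    move=> a al; exists (mf a %/ gg)%N; rewrite /wt /rfreq -/(mf a) /P.
    have -> : (mf a)%:R = (mf a %/ gg)%:R * gg%:R :> R by rewrite -natrM divnK// gdiv.
    rewrite -[RHS]mulr_natr; set d := (_ %/ _)%:R; set Q := pi *+ 2.
    have -> : th * (d * gg%:R) * (Q / (th * gg%:R)) = Q * d * ((th * gg%:R) / (th * gg%:R)) by ring.
    by rewrite divff ?mulr1// gt_eqF.
  - move=> s s' ss E.
    have EH : Hj l x y wt 0 s = Hj l x y wt 0 s'.
      by move: E; rewrite /gj !mul0r !rotmx0 !mulmx1 /= !scaler0 !addr0.
    have c1 : cos (th * (s - s') *+ gg) = 1.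
      apply: cos1_gcd => m /mapP[a al ->].
      rewrite -mulr_natr mulrAC -[th * _]/(wt a).
      exact: (Hj_inj ul xx x0xy xyb al (wp a al) EH).
    have : th * (s - s') *+ gg = 0.
      apply: cos_eq1 => //; rewrite -mulr_natr mulrAC normrM (gtr0_norm tg0).
      rewrite mulrC -ler_pdivlMr// (le_trans ss)// /P mulrAC.
      by rewrite -(mulr_natr pi 2) mulfK// pnatr_eq0.
    move=> /eqP; rewrite mulrn_eq0 (gtn_eqF g0)/= mulf_eq0 gt_eqF//= subr_eq0.
    by move=> /eqP.
  - move=> s; have [| | |O HO1 HO2] := HC 0 wt 0 th s ok.
    + by rewrite ltW.
    + by rewrite lexx ler01.
    + by rewrite scale0r x00.
    exists O => // -[//|k] i /andP[_ kn].
    by apply: le_lt_trans (HO2 k i kn) _; rewrite addr0.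
have rho0 : 0 < dotv x0 x0 by rewrite lt_def dotv_eq0 x00 dotv_ge0.
(* The circle needs a direction [q] orthogonal to [x0] and of the same length; it exists because the
   ambient dimension is at least 2. *)
have [zv z0 zx0] := orth_compl x0 hn.
have {}zx0 : dotv zv x0 = 0 by have := zx0 0; rewrite row_id dotvC.
have zz0 : 0 < dotv zv zv by rewrite lt_def dotv_eq0 z0 dotv_ge0.
have [q qx0 qq] : exists2 q, dotv q x0 = 0 & dotv q q = dotv x0 x0.
  exists ((Num.sqrt (dotv x0 x0 / dotv zv zv)) *: zv); first by rewrite dotvZl zx0 mulr0.
  rewrite dotvZl dotvZr mulrA -expr2 sqr_sqrtr ?divfK ?gt_eqF//.
  by rewrite divr_ge0// ltW.
have qq0 : 0 < dotv q q by rewrite qq.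
pose B := plane q x0.
have gB : rot_gen B by apply: plane_gen => //; rewrite qq.
have qB : q *m B = x0 by exact: plane_u.
have x0B : x0 *m B = - q by apply: plane_w => //; rewrite qq.
have [C C0 HC] := gj_close lpos ul vE x0K xyK xx x0xy xyb gB n.+1.
have [C' HC'] := Hj_bound x y lpos 0.
(* Exceeds the pairing of the helical part with [q]. Once [th * C2 <= dotv q q], the axis circle, of
   radius [|q| / th], outweighs that part in [D] below. *)
pose C2 := `|C'| * n1 q + 1.
have C20 : 0 < C2 by rewrite ltr_wpDl// mulr_ge0// n1_ge0.
have C1 : 0 < C + 1 by lra.
pose th := Num.min 1 (Num.min (eta / (C + 1) / 3) (dotv q q / C2)).
have th0 : 0 < th by rewrite !lt_min ltr01 !divr_gt0.
have th1 : th <= 1 by rewrite ge_min lexx.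
have thC : C * (th + th) < eta.
  have : th <= eta / (C + 1) / 3 by rewrite !ge_min lexx orbT.
  have E : eta = eta / (C + 1) * (C + 1) by rewrite divfK// gt_eqF.
  have e1 : 0 < eta / (C + 1) by rewrite divr_gt0.
  by set r := eta / (C + 1) in E e1 *; nra.
have thC2 : th * C2 <= dotv q q.
  by rewrite -ler_pdivlMr// !ge_min lexx !orbT.
pose wt := rfreq th; have ok : wt_ok l wt th by move=> a al; apply: rfreq_ok => //; exact: lpos.
have wp a : a \in l -> 0 < wt a.
  by move=> al; have /andP[h _] := ok a al; apply: lt_le_trans h; exact: lpos.
pose P := (pi *+ 2) / th.
have P0 : 0 < P by rewrite divr_gt0.
(* Turning at angular speed [th], a point at this distance moves with velocity [x0]. *)
pose p := th^-1 *: q.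
have pB : th *: (p *m B) = x0.
  by rewrite -scalemxAl qB scalerA divff ?scale1r// gt_eqF.
have thP : th * P = pi *+ 2 by rewrite /P mulrC divfK// gt_eqF.
exists P, (gj l x y B p wt th); split=> //.
- by move=> k s; exact: is_derive_gj.
- move=> k s; apply: gj_periodic; last by exists 1%N; rewrite mulr1n.
  move=> a al; exists (Num.truncn (a / th)).+1; rewrite /wt /rfreq mulrAC thP.
  by rewrite mulr_natr.
- move=> s s' ss E.
  (* In the plane of [q] and [x0] the curve has angle [th * z] and, up to a constant factor, radius
     [D z > 0]; hence equal points have equal angles modulo a full turn. *)
  pose D z := dotv q q / th + dotv (Hj l x y wt 0 z) q.
  have Dpos z : 0 < D z.
    have ok1 : wt_ok l wt 1.
      by move=> a al; have /andP[w1 w2] := ok a al; rewrite w1 (le_trans w2)// lerD2l.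
    have h1 := HC' wt z ok1; have h2 := n1_dotv (Hj l x y wt 0 z) q.
    have h3 : n1 (Hj l x y wt 0 z) * n1 q <= `|C'| * n1 q.
      by rewrite ler_wpM2r ?n1_ge0// (le_trans h1)// ler_norm.
    have h4 : C2 <= dotv q q / th by rewrite ler_pdivlMr// mulrC.
    have := ler_norm (- dotv (Hj l x y wt 0 z) q); rewrite normrN => h5.
    by rewrite /D; move: h4; rewrite /C2; lra.
  have Hx0 z : dotv (Hj l x y wt 0 z) x0 = 0.
    rewrite /Hj dotv_suml big_seq big1// => a al; have [_ e1 e2] := x0xy a al.
    by rewrite dotvZl dotvDl !dotvZl dotvC e1 dotvC e2 !mulr0 addr0 mulr0.
  have R1 z := rot_orth z gB.
  have mv u w z : dotv (u *m rotmx B z) w = dotv u (w *m rotmx B (- z)).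
    by rewrite -rotmxT// -(dotv_mx u _ (R1 z)) -mulmxA (mulmx1C (R1 z)) mulmx1.
  have x0r z : x0 *m rotmx B (- z) = cos z *: x0 + sin z *: q.
    by rewrite (rot_act _ x0B) ?mulNmx ?qB// cosN sinN scaleNr scalerN opprK.
  have qr z : q *m rotmx B (- z) = cos z *: q - sin z *: x0.
    by rewrite (rot_act _ qB x0B) cosN sinN scaleNr.
  have gq z : dotv (gj l x y B p wt th 0 z) q = cos (th * z) * D z /\
      dotv (gj l x y B p wt th 0 z) x0 = sin (th * z) * D z.
    rewrite /gj !mv x0r qr /= scale1r.
    have u1 : dotv (Hj l x y wt 0 z + p) x0 = 0 by rewrite dotvDl Hx0 dotvZl qx0 mulr0 addr0.
    have u2 : dotv (Hj l x y wt 0 z + p) q = D z by rewrite dotvDl dotvZl addrC mulrC.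
    by rewrite !dotvDr -scaleNr !dotvZr u1 u2 !mulr0 addr0 add0r.
  have [q1 x1] := gq s; have [q2 x2] := gq s'; rewrite -E q1 in q2; rewrite -E x1 in x2.
  have DD : D s = D s'.
    have e1 := cos2Dsin2 (th * s); have e2 := cos2Dsin2 (th * s').
    have : D s ^+ 2 = D s' ^+ 2.
      rewrite -[LHS]mul1r -[RHS]mul1r -{1}e1 -e2 !mulrDl -!exprMn.
      by rewrite q2 x2.
    by move=> /eqP; rewrite eqrXn2 ?ltW// => /eqP.
  have Dn : D s' != 0 by rewrite gt_eqF.
  move: q2 x2; rewrite DD => /(mulIf Dn) e1 /(mulIf Dn) e2.
  have := cosB_eq1 e1 e2; rewrite -mulrBr => /cos_eq1 c1.
  have : th * (s - s') = 0.
    apply: c1; rewrite normrM (gtr0_norm th0) mulrC -ler_pdivlMr//.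
    by rewrite (le_trans ss)// /P mulrAC -(mulr_natr pi 2) mulfK.
  by move=> /eqP; rewrite mulf_eq0 gt_eqF//= subr_eq0 => /eqP.
- move=> s; have [||O HO1 HO2] := HC p wt th th s ok _ _ pB.
  + by rewrite ltW.
  + by rewrite ltW.
  exists O => // -[//|k] i /andP[_ kn].
  by apply: le_lt_trans (HO2 k i kn) _.
Qed.

End BaseExists.

(** * The model jet with given constant curvatures *)

Section Model.
Context {R : realType}.

(** The Frenet matrix for row vectors: row [i] holds the derivative of [e i.+1] in the frame, whence
    [c j] at [j = i.+1]. *)
Definition frenetK n (c : nat -> R) : 'M[R]_n.+1 :=
  \matrix_(i, j) (if (j : nat) == i.+1 then c j else if (i : nat) == j.+1 then - c i else 0).

Lemma frenetKT n (c : nat -> R) : (frenetK n c)^T = - frenetK n c.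
Proof.
apply/matrixP => i j; rewrite !mxE.
case: (i =P j.+1 :> nat) => [->|ij]; last first.
  by case: (j =P i.+1 :> nat) => _; rewrite ?opprK ?oppr0.
by rewrite (ltn_eqF (leqW (leqnn _))) opprK.
Qed.

Let e0 n : 'rV[R]_n.+1 := delta_mx 0 0.
Let E n (k : nat) : 'rV[R]_n.+1 := delta_mx 0 (inord k.-1).

Lemma wv_frenet n (c : nat -> R) k : (k <= n)%N ->
  (forall i : 'I_n.+1, (k < i)%N -> wv (frenetK n c) (e0 n) k.+1 0 i = 0) /\
  wv (frenetK n c) (e0 n) k.+1 0 (inord k) = \prod_(1 <= i < k.+1) c i.
Proof.
elim: k => [_|k IH kn].
  split; first by move=> i i0; rewrite /wv /= mxE eqxx -val_eqE /= gtn_eqF.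
  by rewrite big_geq// /wv /= mxE eqxx -val_eqE /= inordK.
have [IH1 IH2] := IH (ltnW kn).
have S i : wv (frenetK n c) (e0 n) k.+2 0 i =
    \sum_j wv (frenetK n c) (e0 n) k.+1 0 j * frenetK n c j i.
  by rewrite [wv _ _ k.+2](_ : _ = wv (frenetK n c) (e0 n) k.+1 *m frenetK n c)// mxE.
split=> [i ki|].
  rewrite S big1// => j _; rewrite mxE.
  have [kj|jk] := ltnP k j; first by rewrite IH1 ?mul0r.
  rewrite (gtn_eqF (leq_ltn_trans (jk : (j.+1 <= k.+1)%N) ki)) (ltn_eqF (_ : (j < i.+1)%N)) ?mulr0//.
  by rewrite ltnS (leq_trans jk)// ltnW// ltnW.
rewrite S (bigD1 (inord k))//= big1 ?addr0.
  rewrite IH2 mxE !inordK ?eqxx//; last by rewrite ltnS ltnW.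
  by rewrite [RHS]big_nat_recr.
move=> j jk; rewrite mxE inordK ?ltnS//.
have [kj|kj] := ltnP k j; first by rewrite IH1 ?mul0r.
have jk' : (j : nat) != k by apply: contra jk => /eqP E1; rewrite -val_eqE /= inordK ?E1// ltnS ltnW.
by rewrite eqSS eq_sym (negbTE jk') (ltn_eqF (_ : (j < k.+2)%N)) ?mulr0// ltnS (leq_trans kj)// leqW.
Qed.

Lemma E_coord n k (i : 'I_n.+1) : (k <= n)%N -> E n k.+1 0 i = ((i : nat) == k)%:R.
Proof. by move=> kn; rewrite mxE eqxx -(inj_eq val_inj) /= inordK. Qed.

Lemma E_dot n i j : (1 <= i <= n.+1)%N -> (1 <= j <= n.+1)%N ->
  dotv (E n i) (E n j) = (i == j)%:R.
Proof.
case: i => // i /andP[_ hi]; case: j => // j /andP[_ hj].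
rewrite /dotv (bigD1 (inord i))//= !mxE !eqxx mul1r big1 ?addr0.
  by rewrite -val_eqE /= !inordK// eqSS.
by move=> k ki; rewrite !mxE (negbTE ki) andbF mul0r.
Qed.

Lemma E_gs n k : (1 <= k <= n.+1)%N -> gr (E n) k = E n k /\ gs (E n) k = E n k.
Proof.
elim/ltn_ind: k => k IH hk; have [k1 kn] := andP hk.
have G : gr (E n) k = E n k.
  rewrite /gr big_nat_cond big1 ?subr0// => j; rewrite andbT => /andP[j1 jk].
  have hj : (1 <= j <= n.+1)%N by rewrite j1 (leq_trans (ltnW jk)).
  by rewrite (IH j jk hj).2 E_dot// gtn_eqF// scale0r.
by split=> //; rewrite gsE// G /enorm E_dot// eqxx sqrtr1 invr1 scale1r.
Qed.

(** The standard basis, as an abstract jet, has [dd = 1] throughout, and [W] is triangular over it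
    with diagonal entries [c 1 * ... * c k.-1]; the quotient in [tri_curv] is then [c k]. *)
Lemma frenet_model n (c : nat -> R) : (1 <= n)%N -> (forall k, (1 <= k < n)%N -> 0 < c k) ->
  gs_ok n (wv (frenetK n c) (e0 n)) /\
  forall k, (1 <= k <= n)%N -> curv (wv (frenetK n c) (e0 n)) k = c k.
Proof.
move=> n1 cpos; set W := wv _ _.
pose b k j := W k 0 (inord j.-1).
have bkk k : (1 <= k <= n.+1)%N -> b k k = \prod_(1 <= i < k) c i.
  by case: k => // k /andP[_ kn]; have [_ <-] := @wv_frenet n c k kn.
have okE : gs_ok n (E n).
  move=> k /andP[k1 kn]; have hk : (1 <= k <= n.+1)%N by rewrite k1 leqW.
  by rewrite (E_gs hk).1 -dotv_eq0 E_dot// eqxx oner_eq0.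
have [||okW CW] := @tri_curv R n W (E n) b okE.
- move=> k /andP[k1 kn]; rewrite bkk ?k1 ?leqW// big_nat_cond prodr_gt0// => i.
  by rewrite andbT => /andP[i1 ik]; rewrite cpos// i1 (leq_trans ik).
- case=> // k /andP[_ kn]; have [W0 _] := @wv_frenet n c k kn.
  apply/rowP => i; rewrite summxE; have [ki|ik] := ltnP k i.
    rewrite W0// big_nat_cond big1// => -[//|j]; rewrite andbT => /andP[_ jk].
    have jk' : (j <= k)%N := jk.
    by rewrite mxE E_coord ?(leq_trans jk')// gtn_eqF ?mulr0// (leq_ltn_trans jk').
  rewrite (bigD1_seq i.+1) ?iota_uniq//=; last by rewrite mem_index_iota /= ltnS.
  rewrite mxE E_coord ?(leq_trans ik)// eqxx mulr1 /b /= inord_val big_nat_cond big1 ?addr0// => -[//|j].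
  move=> /andP[/andP[_ jk] ji]; have jk' : (j <= k)%N := jk.
  by rewrite mxE E_coord ?(leq_trans jk')// -eqSS eq_sym (negbTE ji) mulr0.
split=> // k hk; have [k1 kn] := andP hk; rewrite CW//.
have dE j : (1 <= j <= n.+1)%N -> dd (E n) j = 1.
  move=> hj; have [j1 jn] := andP hj; rewrite /dd /fr; case: eqP => [Ej|/eqP jne].
    rewrite -det_cross -[RHS](det1 R n.+1); congr (\det _).
    apply/matrixP => a a'; rewrite mxE [RHS]mxE -(inj_eq val_inj) /=.
    case: eqP => [an|_]; first by rewrite Ej E_coord// eq_sym; congr ((_ == _)%:R).
    have ha : (1 <= a.+1 <= n.+1)%N by rewrite /= ltn_ord.
    by rewrite (E_gs ha).2 E_coord; [rewrite eq_sym|rewrite -ltnS].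
  by rewrite (E_gs hj).2 E_dot// eqxx.
have hk' : (1 <= k <= n.+1)%N by rewrite k1 leqW.
rewrite /curv (dE k.+1)// (dE k)// (dE 1%N)// mulr1 divr1 mulr1.
rewrite (bkk k.+1)// (bkk k)// (bkk 1%N)//.
rewrite big_nat_recr//= [X in _ / (_ * X)]big_geq// mulr1 mulrAC divff ?mul1r//.
rewrite gt_eqF// big_nat_cond prodr_gt0// => i.
by rewrite andbT => /andP[i1 ik]; rewrite cpos// i1 (leq_trans ik).
Qed.

End Model.

(** * A lower Lipschitz bound for closed embedded curves *)

Section Bilipschitz.
Context {R : realType}.
Implicit Types (f : R -> R).

Lemma bounded_itv f (a b : R) : continuous f -> exists2 M, 0 <= M & forall s, a <= s <= b -> `|f s| <= M.
Proof.
move=> cf; have [ab|ba] := leP a b; last first.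
  by exists 0 => // s /andP[h1 h2]; move: (le_trans h1 h2); rewrite leNgt ba.
have cn : continuous (fun s => `|f s|) by move=> s; apply: cvg_norm; exact: cf.
have [c _ H] := EVT_max ab (continuous_subspaceT cn).
by exists `|f c| => // s hs; apply: H; rewrite in_itv.
Qed.

Lemma min_itv f (a b : R) : continuous f -> (forall s, a <= s <= b -> 0 < f s) ->
  exists2 M, 0 < M & forall s, a <= s <= b -> M <= f s.
Proof.
move=> cf pf; have [ab|ba] := leP a b; last first.
  by exists 1 => // s /andP[h1 h2]; move: (le_trans h1 h2); rewrite leNgt ba.
have [c hc H] := EVT_min ab (continuous_subspaceT cf).
exists (f c); first by apply: pf; move: hc; rewrite in_itv.
by move=> s hs; apply: H; rewrite in_itv.
Qed.

Lemma periodicz f (P : R) : (forall s, f (s + P) = f s) -> forall s (k : int), f (s + P * k%:~R) = f s.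
Proof.
move=> H; have N s (k : nat) : f (s + P * k%:R) = f s.
  by elim: k => [|k IH]; rewrite ?mulr0 ?addr0// -natr1 mulrDr mulr1 addrA H IH.
move=> s [k|k]; first exact: N.
by rewrite NegzE mulrNz mulrN -(N (s - P * k.+1%:R) k.+1) subrK.
Qed.

Lemma periodic_reduce (P s : R) : 0 < P -> exists k : int, 0 <= s - P * k%:~R <= P.
Proof.
move=> P0; have [k] := near_int (s - P / 2) P0.
by rewrite ler_norml => /andP[h1 h2]; exists k; apply/andP; lra.
Qed.

(** Near the diagonal the bound comes from the nonzero velocity and a bound on the second
    derivative; at distances between [rho] and [P / 2] it comes from injectivity and compactness,
    after reducing the base point modulo [P]. *)
Lemma bilip m (g : nat -> R -> 'rV[R]_m) (P : R) : 0 < P ->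
  (forall k (s : R), is_derive s 1 (g k) (g k.+1 s)) -> (forall k s, g k (s + P) = g k s) ->
  (forall s s', `|s - s'| <= P / 2 -> g 0%N s = g 0%N s' -> s = s') ->
  (forall s, g 1%N s != 0) ->
  exists2 mu, 0 < mu & forall s s', `|s - s'| <= P / 2 -> mu * `|s - s'| <= n1 (g 0%N s - g 0%N s').
Proof.
move=> P0 D per inj imm.
have Dc k i (s : R) : is_derive s 1 (fun s => g k s 0 i) (g k.+1 s 0 i).
  exact: ((is_derive_rowP _ _ _).1 (D k s)).
have cc k i : continuous (fun s => g k s 0 i).
  by apply: derivable_cont => s; case: (Dc k i s).
have cn1 k : continuous (fun s => n1 (g k s)).
  by move=> s; apply: (@cvg_sumf R R (nbhs s) (nbhs_pfilter s)) => i _; apply: cvg_norm; exact: cc.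
have n10 (u : 'rV[R]_m) : u != 0 -> 0 < n1 u.
  move=> u0; rewrite lt_def n1_ge0 andbT; apply: contra u0 => /eqP E.
  by apply/eqP/rowP => i; rewrite mxE; apply/eqP; rewrite -normr_eq0 eq_le normr_ge0 -E n1_coord.
have [d d0 Hd] := min_itv (a := 0) (b := P) (cn1 1%N) (fun s _ => n10 _ (imm s)).
have [M M0 HM] := bounded_itv 0 P (cn1 2%N).
have red (F : R -> R) s : (forall s, F (s + P) = F s) -> exists2 r, 0 <= r <= P & F s = F r.
  move=> pF; have [k hk] := periodic_reduce s P0; exists (s - P * k%:~R) => //.
  by rewrite -(periodicz pF (s - P * k%:~R) k) subrK.
have {}Hd s : d <= n1 (g 1%N s).
  by have [r hr ->] := red (fun s => n1 (g 1%N s)) s (fun s => congr1 (@n1 R m) (per 1%N s)); exact: Hd.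
have {}HM s : n1 (g 2%N s) <= M.
  have [r hr ->] := red (fun s => n1 (g 2%N s)) s (fun s => congr1 (@n1 R m) (per 2%N s)).
  by apply: le_trans (HM r hr); rewrite ler_norm.
have loc s s' : d * `|s - s'| - m%:R * M * `|s - s'| ^+ 2 <= n1 (g 0%N s - g 0%N s').
  have T i : `|(g 0%N s 0 i - g 0%N s' 0 i) - g 1%N s' 0 i * (s - s')| <= M * `|s - s'| ^+ 2.
    pose F u := g 0%N u 0 i - g 1%N s' 0 i * u.
    have DF (u : R) : is_derive u 1 F (g 1%N u 0 i - g 1%N s' 0 i).
      have := is_deriveDf (Dc 0%N i u) (is_deriveNf (is_deriveZf (g 1%N s' 0 i) (is_derive_id u 1))).
      by rewrite mulr1.
    have -> : (g 0%N s 0 i - g 0%N s' 0 i) - g 1%N s' 0 i * (s - s') = F s - F s' by rewrite /F; ring.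
    rewrite expr2 mulrA; apply: (MVT_abs DF) => u hu.
    apply: le_trans (MVT_abs (M := M) (Dc 1%N i) _) _.
      by move=> w _; apply: le_trans (n1_coord _ i) (HM w).
    rewrite ler_wpM2l//; case: (leP s s') hu => ss /andP[u1 u2].
      by rewrite !ler0_norm; lra.
    by rewrite !ger0_norm; lra.
  have : n1 (g 1%N s') * `|s - s'| <= n1 (g 0%N s - g 0%N s') + m%:R * M * `|s - s'| ^+ 2.
    rewrite {1 2}/n1 mulr_suml -mulrA mulr_natl -[X in _ *+ X](card_ord m) -sumr_const -big_split /=.
    apply: ler_sum => i _; rewrite !mxE -normrM.
    have := T i; set A := g 0%N s 0 i - _; set B := _ * (s - s') => h.
    by have := ler_distD A B 0; rewrite !subr0 [`|B - A|]distrC => h'; lra.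
  have : d * `|s - s'| <= n1 (g 1%N s') * `|s - s'| by rewrite ler_wpM2r.
  by lra.
(* Below this distance the quadratic error of [loc] uses up at most half of [d]. *)
pose rho := d / (2 * (m%:R * M + 1)).
have mM : 0 <= m%:R * M by rewrite mulr_ge0.
have rho0 : 0 < rho by rewrite divr_gt0// mulr_gt0//; lra.
have near s s' : `|s - s'| <= rho -> d / 2 * `|s - s'| <= n1 (g 0%N s - g 0%N s').
  move=> h; apply: le_trans (loc s s').
  have : (m%:R * M) * `|s - s'| <= d / 2.
    apply: (@le_trans _ _ (m%:R * M * rho)); first by rewrite ler_wpM2l.
    have -> : d / 2 = (m%:R * M + 1) * rho by rewrite /rho; field; lra.
    by rewrite ler_wpM2r ?lerDl// ltW.
  move=> h2; have a0 : 0 <= `|s - s'| by [].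
  by rewrite expr2; nra.
have [nu nu0 far] : exists2 nu, 0 < nu & forall s w, rho <= w <= P / 2 -> nu <= n1 (g 0%N (s + w) - g 0%N s).
  pose F (z : R * R) := n1 (g 0%N (z.1 + z.2) - g 0%N z.1).
  have cF : continuous F.
    move=> z; apply: (@cvg_sumf R _ (nbhs z) (nbhs_pfilter z)) => i _; apply: cvg_norm.
    rewrite (_ : (fun x => _) = fun x : R * R => g 0%N (x.1 + x.2) 0 i - g 0%N x.1 0 i); last first.
      by apply/funext => x; rewrite !mxE.
    rewrite !mxE; apply: cvgB.
      apply: (continuous_comp (f := fun z : R * R => z.1 + z.2) (g := fun s => g 0%N s 0 i)).
        by apply: cvgD; [exact: cvg_fst|exact: cvg_snd].
      exact: cc.
    apply: (continuous_comp (f := fun z : R * R => z.1) (g := fun s => g 0%N s 0 i)).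
      exact: cvg_fst.
    exact: cc.
  have [rP|rP] := leP rho (P / 2); last first.
    by exists 1 => // s w /andP[h1 h2]; lra.
  have cK := compact_setX (segment_compact (a := 0) (b := P)) (segment_compact (a := rho) (b := P / 2)).
  have K0 : (`[0, P]%classic `*` `[rho, P / 2]%classic) !=set0.
    by exists (0, rho); split => /=; rewrite in_itv /= lexx ?rP ?(ltW P0).
  have [c cK' H] := compact_EVT_min K0 cK (continuous_subspaceT cF).
  move: cK'; rewrite inE => -[] /=; rewrite !in_itv /= => c1 /andP[c2 c3].
  have Fc : 0 < F c.
    apply: n10; rewrite subr_eq0; apply/eqP => E.
    have E' : `|(c.1 + c.2) - c.1| <= P / 2.
      by rewrite addrC addKr ger0_norm//; lra.
    have := inj _ _ E' E; lra.
  exists (F c) => // s w hw.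
  have [k hk] := periodic_reduce s P0.
  have pg z : g 0%N (z + P * k%:~R) = g 0%N z.
    apply/rowP => i; apply: (periodicz (f := fun z => g 0%N z 0 i)) => x.
    by rewrite per.
  have -> : n1 (g 0%N (s + w) - g 0%N s) = F (s - P * k%:~R, w).
    by rewrite /F /= -(pg (s - _ + w)) -(pg (s - _)) addrAC !subrK.
  by apply: H; rewrite inE; split; rewrite /= in_itv.
exists (Num.min (d / 2) (nu / (P / 2))).
  by rewrite lt_min !divr_gt0// divr_gt0.
move=> s s' h; have [r1|r1] := leP `|s - s'| rho.
  by apply: le_trans (near s s' r1); rewrite ler_wpM2r// ge_min lexx.
have E : nu <= n1 (g 0%N s - g 0%N s').
  have [ss|ss] := leP s' s.
    have -> : s = s' + (s - s') by rewrite addrC subrK.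
    by apply: far; move: r1 h; rewrite ger0_norm ?subr_ge0// => r1 h; rewrite ltW.
  have -> : n1 (g 0%N s - g 0%N s') = n1 (g 0%N (s + (s' - s)) - g 0%N s).
    have -> : s + (s' - s) = s' by rewrite addrC subrK.
    by apply: eq_bigr => i _; rewrite !mxE distrC.
  by apply: far; move: r1 h; rewrite distrC gtr0_norm ?subr_gt0// => r1 h; rewrite ltW.
apply: le_trans E; apply: (@le_trans _ _ (nu / (P / 2) * `|s - s'|)).
  by rewrite ler_wpM2r// ge_min lexx orbT.
by rewrite mulrAC ler_pdivrMr ?divr_gt0// ler_wpM2l// ltW.
Qed.

End Bilipschitz.

(** * The Taylor patch *)

Section Patches.
Context {R : realType}.
Implicit Types (f : R -> R).

Lemma finite_bound N (P : nat -> R -> Prop) : (forall i, (i <= N)%N -> exists2 M, 0 <= M & P i M) ->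
  (forall i M M', M <= M' -> P i M -> P i M') -> exists2 M, 0 <= M & forall i, (i <= N)%N -> P i M.
Proof.
move=> H mono; elim: N H => [|N IH] H.
  have [M M0 HM] := H 0%N isT; exists M => // i; by rewrite leqn0 => /eqP ->.
have [M M0 HM] := IH (fun i iN => H i (leqW iN)); have [M' M'0 HM'] := H N.+1 (leqnn _).
exists (M + M') => [|i]; first exact: addr_ge0.
rewrite leq_eqVlt => /predU1P[->|iN]; first by apply: mono HM'; rewrite lerDr.
by apply: mono (HM i iN); rewrite lerDl.
Qed.

Lemma finite_small N (P : nat -> R -> Prop) : (forall i, (i <= N)%N -> exists2 d, 0 < d & P i d) ->
  (forall i d d', 0 < d' <= d -> P i d -> P i d') -> exists2 d, 0 < d & forall i, (i <= N)%N -> P i d.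
Proof.
move=> H mono; elim: N H => [|N IH] H.
  have [M M0 HM] := H 0%N isT; exists M => // i; by rewrite leqn0 => /eqP ->.
have [M M0 HM] := IH (fun i iN => H i (leqW iN)); have [M' M'0 HM'] := H N.+1 (leqnn _).
have m0 : 0 < Num.min M M' by rewrite lt_min M0.
exists (Num.min M M') => // i.
rewrite leq_eqVlt => /predU1P[->|iN]; first by apply: mono HM'; rewrite m0 ge_min lexx orbT.
by apply: mono (HM i iN); rewrite m0 ge_min lexx.
Qed.

Lemma jets_bounded N f (a b : R) : Ck N f ->
  exists2 M, 0 <= M & forall i, (i <= N)%N -> forall s, a <= s <= b -> `|derive1n i f s| <= M.
Proof.
move=> Cf; apply: finite_bound => [i iN|i M M' MM H s hs]; last exact: le_trans (H s hs) MM.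
have Ci : Ck (i + (N - i)) f by rewrite subnKC.
exact: bounded_itv (Ck_cont (Ck_derive1n Ci)).
Qed.

Lemma near_zero_jets f (u : R) : {near u, f =1 fun=> 0} -> forall k, derive1n k f u = 0.
Proof.
move=> H k; rewrite (nbhs_singleton (near_derive1n H k)).
by case: k => // k; rewrite derive1n_cst.
Qed.

Lemma Jb_dilate N f (A c u : R) : Ck N f -> (forall i, (i <= N)%N -> `|derive1n i f (c * u)| <= A) ->
  0 <= A -> Jb N A `|c| (fun t => f (c * t)) u.
Proof.
move=> Cf H A0 i iN; rewrite derive1n_dilate; last exact: Ck_le iN Cf.
by rewrite normrM normrX mulrC ler_wpM2r ?H// exprn_ge0.
Qed.

Section Taylor.
Variables (N : nat) (b : R -> R) (f : R -> R).
Hypotheses (Cb : Ck N b) (b0 : forall t, t <= 0 -> b t = 0) (b1 : forall t, 1 <= t -> b t = 1).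
Hypothesis Cf : Ck N.+1 f.

Definition tay (u : R) := \sum_(l < N.+1) derive1n l f 0 * pw l u.
Definition plateau (y : R) := b (2 + y) * b (2 - y).
(* Adding [tpatch d] to [f] replaces it by its Taylor polynomial on [[-d, d]]. *)
Definition tpatch (d u : R) := plateau (d^-1 * u) * (tay u - f u).

Lemma Ck_tay k : Ck k tay.
Proof. by apply: Ck_sum => l _; apply: CkZ; exact: Ck_pw. Qed.

Lemma Ck_plateau : Ck N plateau.
Proof.
apply: CkM.
  apply: (@Ck_comp _ _ (fun y => 2 + y)) => //.
  by apply: CkD; [exact: Ck_cst|exact: Ck_id].
apply: (@Ck_comp _ _ (fun y => 2 - y)) => //.
by apply: CkB; [exact: Ck_cst|exact: Ck_id].
Qed.

Lemma Ck_dilate k g (c : R) : Ck k g -> Ck k (fun t => g (c * t)).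
Proof. by move=> Cg; apply: (@Ck_comp _ _ (fun t => c * t)) => //; apply: CkZ; exact: Ck_id. Qed.

Lemma Ck_tpatch d : Ck N (tpatch d).
Proof.
apply: CkM; first exact: Ck_dilate Ck_plateau.
by apply: CkB; [exact: Ck_tay|exact: CkW].
Qed.

Lemma plateau1 y : `|y| <= 1 -> plateau y = 1.
Proof. by rewrite ler_norml => /andP[h1 h2]; rewrite /plateau !b1 ?mulr1//; lra. Qed.

Lemma plateau0 y : 2 <= `|y| -> plateau y = 0.
Proof.
rewrite /plateau ler_normr => /orP[h|h]; first by rewrite [b (2 - y)]b0 ?mulr0//; lra.
by rewrite b0 ?mul0r//; lra.
Qed.

Lemma tpatch0 d u : 0 < d -> 2 * d <= `|u| -> tpatch d u = 0.
Proof.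
move=> d0 h; rewrite /tpatch plateau0 ?mul0r// normrM gtr0_norm ?invr_gt0//.
by rewrite mulrC ler_pdivlMr.
Qed.

Lemma tpatch1 d u : 0 < d -> `|u| <= d -> tpatch d u = tay u - f u.
Proof.
move=> d0 h; rewrite /tpatch plateau1 ?mul1r// normrM gtr0_norm ?invr_gt0//.
by rewrite mulrC ler_pdivrMr// mul1r.
Qed.

Lemma tay_jets i : (i <= N)%N -> derive1n i tay 0 = derive1n i f 0.
Proof.
move=> iN; rewrite /tay derive1n_sum => [|l]; last by apply: CkZ; exact: Ck_pw.
rewrite (bigD1 (Ordinal (iN : (i < N.+1)%N)))//= big1 ?addr0.
  by rewrite derive1nZ ?derive1n_pw ?leqnn ?subnn ?pw0 ?mulr1//; exact: Ck_pw.
move=> l li; rewrite derive1nZ; last exact: Ck_pw.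
rewrite derive1n_pw; case: ifP => il; last by rewrite mulr0.
rewrite pw0 subn_eq0 leqNgt ltn_neqAle il andbT.
have -> : i != l by apply: contra li => /eqP E; rewrite -val_eqE /= E.
by rewrite mulr0.
Qed.

(** The Taylor remainder is flat to order [N.+1], so its [i]-th derivative is of order
    [d ^ (N + 1 - i)] on the support, while each derivative of the cutoff costs a factor [1/d]. Up
    to order [N] at least one factor [d] is left. *)
Lemma tpatch_small : exists2 C, 0 <= C & forall d, 0 < d <= 1 -> forall u k, (k <= N)%N ->
  `|derive1n k (tpatch d) u| <= C * d.
Proof.
pose rho u := tay u - f u.
have Crho : Ck N.+1 rho by apply: CkB => //; exact: Ck_tay.
have rho0 i : (i < N.+1)%N -> derive1n i rho 0 = 0.
  move=> iN; rewrite /rho derive1nD; last 2 first.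
  - exact: Ck_tay.
  - by apply: CkN; apply: Ck_le Cf; exact: ltnW.
  have -> : (fun t => - f t) = (fun t => -1 * f t) by apply/funext => t; rewrite mulN1r.
  rewrite derive1nZ; last by apply: Ck_le Cf; exact: ltnW.
  by rewrite mulN1r tay_jets// subrr.
have [M M0 HM] := jets_bounded (- 2) 2 Crho.
have [A A0 HA] := jets_bounded (- 2) 2 Ck_plateau.
exists (A * M * 4 ^+ N.+1) => [|d /andP[d0 d1] u k kN].
  by rewrite !mulr_ge0// exprn_ge0.
have rhs0 : 0 <= A * M * 4 ^+ N.+1 * d by rewrite !mulr_ge0 ?exprn_ge0// ltW.
have [ud|ud] := leP `|u| (2 * d); last first.
  rewrite near_zero_jets ?normr0//.
  apply: (@near_lt_eq _ _ _ (`|u| - 2 * d)) => [|v uv]; first by rewrite subr_gt0.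
  apply: tpatch0 => //; have := ler_distD v u 0; rewrite !subr0 distrC => h.
  by lra.
have u2 : `|u| <= 2 by lra.
have J1 : Jb N A `|d^-1| (fun t => plateau (d^-1 * t)) u.
  apply: Jb_dilate => //; first exact: Ck_plateau.
  move=> i iN; apply: HA => //; rewrite -ler_norml normrM gtr0_norm ?invr_gt0//.
  by rewrite mulrC ler_pdivrMr.
have J2 : Jb N (M * (2 * d) ^+ N.+1) `|d^-1| rho u.
  move=> i iN; have B0 : forall u, `|u| <= 2 -> `|derive1n N.+1 rho u| <= M.
    by move=> w hw; apply: HM => //; rewrite -ler_norml.
  apply: le_trans (flat_bound Crho rho0 B0 (leqW iN) u2) _.
  have di0 : 0 < d^-1 by rewrite invr_gt0.
  rewrite -mulrA ler_wpM2l// (gtr0_norm di0).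
  apply: (@le_trans _ _ ((2 * d) ^+ (N.+1 - i))).
    by rewrite lerXn2r ?nnegrE // mulr_ge0// ltW.
  rewrite -[in leRHS](subnK (leqW iN : (i <= N.+1)%N)) exprD -mulrA ler_pMr; last first.
    by rewrite exprn_gt0// mulr_gt0.
  by rewrite -exprMn -mulrA divff ?gt_eqF// mulr1 exprn_ege1// ler1n.
have := Jb_mul (normr_ge0 _) (Ck_dilate d^-1 Ck_plateau) (CkW Crho) J1 J2 kN.
move/le_trans; apply.
have di0 : 0 < d^-1 by rewrite invr_gt0.
have -> : A * (M * (2 * d) ^+ N.+1) * (`|d^-1| *+ 2) ^+ k =
    A * M * ((2 ^+ N.+1 * 2 ^+ k) * (d ^+ N.+1 / d ^+ k)).
  have -> : `|d^-1| *+ 2 = 2 * d^-1 by rewrite (gtr0_norm di0) -(mulr_natl d^-1).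
  by rewrite !exprMn exprVn; ring.
have -> : A * M * 4 ^+ N.+1 * d = A * M * ((2 ^+ N.+1 * 2 ^+ N.+1) * d).
  by rewrite -exprMn -natrM mulrA.
rewrite ler_wpM2l ?mulr_ge0//; apply: ler_pM.
- by rewrite mulr_ge0// exprn_ge0.
- by rewrite mulr_ge0 ?invr_ge0 ?exprn_ge0// ltW.
- by rewrite ler_wpM2l ?exprn_ge0// ler_weXn2l ?ler1n// leqW.
have -> : d ^+ N.+1 / d ^+ k = d ^+ (N.+1 - k).
  by rewrite -[in LHS](subnK (leqW kN)) exprD mulfK// expf_neq0// gt_eqF.
by rewrite subSn// exprS ler_piMr ?(ltW d0)// exprn_ile1// ltW.
Qed.

End Taylor.
End Patches.

(** * Weighted powers and the window patch *)

Section Window.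
Context {R : realType}.
Implicit Types (f : R -> R) (x : R).

(** Continuity is asked for only in the specification, so that [prim] is a total operator and can be
    iterated inside a fixpoint. *)
Lemma prim_ex f : exists F : R -> R, F 0 = 0 /\ (continuous f -> forall x, is_derive x 1 F (f x)).
Proof.
have [cf|nf] := pselect (continuous f); last by exists (fun=> 0); split.
have [F HF] := antiderivative cf; exists (fun x => F x - F 0).
split=> [|_ x]; first by rewrite subrr.
have := is_deriveDf (HF x) (is_deriveNf (is_derive_cst (F 0) x 1)).
by rewrite oppr0 addr0.
Qed.

Definition prim f : R -> R := sval (cid (prim_ex f)).

Lemma prim0 f : prim f 0 = 0.
Proof. by rewrite /prim; case: cid => F []. Qed.

Lemma is_derive_prim f x : continuous f -> is_derive x 1 (prim f) (f x).
Proof. by move=> cf; rewrite /prim; case: cid => F [_ /= H]; exact: H. Qed.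

Variables (N : nat) (lam : nat -> R -> R) (a bb : R).
Hypothesis Clam : forall j, Ck N (lam j).
Hypothesis lam0 : lam 0%N = fun=> 1.
Hypotheses (a0 : 0 < a) (abb : a < bb).
Hypothesis lam_out : forall j x, x <= a \/ bb <= x -> lam j x = 1.

(** [d] counts the integrations: for [d <= l], [wpow_rec l d] is [wpow (l - d) l], and the recursion
    moves inwards to the weight [lam l.-1]. *)
Fixpoint wpow_rec (l d : nat) : R -> R :=
  if d is d'.+1 then prim (fun x => lam (l - d) x * wpow_rec l d' x) else fun=> 1.

(* The weighted analogue of [x^(l-j) / (l-j)!]: the iterated integral from [0]
   solving [(wpow j l)' = lam_j wpow j.+1 l] with [wpow l l = 1]. *)
Definition wpow (j l : nat) : R -> R := if (j <= l)%N then wpow_rec l (l - j) else fun=> 0.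

Lemma Ck_wpow_rec l d : Ck N (wpow_rec l d).
Proof.
elim: d => [|d IH]; first exact: Ck_cst.
have C : Ck N (fun x => lam (l - d.+1) x * wpow_rec l d x) by exact: CkM.
apply: CkW; apply: (Ck_of_deriv _ C) => x.
by apply: is_derive_prim; exact: Ck_cont C.
Qed.

Lemma Ck_wpow j l : Ck N (wpow j l).
Proof. by rewrite /wpow; case: ifP => _; [exact: Ck_wpow_rec|exact: Ck_cst]. Qed.

Lemma wpow_diag j x : wpow j j x = 1.
Proof. by rewrite /wpow leqnn subnn. Qed.

Lemma wpow_gt j l x : (l < j)%N -> wpow j l x = 0.
Proof. by rewrite ltnNge /wpow => /negbTE ->. Qed.

Lemma wpow_at0 j l : (j < l)%N -> wpow j l 0 = 0.
Proof.
by move=> jl; rewrite /wpow (ltnW jl) -[(l - j)%N]prednK ?subn_gt0//= prim0.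
Qed.

Lemma is_derive_wpow j l x : is_derive x 1 (wpow j l) (lam j x * wpow j.+1 l x).
Proof.
have [jl|lj] := ltnP j l; last first.
  rewrite [wpow j.+1 l]/wpow ltnNge lj /= mulr0.
  rewrite /wpow; case: ifP => [jl|_]; last exact: is_derive_cst.
  have -> : (l - j = 0)%N by apply/eqP.
  exact: is_derive_cst.
rewrite /wpow (ltnW jl) jl -(subnSK jl) [wpow_rec l _.+1]/=.
have E : (l - (l - j.+1).+1 = j)%N by rewrite subnSK// subKn// ltnW.
rewrite E; apply: (@is_derive_prim (fun x => lam j x * wpow_rec l (l - j.+1) x)).
by apply: (@Ck_cont _ N); apply: CkM => //; exact: Ck_wpow_rec.
Qed.

Definition tpow j l : R -> R := if (j <= l)%N then pw (l - j) else fun=> 0.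

Lemma is_derive_tpow j l x : is_derive x 1 (tpow j l) (tpow j.+1 l x).
Proof.
rewrite /tpow; have [jl|lj] := ltnP j l; last first.
  case: ifP => [jl|_]; last exact: is_derive_cst.
  have -> : (l - j = 0)%N by apply/eqP.
  exact: (is_derive_pw 0 x).
rewrite (ltnW jl) -(subnSK jl); exact: (is_derive_pw (l - j.+1).+1 x).
Qed.

Lemma Ck_tpow k j l : Ck k (tpow j l).
Proof. by rewrite /tpow; case: ifP => _; [exact: Ck_pw|exact: Ck_cst]. Qed.

(** For [j < l] this defect is 0 before the window and, beyond it, a polynomial of degree less than
    [l - j], because the leading terms cancel. *)
Definition wdef j l x := wpow j l x - tpow j l x.

Lemma Ck_wdef j l : Ck N (wdef j l).
Proof. by apply: CkB; [exact: Ck_wpow|exact: Ck_tpow]. Qed.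

Lemma wdef_ge j l x : (l <= j)%N -> wdef j l x = 0.
Proof.
rewrite /wdef /wpow /tpow leq_eqVlt => /predU1P[->|lj].
  by rewrite leqnn subnn /pw expr0 fact0 divr1 subrr.
by rewrite leqNgt lj subrr.
Qed.

Lemma wdef_at0 j l : wdef j l 0 = 0.
Proof.
have [lj|jl] := leqP l j; first exact: wdef_ge.
rewrite /wdef wpow_at0// /tpow (ltnW jl) pw0 subn_eq0 leqNgt jl /=.
by rewrite subrr.
Qed.

Lemma is_derive_wdef j l x : is_derive x 1 (wdef j l) (lam j x * wpow j.+1 l x - tpow j.+1 l x).
Proof. exact: is_deriveDf (is_derive_wpow j l x) (is_deriveNf (is_derive_tpow j l x)). Qed.

Lemma is_derive_wdef1 j l x : lam j x = 1 -> is_derive x 1 (wdef j l) (wdef j.+1 l x).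
Proof. by move=> E; have := is_derive_wdef j l x; rewrite E mul1r. Qed.

Lemma wdef_left j l x : x < a -> wdef j l x = 0.
Proof.
move: {2}(l - j)%N (erefl (l - j)%N) => d; elim: d j x => [|d IH] j x E xa.
  by rewrite wdef_ge// -subn_eq0 E.
have E' : (l - j.+1)%N = d by rewrite subnS E.
rewrite -[RHS](wdef_at0 j l).
apply: (@derive0_cst _ (wdef j l) (Num.min x 0 - 1) a).
- move=> t /andP[_ ta]; rewrite -(IH j.+1 t E' ta).
  by apply: is_derive_wdef1; apply: lam_out; left; exact: ltW.
- by rewrite xa andbT; have [] := leP x 0; lra.
- by rewrite a0 andbT; have [] := leP x 0; lra.
Qed.

Lemma wdef_right_jets k l x : bb < x -> derive1n k (wdef 0 l) x = wdef k l x.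
Proof.
elim: k x => [//|k IH] x bx; rewrite derive1nS.
have nr : {near x, derive1n k (wdef 0 l) =1 wdef k l}.
  apply: (@near_lt_eq _ _ _ (x - bb)) => [|y yx]; first by rewrite subr_gt0.
  by apply: IH; move: yx; rewrite ltr_norml => /andP[h1 h2]; lra.
rewrite derive1E (near_eq_derive _ nr) -derive1E.
by apply: derive1_is; apply: is_derive_wdef1; apply: lam_out; right; exact: ltW.
Qed.

(** Beyond the window the defect of index [j] is an integral of that of index [j.+1] over a length
    at most [1/d], which costs one factor [1/d]; for [j.+1 = l] the integrand vanishes there and
    nothing is lost. So one factor [d] remains. *)
Lemma wdef_bound : exists2 C, 0 <= C & forall d x j l, 0 < d <= 1 -> 0 <= x -> d * x <= 1 ->
  (j < l <= N)%N -> d ^+ (l - j) * `|wdef j l x| <= C * d.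
Proof.
have H e : forall l j, (l - j)%N = e -> (j < l)%N -> exists2 C, 0 <= C & forall d x, 0 < d <= 1 -> 0 <= x ->
    d * x <= 1 -> d ^+ (l - j) * `|wdef j l x| <= C * d.
  elim: e => [|e IH] l j le jl; first by move: jl; rewrite -subn_gt0 le.
  have [A A0 HA] := bounded_itv 0 bb (Ck_cont (Ck_wdef j l)).
  have E' : (l - j.+1)%N = e by rewrite subnS le.
  have [C C0 HC] : exists2 C, 0 <= C & forall d x, 0 < d <= 1 -> 0 <= x -> d * x <= 1 ->
      d ^+ e * `|wdef j.+1 l x| <= C * d.
    have [jl1|lj1] := ltnP j.+1 l; first by have := IH l j.+1 E' jl1; rewrite E'.
    by exists 0 => // d x _ _ _; rewrite wdef_ge// normr0 mulr0 mul0r.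
  have Ad d y : 0 < d <= 1 -> 0 <= y <= bb -> d ^+ e.+1 * `|wdef j l y| <= A * d.
    move=> /andP[d0 d1] hy; rewrite mulrC; apply: ler_pM => //; first by rewrite exprn_ge0// ltW.
      exact: HA.
    by rewrite exprS ler_piMr ?(ltW d0)// exprn_ile1// ltW.
  exists (A + C); first exact: addr_ge0.
  move=> d x hd x0 dx; rewrite le mulrDl; have [d0 d1] := andP hd.
  have Cd0 : 0 <= C * d by rewrite mulr_ge0// ltW.
  have [xb|bx] := leP x bb; first by apply: le_trans (Ad d x hd _) _; rewrite ?x0// lerDl.
  have bb0 : 0 <= bb by rewrite ltW// (lt_trans a0).
  have de0 : 0 < d ^+ e by rewrite exprn_gt0.
  pose B := C * d / d ^+ e.
  have B0 : 0 <= B by rewrite divr_ge0// ltW.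
  have h1 : `|wdef j l x - wdef j l bb| <= B * `|x - bb|.
    apply: (MVT_abs (is_derive_wdef j l)) => t; rewrite min_r ?max_l ?(ltW bx)// => /andP[t1 t2].
    rewrite lam_out ?mul1r; last by right.
    rewrite /B ler_pdivlMr// mulrC; apply: HC => //; first exact: le_trans t1.
    by apply: le_trans dx; rewrite ler_pM2l.
  have h2 := Ad d bb hd; rewrite bb0 lexx in h2; have {}h2 := h2 isT.
  have h3 : `|wdef j l x| <= `|wdef j l bb| + B * x.
    have := ler_distD (wdef j l bb) (wdef j l x) 0; rewrite !subr0 => h.
    have : B * `|x - bb| <= B * x by rewrite ler_wpM2l// gtr0_norm ?subr_gt0//; lra.
    by lra.
  apply: (@le_trans _ _ (d ^+ e.+1 * (`|wdef j l bb| + B * x))); first by rewrite ler_wpM2l// exprn_ge0// ltW.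
  rewrite mulrDr; apply: lerD => //.
  have -> : d ^+ e.+1 * (B * x) = C * d * (d * x).
    by rewrite /B exprS; field; rewrite gt_eqF.
  by rewrite ler_piMr.
have [C C0 HC] : exists2 C, 0 <= C & forall l, (l <= N)%N -> forall j, (j <= N)%N -> forall d x, 0 < d <= 1 -> 0 <= x -> d * x <= 1 ->
  (j < l)%N -> d ^+ (l - j) * `|wdef j l x| <= C * d.
  apply: finite_bound => [l lN|l M M' MM' HH j jN d x hd x0 dx jl]; last first.
    by apply: le_trans (HH j jN d x hd x0 dx jl) _; rewrite ler_wpM2r//; case/andP: hd => /ltW.
  apply: finite_bound => [j jN|j M M' MM' HH d x hd x0 dx jl]; last first.
    by apply: le_trans (HH d x hd x0 dx jl) _; rewrite ler_wpM2r//; case/andP: hd => /ltW.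
  have [jl|lj] := ltnP j l; last by exists 0.
  by have [C C0 HC] := H _ l j erefl jl; exists C => // d x hd x0 dx _; exact: HC.
exists C => // d x j l hd x0 dx /andP[jl lN]; apply: HC => //.
by rewrite (leq_trans (ltnW jl)).
Qed.

Section Patch2.
Variables (b : R -> R) (kap : R).
Hypotheses (Cb : Ck N b) (b0 : forall t, t <= 0 -> b t = 0) (b1 : forall t, 1 <= t -> b t = 1).
Hypotheses (kap0 : 0 < kap) (kap1 : kap <= 2^-1) (N1 : (1 <= N)%N).
Variable gl : nat -> R.

Definition cut (y : R) := b (2 - y).
Definition wcorr (d u : R) := \sum_(1 <= l < N.+1) (d ^+ l * gl l) * wdef 0 l (d^-1 * u).
(* Near [0], adding [wpatch d] to [\sum_l g_l u^l/l!] turns it into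
   [\sum_l d^l g_l wpow 0 l (u / d)]. *)
Definition wpatch (d u : R) := cut (kap^-1 * u) * wcorr d u.

Lemma Ck_cut : Ck N cut.
Proof.
apply: (@Ck_comp _ _ (fun y => 2 - y)) => //.
by apply: CkB; [exact: Ck_cst|exact: Ck_id].
Qed.

Lemma Ck_wcorr d : Ck N (wcorr d).
Proof. by apply: Ck_sum => l _; apply: CkZ; apply: Ck_dilate; exact: Ck_wdef. Qed.

Lemma Ck_wpatch d : Ck N (wpatch d).
Proof. by apply: CkM; [exact: Ck_dilate Ck_cut|exact: Ck_wcorr]. Qed.

Lemma wcorr_left d u : 0 < d -> u < d * a -> wcorr d u = 0.
Proof.
move=> d0 ua; rewrite /wcorr big1// => l _; rewrite wdef_left ?mulr0//.
by rewrite mulrC ltr_pdivrMr// mulrC.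
Qed.

Lemma wpatch_left d u : 0 < d -> u < d * a -> wpatch d u = 0.
Proof. by move=> d0 ua; rewrite /wpatch wcorr_left// mulr0. Qed.

Lemma wpatch_right d u : 2 * kap <= u -> wpatch d u = 0.
Proof.
move=> ku; rewrite /wpatch /cut b0 ?mul0r// subr_le0.
by rewrite mulrC ler_pdivlMr.
Qed.

Lemma wpatch_near0 d u : u <= kap -> wpatch d u = wcorr d u.
Proof.
move=> ku; rewrite /wpatch /cut b1 ?mul1r//.
have : kap^-1 * u <= 1 by rewrite mulrC ler_pdivrMr// mul1r.
by lra.
Qed.

(** As [lam 0] is 1 inside the window too, the first derivative is again a combination of defects,
    of index 1, to which [wdef_bound] applies. This is the source of the C^1 bound in the window. *)
Lemma is_derive_wcorr (d u : R) : 0 < d ->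
  is_derive u 1 (wcorr d) (\sum_(1 <= l < N.+1) (d ^+ l.-1 * gl l) * wdef 1 l (d^-1 * u)).
Proof.
move=> d0; rewrite big_nat_cond.
rewrite (_ : wcorr d = fun u => \sum_(1 <= l < N.+1 | (1 <= l < N.+1)%N && true) (d ^+ l * gl l) * wdef 0 l (d^-1 * u)); last first.
  by apply/funext => v; rewrite /wcorr big_nat_cond.
apply: is_derive_sumf => l; rewrite andbT => /andP[l1 _].
have -> : d ^+ l.-1 * gl l * wdef 1 l (d^-1 * u) = d ^+ l * gl l * (wdef 1 l (d^-1 * u) * d^-1).
  by case: l l1 => // l _; rewrite exprS /=; field; rewrite gt_eqF.
apply: is_deriveZf.
have D : is_derive u 1 (fun u => d^-1 * u) d^-1.
  by rewrite -[X in is_derive _ _ _ X](mulr1 d^-1); exact: is_deriveZf (is_derive_id u 1).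
by apply: (is_derive_compf D); apply: is_derive_wdef1; rewrite lam0.
Qed.

(** Inside the window the higher derivatives carry the change of curvature, so only the first one is
    bounded there. Beyond it [wdef_right_jets] turns [k]-th derivatives into defects of index [k],
    which [wdef_bound] controls. *)
Lemma wpatch_small : exists2 C, 0 <= C & forall d u, 0 < d <= 1 ->
  `|derive1 (wpatch d) u| <= C * d /\
  (u < d * a \/ d * bb < u -> forall k, (k <= N)%N -> `|derive1n k (wpatch d) u| <= C * d).
Proof.
have [C C0 HC] := wdef_bound.
have [A A0 HA] := jets_bounded 0 2 Ck_cut.
pose G := \sum_(1 <= l < N.+1) `|gl l|.
have G0 : 0 <= G by exact: sumr_ge0.
have ki0 : 0 < kap^-1 by rewrite invr_gt0.
(* Keeps the support of the cutoff within [d * (u / d) <= 1], the range of [wdef_bound]. *)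
have kap2 : 2 * kap <= 1 by have := kap1; lra.
have ki1 : 1 <= kap^-1 by rewrite invf_ge1//; lra.
have zl d u : 0 < d -> u < d * a -> forall k, derive1n k (wpatch d) u = 0.
  move=> d0 ua; apply: near_zero_jets.
  apply: (@near_lt_eq _ _ _ (d * a - u)) => [|v vu]; first by rewrite subr_gt0.
  by apply: wpatch_left => //; move: vu; rewrite ltr_norml => /andP[h1 h2]; lra.
have zr d u : 0 < d -> 2 * kap < u -> forall k, derive1n k (wpatch d) u = 0.
  move=> d0 ua; apply: near_zero_jets.
  apply: (@near_lt_eq _ _ _ (u - 2 * kap)) => [|v vu]; first by rewrite subr_gt0.
  by apply: wpatch_right => //; move: vu; rewrite ltr_norml => /andP[h1 h2]; lra.
have ku u : 0 <= u -> u <= 2 * kap -> 0 <= kap^-1 * u <= 2.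
  by move=> u0 uk; rewrite mulr_ge0 ?(ltW ki0)//= mulrC ler_pdivrMr.
have du d u : 0 < d -> 0 <= u -> u <= 2 * kap -> 0 <= d^-1 * u /\ d * (d^-1 * u) <= 1.
  move=> d0 u0 uk; split; first by rewrite mulr_ge0// invr_ge0 ltW.
  by rewrite mulrA divff ?gt_eqF// mul1r; lra.
have Qb (c : nat -> R) d : (forall l, (1 <= l <= N)%N -> `|c l| <= C * d) ->
    `|\sum_(1 <= l < N.+1) gl l * c l| <= G * C * d.
  move=> Hc; apply: le_trans (ler_norm_sum _ _ _) _.
  rewrite -mulrA /G mulr_suml [leLHS]big_nat_cond [leRHS]big_nat_cond; apply: ler_sum => l; rewrite andbT => /andP[l1 lN].
  by rewrite normrM ler_wpM2l// Hc// l1.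
have QQ0 d u : 0 < d <= 1 -> 0 <= u -> u <= 2 * kap -> `|wcorr d u| <= G * C * d.
  move=> hd u0 uk; have [d0 d1] := andP hd; have [x0 dx] := du d u d0 u0 uk.
  rewrite /wcorr (eq_bigr (fun l => gl l * (d ^+ l * wdef 0 l (d^-1 * u)))); last by move=> l _; ring.
  apply: Qb => l /andP[l1 lN]; rewrite normrM ger0_norm ?exprn_ge0 ?(ltW d0)//.
  by have := HC d (d^-1 * u) 0%N l hd x0 dx; rewrite subn0; apply; rewrite l1.
have QQ1 d u : 0 < d <= 1 -> 0 <= u -> u <= 2 * kap ->
    `|\sum_(1 <= l < N.+1) (d ^+ l.-1 * gl l) * wdef 1 l (d^-1 * u)| <= G * C * d.
  move=> hd u0 uk; have [d0 d1] := andP hd; have [x0 dx] := du d u d0 u0 uk.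
  rewrite (eq_bigr (fun l => gl l * (d ^+ l.-1 * wdef 1 l (d^-1 * u)))); last by move=> l _; ring.
  apply: Qb => l /andP[l1 lN]; rewrite normrM ger0_norm ?exprn_ge0 ?(ltW d0)//.
  have [l2|l2] := leqP l 1; first by rewrite wdef_ge// normr0 mulr0 mulr_ge0// ltW.
  by have := HC d (d^-1 * u) 1%N l hd x0 dx; rewrite subn1; apply; rewrite l2.
pose C1 := A * kap^-1 * (G * C) + A * (G * C).
pose C2 := A * (G * C) * (kap^-1 *+ 2) ^+ N.
have GC0 : 0 <= G * C by exact: mulr_ge0.
have C10 : 0 <= C1 by rewrite addr_ge0// ?mulr_ge0// ltW.
have C20 : 0 <= C2 by rewrite !mulr_ge0// exprn_ge0// mulrn_wge0// ltW.
exists (C1 + C2) => [|d u hd]; first exact: addr_ge0.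
have [d0 d1] := andP hd.
have Cd0 : 0 <= (C1 + C2) * d by apply: mulr_ge0; [exact: addr_ge0|exact: ltW].
split.
  have [u0|u0] := ltP u 0.
    have ua : u < d * a by rewrite (lt_trans u0)// mulr_gt0.
    by rewrite -derive1n1 (zl d u d0 ua) normr0.
  have [uk|uk] := leP u (2 * kap); last first.
    by rewrite -derive1n1 (zr d u d0 uk) normr0.
  have Dk : is_derive u 1 (fun u => cut (kap^-1 * u)) (derive1 cut (kap^-1 * u) * kap^-1).
    have D : is_derive u 1 (fun u => kap^-1 * u) kap^-1.
      by rewrite -[X in is_derive _ _ _ X](mulr1 kap^-1); exact: is_deriveZf (is_derive_id u 1).
    apply: (is_derive_compf D); apply: is_derive_of.
    by have [dbk _] := (CkP N cut).1 Ck_cut; exact: (dbk 0%N (kap^-1 * u) N1).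
  rewrite (derive1_is (is_deriveMf Dk (is_derive_wcorr u d0))).
  apply: le_trans (ler_normD _ _) _.
  have -> : (C1 + C2) * d = A * kap^-1 * (G * C * d) + A * (G * C * d) + C2 * d by rewrite /C1; ring.
  apply: ler_wpDr; first by rewrite mulr_ge0// ltW.
  rewrite !normrM (ger0_norm (ltW ki0)); apply: lerD; apply: ler_pM => //.
  - by rewrite mulr_ge0// ltW.
  - by rewrite ler_wpM2r ?(ltW ki0)// -derive1n1 HA// ku.
  - exact: QQ0.
  - by have := HA 0%N isT; apply; exact: ku.
  - exact: QQ1.
move=> hu k kN; apply: (@le_trans _ _ (C2 * d)); last first.
  by rewrite mulrDl lerDr mulr_ge0// ltW.
have C2d : 0 <= C2 * d by rewrite mulr_ge0// ltW.
case: hu => hu; first by rewrite zl// normr0.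
have [uk|uk] := leP u (2 * kap); last by rewrite zr// normr0.
have u0 : 0 <= u.
  by apply: le_trans (ltW hu); rewrite mulr_ge0 ?(ltW d0)// ltW// (lt_trans a0).
have [x0 dx] := du d u d0 u0 uk.
have J1 : Jb N A `|kap^-1| (fun t => cut (kap^-1 * t)) u.
  apply: Jb_dilate => //; first exact: Ck_cut.
  by move=> i iN; apply: HA => //; exact: ku.
have J2 : Jb N (G * C * d) `|kap^-1| (wcorr d) u.
  move=> i iN; apply: (@le_trans _ _ (G * C * d)); last first.
    rewrite ler_peMr ?mulr_ge0 ?(ltW d0)// gtr0_norm//.
    exact: exprn_ege1.
  rewrite /wcorr derive1n_sum => [|l]; last first.
    by apply: CkZ; apply: Ck_dilate; apply: Ck_le iN _; exact: Ck_wdef.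
  rewrite (eq_bigr (fun l => gl l * (d ^+ l * (d^-1 ^+ i * wdef i l (d^-1 * u))))); last first.
    move=> l _; have Crr : Ck i (wdef 0 l) by apply: Ck_le iN _; exact: Ck_wdef.
    rewrite derive1nZ; last exact: Ck_dilate.
    rewrite derive1n_dilate// wdef_right_jets; first by ring.
    by rewrite mulrC ltr_pdivlMr// mulrC.
  apply: Qb => l /andP[l1 lN].
  have [li|il] := leqP l i; first by rewrite wdef_ge// mulr0 mulr0 normr0 mulr_ge0// ltW.
  rewrite mulrA exprVn.
  have -> : d ^+ l / d ^+ i = d ^+ (l - i).
    by rewrite -[in LHS](subnK (ltnW il)) exprD mulfK// expf_neq0// gt_eqF.
  rewrite normrM ger0_norm ?exprn_ge0 ?(ltW d0)//.
  by apply: HC; rewrite ?il.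
apply: le_trans (Jb_mul (normr_ge0 _) (Ck_dilate kap^-1 Ck_cut) (Ck_wcorr d) J1 J2 kN) _.
rewrite (gtr0_norm ki0).
have -> : A * (G * C * d) * (kap^-1 *+ 2) ^+ k = (A * (G * C) * d) * (kap^-1 *+ 2) ^+ k by ring.
have -> : C2 * d = (A * (G * C) * d) * (kap^-1 *+ 2) ^+ N by rewrite /C2; ring.
rewrite ler_wpM2l//; first by rewrite !mulr_ge0// ltW.
rewrite ler_weXn2l// mulr2n; lra.
Qed.

End Patch2.
End Window.

(** * The parametrization and the weights *)

Section Data.
Context {R : realType}.
Local Notation tpi := (pi *+ 2 : R).

Lemma tpi_gt0 : 0 < tpi.
Proof. by rewrite pmulrn_lgt0// pi_gt0. Qed.

Lemma tpiE : tpi = 2 * pi :> R.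
Proof. by rewrite mulr_natl. Qed.

(** Slope [d] plus a periodic staircase that climbs the remaining [P - d * tpi] while [t] is within
    [tau] of a multiple of the period, normalized to vanish on [tau < t < tpi - tau]. *)
Lemma time_change M (tau P d : R) : 0 < tau < pi / 4 -> 0 < d -> d * tpi < P ->
  exists u : R -> R, [/\ Ck M u, forall t, u (t + tpi) = u t + P,
    forall t : R, derivable u t 1 /\ d <= derive1 u t,
    forall t, tau < t < tpi - tau -> u t = d * t &
    forall t, `|t| <= pi -> d * t - (P - d * tpi) <= u t <= d * t].
Proof.
move=> /andP[tau0 tau1] d0 dP; have p0 := pi_gt0 R; have tp := tpiE.
have [b [Cb b0 b1 b01 db]] := @cutoff R M.
pose s := (2 * tau)^-1; have s0 : 0 < s by rewrite invr_gt0; lra.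
pose f t := b (s * (t + tau)).
have f0 t : t <= - tau -> f t = 0.
  by move=> h; apply: b0; rewrite pmulr_rle0//; lra.
have f1 t : tau <= t -> f t = 1.
  move=> h; apply: b1; rewrite /s mulrC ler_pdivlMr; lra.
have Cf : Ck M f.
  apply: (@Ck_comp _ _ (fun t => s * (t + tau))) => //.
  by apply: CkZ; apply: CkD; [exact: Ck_id|exact: Ck_cst].
have Df (t : R) : exists2 e : R, 0 <= e & is_derive t 1 f e.
  exists (derive1 b (s * (t + tau)) * s); first by rewrite mulr_ge0 ?(ltW s0)//; have [] := db (s * (t + tau)).
  have D : is_derive t 1 (fun t => s * (t + tau)) s.
    have := is_deriveZf s (is_deriveDf (is_derive_id t 1) (is_derive_cst tau t 1)).
    by rewrite addr0 mulr1.
  by apply: (is_derive_compf D); apply: is_derive_of; have [] := db (s * (t + tau)).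
have tau0' : 0 <= tau by exact: ltW.
have tau2 : tau < tpi / 2 by rewrite tp; lra.
pose St t := qper tpi 1 f t - 1.
have near t (k : int) : `|t - tpi * k%:~R| <= tpi / 2 ->
    {near t, qper tpi 1 f =1 fun t => f (t - tpi * k%:~R) + k%:~R * 1}.
  by move=> h; exact: qper_near tau0' tau2 f0 f1 h.
exists (fun t => d * t + (P - d * tpi) * St t); split.
- apply: CkD; first by apply: CkZ; exact: Ck_id.
  apply: CkZ; apply: CkB; last exact: Ck_cst.
  exact: (Ck_qper tau0' tau2 f0 f1 Cf).
- move=> t; rewrite /St qper_shift ?tpi_gt0//; ring.
- move=> t; have [k hk] := near_int t tpi_gt0.
  have [e e0 De] := Df (t - tpi * k%:~R).
  have DS : is_derive t 1 St e.
    have D1 : is_derive t 1 (fun t => f (t - tpi * k%:~R) + k%:~R * 1 - 1) e.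
      have Dt : is_derive t 1 (fun t => t - tpi * k%:~R) 1.
        have := is_deriveDf (is_derive_id t 1) (is_derive_cst (- (tpi * k%:~R)) t 1).
        by rewrite addr0.
      have := is_deriveDf (is_deriveDf (is_derive_compf Dt De) (is_derive_cst (k%:~R * 1 : R) t 1)) (is_derive_cst (-1 : R) t 1).
      by rewrite !addr0 (mulr1 e).
    apply: near_eq_is_derive D1; apply: filterS (near t k hk) => x Hx.
    by rewrite /St Hx.
  have D := is_deriveDf (is_deriveZf d (is_derive_id t 1)) (is_deriveZf (P - d * tpi) DS).
  split; first by case: D.
  by rewrite (derive1_is D) mulr1 lerDl mulr_ge0// subr_ge0 ltW.
- move=> t /andP[t1 t2]; rewrite /St.
  have [tpi'|tpi'] := leP t pi.
    have h : `|t - tpi * 0%:~R| <= tpi / 2 by rewrite mulr0 subr0 ger0_norm ?tp; lra.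
    by rewrite (nbhs_singleton (near t 0 h)) mulr0 subr0 f1 ?ltW// mul0r addr0 subrr mulr0 addr0.
  have h : `|t - tpi * 1%:~R| <= tpi / 2 by rewrite mulr1 ler0_norm ?tp; lra.
  rewrite (nbhs_singleton (near t 1 h)) mulr1 f0; last by lra.
  by rewrite add0r subrr mulr0 addr0.
- move=> t ht; rewrite /St.
  have h : `|t - tpi * 0%:~R| <= tpi / 2 by rewrite mulr0 subr0 (le_trans ht)// tp; lra.
  rewrite (nbhs_singleton (near t 0 h)) mulr0 subr0 mul0r addr0.
  have /andP[h1 h2] := b01 (s * (t + tau)); rewrite -/(f t) in h1 h2.
  have PD : 0 < P - d * tpi by lra.
  by apply/andP; split; nra.
Qed.

Lemma curvature_data M n (sg : nat -> R -> R) (e : R) : (1 <= n)%N -> 0 < e ->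
  (forall k, continuous (sg k)) -> (forall k t, sg k (t + tpi) = sg k t) ->
  (forall k t, (1 <= k < n)%N -> 0 < sg k t) ->
  exists (c : nat -> R) (tau : R) (lam : nat -> R -> R),
  [/\ 0 < tau < pi / 8,
      forall k, (1 <= k < n)%N -> 0 < c k,
      forall k t, (1 <= k <= n)%N -> `|t| <= 2 * tau -> `|c k - sg k t| <= e &
  [/\ forall j, Ck M (lam j), lam 0%N = fun=> 1,
      forall j x, x <= 2 * tau \/ tpi - 2 * tau <= x -> lam j x = 1,
      forall k x, (1 <= k < n)%N -> 0 < lam k x &
      forall k t, (1 <= k <= n)%N -> 0 <= t <= tpi -> `|lam k t * c k - sg k t| <= e]].
Proof.
move=> n1 e0 csg per pos; have p0 := pi_gt0 R; have tp := tpiE.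
pose e2 := e / 2; have e20 : 0 < e2 by rewrite divr_gt0.
(* A last curvature that vanishes at 0 is replaced by the small value [e2], because [lam n] is a
   quotient by [c n]. *)
pose c k := if k == n then (if sg n 0 == 0 then e2 else sg n 0) else sg k 0.
have c_close k : `|c k - sg k 0| <= e2.
  rewrite /c; case: eqP => [->|_]; last by rewrite subrr normr0 ltW.
  by case: eqP => [->|_]; rewrite ?subr0 ?subrr ?normr0 ?gtr0_norm// ltW.
have cn0 : c n != 0.
  by rewrite /c eqxx; case: ifP => [_|->//]; rewrite gt_eqF.
have cpos k : (1 <= k < n)%N -> 0 < c k.
  by move=> hk; rewrite /c ltn_eqF ?pos//; case/andP: hk.
have [w w0 Hw] : exists2 w, 0 < w & forall k, (k <= n)%N -> forall x y, - 10 <= x <= tpi + 10 -> `|x - y| < w -> `|sg k x - sg k y| < e2.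
  apply: finite_small => [k kn|k d d' /andP[d0 dd] H x y hx xy]; last by apply: H => //; exact: lt_le_trans dd.
  exact: compact_unif_cont.
(* Over a distance [4 * tau] every [sg k] varies by less than [e2], so the constants [c k] serve up
   to [3 * tau] from 0. *)
pose tau := Num.min (w / 8) (pi / 16).
have tau0 : 0 < tau by rewrite lt_min !divr_gt0.
have tauw : 4 * tau < w.
  have : tau <= w / 8 by rewrite ge_min lexx.
  lra.
have tau1 : tau <= pi / 16 by rewrite ge_min lexx orbT.
have near0 k t : (k <= n)%N -> `|t| <= 3 * tau -> `|c k - sg k t| <= e.
  move=> kn ht; have h1 := c_close k.
  have h2 : `|sg k 0 - sg k t| < e2.
    by apply: Hw => //; [apply/andP; split; rewrite ?tp; lra|rewrite sub0r normrN; lra].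
  by have := ler_distD (sg k 0) (c k) (sg k t); rewrite /e2 in h1 h2; lra.
have near1 k t : (k <= n)%N -> `|t - tpi| <= 3 * tau -> `|c k - sg k t| <= e.
  move=> kn ht; rewrite -[t](subrK tpi) per; exact: near0.
have [b [Cb b0 b1 b01 db]] := @cutoff R M.
(* The [M] averages reach over a total length [h *+ M], which must stay below the modulus [w];
   [M.+1] avoids dividing by 0. *)
pose h := w / 2 / M.+1%:R; have h0 : 0 < h by rewrite !divr_gt0// ltr0n.
have hM : h *+ M < w.
  have : h *+ M.+1 = w / 2 by rewrite -mulr_natr divfK// pnatr_eq0.
  rewrite mulrS; lra.
pose g k := sval (cid (smoothing M h0 (csg k))).
have Cg k : Ck M (g k) by rewrite /g; case: cid => ? [].
have gb k : forall t a b, (forall y, t <= y <= t + h *+ M -> a <= sg k y <= b) -> a <= g k t <= b.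
  by rewrite /g; case: cid => ? [].
have hM0 : 0 <= h *+ M by rewrite mulrn_wge0// ltW.
have g_close k t : (k <= n)%N -> 0 <= t <= tpi -> `|g k t - sg k t| <= e2.
  move=> kn /andP[t0 t1]; rewrite ler_distl; apply: gb => y /andP[y1 y2].
  have : `|sg k t - sg k y| < e2.
    by apply: Hw => //; [apply/andP; lra|rewrite ler0_norm; lra].
  by rewrite ltr_norml => /andP[v1 v2]; apply/andP; lra.
have g_pos k t : (1 <= k < n)%N -> 0 < g k t.
  move=> hk.
  have [m m0 Hm] := min_itv (a := t) (b := t + h *+ M) (csg k) (fun s _ => pos k s hk).
  have [A A0 HA] := bounded_itv t (t + h *+ M) (csg k).
  have /andP[h1 _] : m <= g k t <= A.
    apply: gb => y hy; rewrite Hm//=; apply: le_trans (HA y hy); exact: ler_norm.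
  exact: lt_le_trans h1.
(* Vanishes where the weights have to be 1, and is 1 between [3 * tau] and [tpi - 3 * tau]. In the
   transition zones [c k] and [g k] are both close to [sg k], hence so is any interpolation between
   them. *)
pose psi x := b (tau^-1 * (x - 2 * tau)) * b (tau^-1 * (tpi - 2 * tau - x)).
have ti0 : 0 < tau^-1 by rewrite invr_gt0.
have Cpsi : Ck M psi.
  apply: CkM.
    apply: (@Ck_comp _ _ (fun x => tau^-1 * (x - 2 * tau))) => //.
    by apply: CkZ; apply: CkB; [exact: Ck_id|exact: Ck_cst].
  apply: (@Ck_comp _ _ (fun x => tau^-1 * (tpi - 2 * tau - x))) => //.
  by apply: CkZ; apply: CkB; [exact: Ck_cst|exact: Ck_id].
have psi_out x : x <= 2 * tau \/ tpi - 2 * tau <= x -> psi x = 0.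
  case=> hx; rewrite /psi; first by rewrite b0 ?mul0r// pmulr_rle0//; lra.
  by rewrite [X in _ * X]b0 ?mulr0// pmulr_rle0//; lra.
have psi_in x : 3 * tau <= x <= tpi - 3 * tau -> psi x = 1.
  move=> /andP[x1 x2]; rewrite /psi !b1 ?mulr1//.
    by rewrite mulrC ler_pdivlMr//; lra.
  by rewrite mulrC ler_pdivlMr//; lra.
have psi01 x : 0 <= psi x <= 1.
  have /andP[p1 p2] := b01 (tau^-1 * (x - 2 * tau)).
  have /andP[p3 p4] := b01 (tau^-1 * (tpi - 2 * tau - x)).
  by rewrite mulr_ge0//= mulr_ile1.
pose lam k x := if (1 <= k <= n)%N then 1 + psi x * (g k x / c k - 1) else 1.
exists c, tau, lam; split=> //.
- by rewrite tau0/=; lra.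
- by move=> k t /andP[_ kn] ht; apply: near0 => //; lra.
split=> //.
- move=> j; rewrite /lam; case: (1 <= j <= n)%N; last exact: Ck_cst.
  exact: (CkD (Ck_cst _ _) (CkM Cpsi (CkB (CkM (Cg j) (Ck_cst _ _)) (Ck_cst _ _)))).
- by move=> j x hx; rewrite /lam psi_out// mul0r addr0; case: ifP.
- move=> k x hk; have ck := cpos k hk; have gk := g_pos k x hk.
  have hk' : (1 <= k <= n)%N by case/andP: hk => -> /ltnW.
  rewrite /lam hk'; have /andP[p1 p2] := psi01 x.
  have q0 : 0 < g k x / c k by rewrite divr_gt0.
  set q := g k x / c k in q0 *.
  have [->|pn] := eqVneq (psi x) 0; first by rewrite mul0r addr0.
  have pp : 0 < psi x by rewrite lt_def pn.
  have : 0 < psi x * q by rewrite mulr_gt0.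
  by rewrite mulrBr mulr1; lra.
move=> k t hk ht; rewrite /lam hk; have [k1 kn] := andP hk.
have ck : c k != 0.
  have [->//|kn'] := eqVneq k n.
  by rewrite gt_eqF// cpos// k1 ltn_neqAle kn'.
have -> : (1 + psi t * (g k t / c k - 1)) * c k - sg k t =
  (1 - psi t) * (c k - sg k t) + psi t * (g k t - sg k t) by field.
have /andP[p1 p2] := psi01 t.
have gc := g_close k t kn ht; have gc' : `|g k t - sg k t| <= e by rewrite /e2 in gc; lra.
have [hin|hout] := boolP (3 * tau <= t <= tpi - 3 * tau).
  by rewrite psi_in// subrr mul0r add0r mul1r.
have cc : `|c k - sg k t| <= e.
  move: hout; rewrite negb_and -!ltNge => /orP[h1|h1].
    by apply: near0 => //; case/andP: ht => t0 t1; rewrite ger0_norm// ltW.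
  by apply: near1 => //; case/andP: ht => t0 t1; rewrite ler0_norm; lra.
move: (psi t) p1 p2 => p p1 p2.
apply: le_trans (ler_normD _ _) _; rewrite !normrM (ger0_norm p1) (ger0_norm (_ : 0 <= 1 - p)); last by lra.
have : (1 - p) * `|c k - sg k t| <= (1 - p) * e by rewrite ler_wpM2l//; lra.
have : p * `|g k t - sg k t| <= p * e by rewrite ler_wpM2l.
by lra.
Qed.

End Data.

(** * Effect of reparametrization, weights and perturbation on curvatures and embeddedness *)

Section Pieces.
Context {R : realType}.

Definition jet n (f : 'I_n.+1 -> R -> R) (t : R) (k : nat) : 'rV[R]_n.+1 :=
  \row_i derive1n k (f i) t.

Lemma gs_ok_neq0 m n (v : nat -> 'rV[R]_m) : gs_ok n v -> (1 <= n)%N -> v 1%N != 0.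
Proof. by move=> ok n1; have := ok 1%N; rewrite n1 /gr big_geq// subr0; exact. Qed.

Lemma near_model n (W : nat -> 'rV[R]_n.+1) (e : R) : gs_ok n W -> 0 < e ->
  exists2 eta, 0 < eta & forall (v : nat -> 'rV[R]_n.+1) (O : 'M[R]_n.+1), O *m O^T = 1%:M -> \det O = 1 ->
    (forall k i, (1 <= k <= n.+1)%N -> `|v k 0 i - (W k *m O) 0 i| < eta) ->
    gs_ok n v /\ forall k, (1 <= k <= n)%N -> `|curv v k - curv W k| < e.
Proof.
move=> okW e0; have [eta eta0 H] := curv_stable okW e0.
have N0 : 0 < n.+2%:R :> R by rewrite ltr0n.
(* Rotating back by [O^T] can multiply coordinate errors by [n.+1]. *)
exists (eta / n.+2%:R) => [|v O HO dO Hv]; first exact: divr_gt0.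
have close k i : (1 <= k <= n.+1)%N -> `|(v k *m O^T) 0 i - W k 0 i| < eta.
  move=> hk; apply: le_lt_trans (curv_near_orth HO Hv i hk) _.
  rewrite mulrCA gtr_pMr// ltr_pdivrMr// mul1r ltr_nat.
  by rewrite ltnS.
have [ok c] := H _ close.
have E k : (1 <= k <= n.+1)%N -> v k = v k *m O^T *m O.
  by move=> _; rewrite -mulmxA (mulmx1C HO) mulmx1.
have [okv cv] := curv_orth HO dO E ok.
by split=> // k hk; rewrite cv// c.
Qed.

(** The chain rule is a triangular system in which all weights are [du]: the diagonal entries
    [du ^+ k] cancel in the quotient of [tri_curv]. *)
Lemma reparam n (G : 'I_n.+1 -> R -> R) (u du : R -> R) (t : R) : (1 <= n)%N ->
  (forall i, Ck n.+1 (G i)) -> Ck n.+1 du -> (forall s : R, is_derive s 1 u (du s)) -> 0 < du t ->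
  gs_ok n (jet G (u t)) ->
  gs_ok n (jet (fun i s => G i (u s)) t) /\
  forall k, (1 <= k <= n)%N -> curv (jet (fun i s => G i (u s)) t) k = curv (jet G (u t)) k.
Proof.
move=> n1 CG Cd D d0 ok; pose b := bf (fun=> du).
have bkk k : b k k t = du t ^+ k.
  by rewrite /b bf_diag prodr_const card_ord.
have [okv cv] : gs_ok n (jet (fun i s => G i (u s)) t) /\ forall k, (1 <= k <= n)%N ->
    curv (jet (fun i s => G i (u s)) t) k = b k.+1 k.+1 t / (b k k t * b 1%N 1%N t) * curv (jet G (u t)) k.
  apply: (tri_curv (b := fun k j => b k j t)) => //.
    by move=> k _; rewrite bkk exprn_gt0.
  move=> k /andP[k1 kn]; apply/rowP => i; rewrite mxE summxE.
  have DT j (s : R) : (j < n.+1)%N ->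
      is_derive s 1 (fun s => derive1n j (G i) (u s)) (du s * derive1n j.+1 (G i) (u s)).
    move=> jn; rewrite mulrC derive1nS; apply: (is_derive_compf (D s)); apply: is_derive_of.
    by have [H _] := (CkP _ _).1 (CG i); exact: H.
  apply: etrans (@derive1n_tri _ (fun=> du) (fun j s => derive1n j (G i) (u s)) n.+1 (fun=> Cd) DT k t kn) _.
  rewrite -(big_mkord xpredT (fun j => bf (fun=> du) k j t * derive1n j (G i) (u t))) big_nat_recl//.
  case: k k1 kn => // k _ kn; rewrite bf_S0 mul0r add0r big_add1.
  by apply: eq_bigr => j _; rewrite !mxE.
split=> [//|k hk]; rewrite (cv k hk) (bkk k.+1) (bkk k) (bkk 1%N) expr1 exprSr mulfV ?mul1r//.
by rewrite mulf_neq0// ?expf_neq0// gt_eqF.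
Qed.

(* The Taylor polynomial [sum_l d^l u^l/l! * g_l], with the monomials replaced by
   the iterated integrals [wpow 0 l] of the weights [lam]: the weights
   multiply the curvatures. *)
Lemma window_curv n (lam : nat -> R -> R) (g : nat -> 'rV[R]_n.+1) (d t : R) (A : 'I_n.+1 -> R -> R) : (1 <= n)%N ->
  (forall j, Ck n.+1 (lam j)) -> lam 0%N = (fun=> 1) -> (forall k, (1 <= k < n)%N -> 0 < lam k t) -> 0 < d ->
  (forall i, {near t, A i =1 fun x => \sum_(l < n.+2) d ^+ l * g l 0 i * wpow lam 0 l x}) ->
  let w := fun j => \row_i \sum_(l < n.+2) d ^+ (l - j) * g l 0 i * wpow lam j l t in
  gs_ok n w ->
  gs_ok n (jet A t) /\ forall k, (1 <= k <= n)%N -> curv (jet A t) k = lam k t * curv w k.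
Proof.
move=> n1 Cl l0 lpos d0 nearA w ok.
(* The powers of [d] go into the matrix, where they cancel in the curvature quotient, so that the
   vectors [w j] themselves stay near [g j]. *)
pose b k j := bf lam k j t * d ^+ j.
have l0t : lam 0%N t = 1 by rewrite l0.
have pos k : (k <= n)%N -> 0 < \prod_(i < k) lam i t.
  move=> kn; apply: prodr_gt0 => -[[|i] ik] _; first by rewrite l0t.
  by apply: lpos => /=; exact: leq_trans ik kn.
have bkk k : b k k = (\prod_(i < k) lam i t) * d ^+ k by rewrite /b bf_diag.
have [okv cv] : gs_ok n (jet A t) /\ forall k, (1 <= k <= n)%N ->
    curv (jet A t) k = b k.+1 k.+1 / (b k k * b 1%N 1%N) * curv w k.
  apply: (tri_curv (b := b)) => //.
    by move=> k /andP[_ kn]; rewrite bkk mulr_gt0 ?pos// exprn_gt0.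
  move=> k /andP[k1 kn]; apply/rowP => i; rewrite mxE summxE.
  rewrite (nbhs_singleton (near_derive1n (nearA i) k)).
  pose E j x := \sum_(l < n.+2) d ^+ l * g l 0 i * wpow lam j l x.
  have DE j (x : R) : is_derive x 1 (E j) (lam j x * E j.+1 x).
    have -> : lam j x * E j.+1 x = \sum_(l < n.+2) d ^+ l * g l 0 i * (lam j x * wpow lam j.+1 l x).
      by rewrite mulr_sumr; apply: eq_bigr => l _; rewrite mulrCA.
    by apply: is_derive_sumf => l _; apply: is_deriveZf; exact: (is_derive_wpow Cl).
  apply: etrans (@derive1n_tri _ lam E n.+1 Cl (fun j x _ => DE j x) k t kn) _.
  rewrite -(big_mkord xpredT (fun j => bf lam k j t * E j t)) big_nat_recl//.
  case: k k1 kn => // k _ kn; rewrite bf_S0 mul0r add0r big_add1.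
  apply: eq_bigr => j _; rewrite !mxE /b -mulrA; congr (_ * _).
  rewrite mulr_sumr; apply: eq_bigr => l _.
  have [jl|lj] := leqP j.+1 l; last by rewrite wpow_gt// !mulr0.
  by rewrite !mulrA -exprD subnKC.
split=> [//|k hk]; have [k1 kn] := andP hk; rewrite (cv k hk) (bkk k.+1) (bkk k) (bkk 1%N); congr (_ * _).
rewrite big_ord_recr big_ord1 /= l0t mul1r expr1 exprSr.
have p0 := pos k kn; have dk : d ^+ k != 0 by rewrite expf_neq0// gt_eqF.
by field; rewrite dk !gt_eqF.
Qed.

(** Reduce [u t'] modulo [P] to within [P / 2] of [u t]. There the perturbation uses up at most half
    of [mu], and [u] stretches distances by at least [d]. *)
Lemma embed_lift m (g : nat -> R -> 'rV[R]_m) (P mu L d T : R) (p dp : 'I_m -> R -> R) (u du : R -> R) :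
  0 < P -> 0 < mu -> 0 < d -> 0 < T ->
  (forall k s, g k (s + P) = g k s) ->
  (forall s s', `|s - s'| <= P / 2 -> mu * `|s - s'| <= n1 (g 0%N s - g 0%N s')) ->
  (forall i s, p i (s + P) = p i s) -> (forall i (s : R), is_derive s 1 (p i) (dp i s)) ->
  (forall i s, `|dp i s| <= L) -> L *+ m <= mu / 2 ->
  (forall t, u (t + T) = u t + P) -> (forall t : R, is_derive t 1 u (du t)) -> (forall t, d <= du t) ->
  exists2 c, 0 < c & forall t t', exists z : int, c * `|t' - t - T * z%:~R| <=
    \sum_i `|(g 0%N (u t') 0 i + p i (u t')) - (g 0%N (u t) 0 i + p i (u t))|.
Proof.
move=> P0 mu0 d0 T0 gper bil pper Dp pL Lmu uper Du ud.
have uz t (k : int) : u (t + T * k%:~R) = u t + P * k%:~R.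
  have H s : u (s + T) - (s + T) / T * P = u s - s / T * P.
    by rewrite uper; field; rewrite gt_eqF.
  have := periodicz H t k.
  have -> : (t + T * k%:~R) / T = t / T + k%:~R by field; rewrite gt_eqF.
  by lra.
exists (mu / 2 * d) => [|t t']; first by rewrite !mulr_gt0.
have [k hk] := near_int (u t' - u t) P0; exists k.
set x := u t; set y := u t' - P * k%:~R.
have gy : g 0%N (u t') = g 0%N y.
  apply/rowP => i; rewrite /y -mulrN -intrN.
  by rewrite (periodicz (f := fun s => g 0%N s 0 i))// => s; rewrite gper.
have py i : p i (u t') = p i y.
  by rewrite /y -mulrN -intrN (periodicz (pper i)).
have yE : y = u (t' - T * k%:~R).
  by rewrite -mulrN -intrN uz intrN mulrN.
rewrite gy; under eq_bigr do rewrite py.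
have B := bil y x; have yx : `|y - x| <= P / 2 by rewrite /y addrAC.
have {B}B := B yx.
have M : d * `|t' - t - T * k%:~R| <= `|y - x|.
  have -> : t' - t - T * k%:~R = (t' - T * k%:~R) - t by ring.
  rewrite yE /x; move: (t' - _) => s.
  have [->|st] := eqVneq s t; first by rewrite subrr normr0 mulr0.
  wlog st' : s t {st x gy py yE y B yx t' hk} / s < t.
    move=> W; have := st; rewrite neq_lt => /orP[h|h]; first exact: W.
    by rewrite distrC [X in _ <= X]distrC; exact: W.
  have [c _ E] := MVT_pos st' Du.
  rewrite distrC [X in _ <= X]distrC E normrM ler_wpM2r//.
  exact: le_trans (ud c) (ler_norm _).
have S : n1 (g 0%N y - g 0%N x) - L *+ m * `|y - x| <= \sum_i `|g 0%N y 0 i + p i y - (g 0%N x 0 i + p i x)|.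
  have -> : L *+ m * `|y - x| = \sum_(i < m) L * `|y - x|.
    by rewrite sumr_const card_ord mulrnAl.
  rewrite /n1 -sumrB; apply: ler_sum => i _.
  have := MVT_abs (f := p i) (x := y) (y := x) (Dp i) (fun s _ => pL i s).
  rewrite !mxE; set a := g _ y 0 i; set b := g _ x 0 i.
  have -> : a + p i y - (b + p i x) = (a - b) + (p i y - p i x) by ring.
  have := ler_normB ((a - b) + (p i y - p i x)) (p i y - p i x).
  by rewrite addrK; lra.
apply: le_trans S.
have : L *+ m * `|y - x| <= mu / 2 * `|y - x| by rewrite ler_wpM2r.
have : mu / 2 * (d * `|t' - t - T * k%:~R|) <= mu / 2 * `|y - x| by rewrite ler_pM2l// divr_gt0.
by lra.
Qed.

Lemma qper_jet (P a : R) f u0 (k : int) j : 0 <= a -> a < P / 2 ->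
  (forall u, u <= - a -> f u = 0) -> (forall u, a <= u -> f u = 0) ->
  `|u0 - P * k%:~R| <= P / 2 ->
  derive1n j (qper P 0 f) u0 = derive1n j f (u0 - P * k%:~R).
Proof.
move=> a0 aP f0 f1 uk; have H := qper_near a0 aP f0 f1 uk.
rewrite (nbhs_singleton (near_derive1n H j)).
rewrite (_ : (fun _ => _) = fun u => f (u + (- (P * k%:~R)))); first exact: derive1n_shift.
by apply/funext => x; rewrite mulr0 addr0.
Qed.

End Pieces.

(** * Choice of small parameters *)

Section Main.
Context {R : realType}.
Local Notation tpi := (pi *+ 2 : R).

(** Each pair [(C, r)] in the list stands for a demand [C * d < r]; one [d] meets them all. *)
Lemma small_pos (s : seq (R * R)) : all (fun p => 0 < p.2) s ->
  exists2 d, 0 < d <= 1 & all (fun p => p.1 * d < p.2) s.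
Proof.
move=> Hs; have [d d0 H] : exists2 d, 0 < d & forall d', 0 < d' <= d -> all (fun p => p.1 * d' < p.2) s.
  elim: s Hs => [_|[C r] s IH /= /andP[r0 /IH[d d0 H]]]; first by exists 1.
  have C0 : 0 < `|C| + 1 by rewrite ltr_pwDr.
  exists (Num.min d (r / (`|C| + 1) / 2)) => [|d' /andP[d'0]]; first by rewrite lt_min d0 !divr_gt0.
  rewrite le_min => /andP[d'd d'r]; rewrite H ?d'0// andbT.
  have : d' * (`|C| + 1) <= r / 2.
    have -> : r / 2 = r / (`|C| + 1) / 2 * (`|C| + 1) by field; rewrite gt_eqF.
    by rewrite ler_pM2r.
  by have := ler_norm C; nra.
have m0 : 0 < Num.min d 1 by rewrite lt_min d0 ltr01.
exists (Num.min d 1); first by rewrite m0 ge_min lexx orbT.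
by apply: H; rewrite m0 ge_min lexx.
Qed.

(** Terms with [l < j] vanish, the term [l = j] is [g j], and those with [l > j] carry a factor
    [d]. *)
Lemma window_close n (lam : nat -> R -> R) (g : nat -> 'rV[R]_n.+1) (T : R) : (forall j, Ck n.+1 (lam j)) ->
  exists2 C, 0 <= C & forall d t i j, 0 < d <= 1 -> 0 <= t <= T -> (j <= n.+1)%N ->
    `|\sum_(l < n.+2) d ^+ (l - j) * g l 0 i * wpow lam j l t - g j 0 i| <= C * d.
Proof.
move=> Cl.
have H j : (j <= n.+1)%N -> exists2 C, 0 <= C & forall d t i, 0 < d <= 1 -> 0 <= t <= T ->
    `|\sum_(l < n.+2) d ^+ (l - j) * g l 0 i * wpow lam j l t - g j 0 i| <= C * d.
  move=> jn; pose B l := s2val (cid2 (bounded_itv 0 T (Ck_cont (Ck_wpow Cl j l)))).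
  have B0 l : 0 <= B l by rewrite /B; case: cid2.
  have BB l t : 0 <= t <= T -> `|wpow lam j l t| <= B l by rewrite /B; case: cid2 => /= x _; exact.
  exists (\sum_(l < n.+2) n1 (g l) * B l) => [|d t i /andP[d0 d1] ht].
    by apply: sumr_ge0 => l _; rewrite mulr_ge0// n1_ge0.
  rewrite (bigD1 (Ordinal (jn : (j < n.+2)%N)))//= subnn wpow_diag mulr1 mul1r addrC addrK.
  apply: le_trans (ler_norm_sum _ _ _) _.
  rewrite mulr_suml [leRHS](bigD1 (Ordinal (jn : (j < n.+2)%N)))//=.
  apply: ler_wpDl; first by rewrite !mulr_ge0 ?n1_ge0// ltW.
  apply: ler_sum => l lj; have [lj'|jl] := ltnP l j.
    by rewrite wpow_gt// mulr0 normr0 !mulr_ge0 ?n1_ge0// ltW.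
  have jl' : (0 < l - j)%N.
    by rewrite subn_gt0 ltn_neqAle jl andbT; apply: contra lj => /eqP jl'; apply/eqP/val_inj.
  rewrite !normrM normrX (ger0_norm (ltW d0)) -mulrA mulrC.
  have h1 : `|g l 0 i| * `|wpow lam j l t| <= n1 (g l) * B l.
    by apply: ler_pM => //; [exact: n1_coord|exact: BB].
  have h2 : d ^+ (l - j) <= d.
    by case: (l - j)%N jl' => // k _; rewrite exprS ler_piMr ?exprn_ile1// ltW.
  by rewrite ler_pM// ?mulr_ge0// exprn_ge0// ltW.
have [C C0 HC] := finite_bound (P := fun j C => forall d t i, 0 < d <= 1 -> 0 <= t <= T ->
  `|\sum_(l < n.+2) d ^+ (l - j) * g l 0 i * wpow lam j l t - g j 0 i| <= C * d) H
  (fun j M M' MM h d t i hd ht => le_trans (h d t i hd ht) (ler_wpM2r (ltW (andP hd).1) MM)).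
by exists C => // d t i j hd ht jn; exact: HC.
Qed.

End Main.

(** * The patched closed curve *)

Section Assembly.
Context {R : realType}.
Local Notation tpi := (pi *+ 2 : R).
Variables (n : nat) (lam : nat -> R -> R) (tau : R) (g : nat -> R -> 'rV[R]_n.+1).
Variables (P r d1 kap d : R) (b : R -> R).
Hypotheses (Clam : forall j, Ck n.+1 (lam j)) (tau0 : 0 < tau < pi / 8).
Hypothesis lam_out : forall j x, x <= 2 * tau \/ tpi - 2 * tau <= x -> lam j x = 1.
Hypothesis Dg : forall k (s : R), is_derive s 1 (g k) (g k.+1 s).
Hypothesis gper : forall k s, g k (s + P) = g k s.
Hypotheses (Cb : Ck n.+1 b) (b0 : forall t, t <= 0 -> b t = 0) (b1 : forall t, 1 <= t -> b t = 1).
Hypotheses (P0 : 0 < P) (d10 : 0 < d1) (d1P : 4 * d1 < P) (kap0 : 0 < kap) (kapP : 4 * kap < P).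
Hypotheses (d0 : 0 < d) (dd1 : tpi * d < d1) (dkap : tpi * d < kap) (dP : tpi * d < P / 2).

Definition gcoord (i : 'I_n.+1) (s : R) := g 0%N s 0 i.
Definition gpatch1 i := tpatch n.+1 b (gcoord i) d1.
Definition gpatch2 (i : 'I_n.+1) := wpatch n.+1 lam b kap (fun l => g l 0 0 i) d.
Definition Gam i (s : R) := gcoord i s + (qper P 0 (gpatch1 i) s + qper P 0 (gpatch2 i) s).

Lemma gcoord_jets M i : Ck M (gcoord i) /\ forall j, (j <= M)%N -> derive1n j (gcoord i) = fun s => g j s 0 i.
Proof.
apply: (@Ck_seq _ M (fun j s => g j s 0 i)) => [j t _|t].
  exact: ((is_derive_rowP _ _ _).1 (Dg j t)).
by apply: derivable_cont t => s; have [] := (is_derive_rowP _ _ _).1 (Dg M s) i.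
Qed.

Lemma gpatch1_outl i u : u <= - (2 * d1) -> gpatch1 i u = 0.
Proof.
move=> h; apply: tpatch0 => //; rewrite ler0_norm; first by rewrite lerNr.
by apply: le_trans h _; rewrite oppr_le0 mulr_ge0 ?ltW.
Qed.

Lemma gpatch1_outr i u : 2 * d1 <= u -> gpatch1 i u = 0.
Proof. by move=> h; apply: tpatch0 => //; rewrite ger0_norm// (le_trans _ h)// mulr_ge0 ?ltW. Qed.

Lemma gpatch2_outl i u : u <= - (2 * kap) -> gpatch2 i u = 0.
Proof.
move=> h; apply: (wpatch_left Clam (a := 2 * tau) (bb := tpi - 2 * tau)) => //.
  by case/andP: tau0 => t0 _; rewrite mulr_gt0.
case/andP: tau0 => t0 _; have : 0 < d * (2 * tau) by rewrite !mulr_gt0.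
by have := kap0; lra.
Qed.

Lemma gpatch2_outr i u : 2 * kap <= u -> gpatch2 i u = 0.
Proof. exact: wpatch_right. Qed.

Lemma d1_ge0 : 0 <= 2 * d1. Proof. by rewrite mulr_ge0// ltW. Qed.
Lemma kap_ge0 : 0 <= 2 * kap. Proof. by rewrite mulr_ge0// ltW. Qed.
Lemma d1_lt : 2 * d1 < P / 2. Proof. by have := d1P; lra. Qed.
Lemma kap_lt : 2 * kap < P / 2. Proof. by have := kapP; lra. Qed.

Lemma Ck_gpatch1 i : Ck n.+1 (gpatch1 i).
Proof. by apply: Ck_tpatch => //; case: (gcoord_jets n.+2 i). Qed.

Lemma Ck_gpatch2 i : Ck n.+1 (gpatch2 i).
Proof. exact: Ck_wpatch. Qed.

Lemma Ck_per1 i : Ck n.+1 (qper P 0 (gpatch1 i)).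
Proof. exact: (Ck_qper d1_ge0 d1_lt (gpatch1_outl i) (gpatch1_outr i) (Ck_gpatch1 i)). Qed.

Lemma Ck_per2 i : Ck n.+1 (qper P 0 (gpatch2 i)).
Proof. exact: (Ck_qper kap_ge0 kap_lt (gpatch2_outl i) (gpatch2_outr i) (Ck_gpatch2 i)). Qed.

Lemma Ck_Gam i : Ck n.+1 (Gam i).
Proof.
apply: (CkD (gcoord_jets n.+1 i).1); exact: CkD (Ck_per1 i) (Ck_per2 i).
Qed.

Lemma Gam_per i s : Gam i (s + P) = Gam i s.
Proof. by rewrite /Gam !qper_shift// !addr0 /gcoord gper. Qed.

Lemma patch_jet i (z : int) k u : `|u - P * z%:~R| <= P / 2 -> (k <= n.+1)%N ->
  derive1n k (fun s => qper P 0 (gpatch1 i) s + qper P 0 (gpatch2 i) s) u =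
  derive1n k (gpatch1 i) (u - P * z%:~R) + derive1n k (gpatch2 i) (u - P * z%:~R).
Proof.
move=> h kn; rewrite derive1nD; [|exact: Ck_le kn (Ck_per1 i)|exact: Ck_le kn (Ck_per2 i)].
congr (_ + _).
  exact: (qper_jet _ d1_ge0 d1_lt (gpatch1_outl i) (gpatch1_outr i) h).
exact: (qper_jet _ kap_ge0 kap_lt (gpatch2_outl i) (gpatch2_outr i) h).
Qed.

Lemma Gam_jet i (z : int) k u : `|u - P * z%:~R| <= P / 2 -> (k <= n.+1)%N ->
  derive1n k (Gam i) u = g k u 0 i +
    (derive1n k (gpatch1 i) (u - P * z%:~R) + derive1n k (gpatch2 i) (u - P * z%:~R)).
Proof.
move=> h kn; have [Cg jg] := gcoord_jets n.+1 i.
rewrite /Gam derive1nD; [|exact: Ck_le kn Cg|exact: Ck_le kn (CkD (Ck_per1 i) (Ck_per2 i))].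
by rewrite jg// (patch_jet i h kn).
Qed.

(** Both cutoffs are 1 here: the first patch leaves the Taylor polynomial of [gamma], and the second
    turns its powers into weighted ones. *)
Lemma Gam_window i (x : R) : 0 < x < tpi ->
  Gam i (d * x) = \sum_(l < n.+2) d ^+ l * g l 0 0 i * wpow lam 0 l x.
Proof.
move=> /andP[x0 x1].
have h0 : 0 < d * x by rewrite mulr_gt0.
have h1 : d * x < tpi * d by rewrite mulrC ltr_pM2r.
have h : `|d * x - P * 0%:~R| <= P / 2.
  by rewrite mulr0 subr0 gtr0_norm// ltW// (lt_trans h1).
rewrite /Gam (nbhs_singleton (qper_near d1_ge0 d1_lt (gpatch1_outl i) (gpatch1_outr i) h)).
rewrite (nbhs_singleton (qper_near kap_ge0 kap_lt (gpatch2_outl i) (gpatch2_outr i) h)).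
rewrite !mulr0 !subr0 !addr0 /gpatch1 tpatch1//; last by rewrite gtr0_norm// ltW// (lt_trans h1).
rewrite /gpatch2 wpatch_near0//; last by rewrite ltW// (lt_trans h1).
rewrite addrA [gcoord i _ + _]addrC subrK /tay /wcorr.
have [_ jg] := gcoord_jets n.+1 i.
rewrite big_add1 big_mkord big_ord_recl [in RHS]big_ord_recl /=.
have -> : pw 0 (d * x) = 1 by rewrite /pw expr0 fact0 divr1.
rewrite wpow_diag !mulr1 mul1r /gcoord -addrA; congr (_ + _).
rewrite -big_split; apply: eq_bigr => l _ /=; rewrite -/(bump 0 l).
rewrite /bump /= add1n add0n jg 1?ltnW// (derive1_is ((is_derive_rowP _ _ _).1 (Dg l 0) i)).
rewrite mulKf ?gt_eqF// /wdef /tpow /= subn0 /pw exprMn.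
by ring.
Qed.

End Assembly.

(** * The approximating curve in coordinates *)

Section Approx.
Context {R : realType}.
Local Notation tpi := (pi *+ 2 : R).

Lemma jet_periodic n (A : 'I_n.+1 -> R -> R) (T : R) : (forall i t, A i (t + T) = A i t) ->
  forall t (z : int), jet A (t + T * z%:~R) = jet A t.
Proof.
move=> per t z; apply/funext => k; apply/rowP => i; rewrite !mxE.
apply: (@periodicz _ (derive1n k (A i))) => s.
by rewrite -derive1n_shift; congr (derive1n k _ _); apply/funext => x; exact: per.
Qed.

(** The order of the choices matters: [c] and the weights depend on [sg], the tolerance [eta] on
    these, the curve [g] and its Lipschitz constant [mu] on [eta], and the patch sizes [d1] and
    [kap] on [g]. The scale [d] is last, since the constants of the window patch depend on all of
    them. *)
Lemma approx_coords n (sg : nat -> R -> R) (eps0 : R) : (1 <= n)%N -> 0 < eps0 ->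
  (forall k, continuous (sg k)) -> (forall k t, sg k (t + tpi) = sg k t) ->
  (forall k t, (1 <= k < n)%N -> 0 < sg k t) ->
  exists a : 'I_n.+1 -> R -> R,
  [/\ forall i, Ck n.+1 (a i), forall i t, a i (t + tpi) = a i t,
      forall t, gs_ok n (jet a t) /\ forall k, (1 <= k <= n)%N -> `|curv (jet a t) k - sg k t| < eps0 &
      exists2 m, 0 < m & forall t t', exists z : int,
        m * `|t' - t - tpi * z%:~R| <= \sum_i `|a i t' - a i t|].
Proof.
move=> n1 eps00 csg sper spos; have p0 := pi_gt0 R; have tp := @tpiE R.
pose e := eps0 / 2; have e0 : 0 < e by rewrite divr_gt0.
have [c [tau [lam [tau0 cpos cc [Clam lam0 lam_out lpos lc]]]]] :=
  @curvature_data R n.+1 n sg e n1 e0 csg sper spos.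
have [okW cW] := frenet_model n1 cpos; set W := wv _ _ in okW cW.
have [M M0 HM] := finite_bound (N := n) (P := fun k M => forall t, 0 <= t <= tpi -> `|lam k t| <= M)
  (fun k _ => bounded_itv 0 tpi (Ck_cont (Clam k)))
  (fun k m m' mm h t ht => le_trans (h t ht) mm).
(* The weights, bounded by [M], multiply the error made in the curvatures of the model. *)
pose e2 := e / (M + 1); have M1 : 0 < M + 1 by rewrite ltr_pwDr.
have e20 : 0 < e2 by rewrite divr_gt0.
have e2e : e2 <= e by rewrite ler_pdivrMr// mulrDr mulr1 lerDr mulr_ge0// ltW.
have Me2 : M * e2 < e by rewrite /e2 mulrA ltr_pdivrMr// mulrC ltr_pM2l// ltrDl.
have [eta eta0 Heta] := near_model okW e20.
(* Three shares of the tolerance: the base curve and the two patches. *)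
pose eta2 := eta / 3; have eta20 : 0 < eta2 by rewrite divr_gt0.
have W1 : delta_mx 0 0 != 0 :> 'rV[R]_n.+1 := gs_ok_neq0 okW n1.
have [P [g [P0 Dg gper ginj gW]]] := base_curve n1 (frenetKT n c) W1 eta20.
have eta23 : eta2 *+ 3 = eta by rewrite /eta2 -mulr_natr divfK.
have eta2e : eta2 < eta by rewrite -eta23 mulrS ltrDl mulrn_wgt0.
have g1 s : g 1%N s != 0.
  have [U [HO dO] H] := gW s.
  have [ok _] := Heta (fun k => g k s) U HO dO (fun k i hk => lt_trans (H k i hk) eta2e).
  exact: gs_ok_neq0 ok n1.
have [mu mu0 Hmu] := bilip P0 Dg gper ginj g1.
(* A bound for each patch: at most [eta2] for the curvatures, and small enough that two patches in
   [n.+1] coordinates use up at most [mu / 2] of the Lipschitz bound. *)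
pose r := Num.min eta2 (mu / 4 / n.+1%:R).
have r0 : 0 < r by rewrite lt_min eta20 !divr_gt0// ltr0n.
have r1 : r <= eta2 by rewrite ge_min lexx.
have r2 : r * 2 *+ n.+1 <= mu / 2.
  rewrite -mulr_natr; have h : r <= mu / 4 / n.+1%:R by rewrite ge_min lexx orbT.
  by move: h; rewrite ler_pdivlMr ?ltr0n//; clear; lra.
have [b [Cb b0 b1 _ _]] := @cutoff R n.+1.
have Cgi := gcoord_jets Dg.
pose C1 i := s2val (cid2 (tpatch_small Cb b0 (Cgi n.+2 i).1)).
have C10 i : 0 <= C1 i by rewrite /C1; case: cid2.
have HC1 i : forall d, 0 < d <= 1 -> forall u k, (k <= n.+1)%N -> `|derive1n k (tpatch n.+1 b (gcoord g i) d) u| <= C1 i * d.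
  by rewrite /C1; case: cid2.
have [d1 /andP[d10 d11] /and3P[d1a d1b _]] := @small_pos R [:: (\sum_i C1 i, r); (4, P)] ltac:(by rewrite /= r0 P0).
rewrite /= in d1a d1b.
have q1s i u k : (k <= n.+1)%N -> `|derive1n k (gpatch1 g d1 b i) u| <= r.
  move=> kn; apply: le_trans (HC1 i d1 _ u k kn) _; first by rewrite d10.
  apply: le_trans (ltW d1a); rewrite ler_wpM2r ?(ltW d10)// (bigD1 i)//= lerDl.
  exact: sumr_ge0.
have [kap /andP[kap0 kap1] /and3P[kapP kap2 _]] := @small_pos R [:: (4, P); (2, 1)] ltac:(by rewrite /= P0 ltr01).
rewrite /= in kapP kap2.
have kaph : kap <= 2^-1 by clear -kap2; lra.
have [tau1 tau2] := andP tau0.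
have ta0 : 0 < 2 * tau by rewrite mulr_gt0.
have tab : 2 * tau < tpi - 2 * tau by clear -tau1 tau2 tp p0; lra.
pose C2 i := s2val (cid2 (wpatch_small Clam lam0 ta0 tab lam_out Cb b0 kap0 kaph (isT : (1 <= n.+1)%N) (fun l => g l 0 0 i))).
have C20 i : 0 <= C2 i by rewrite /C2; case: cid2.
have HC2 i : forall d u, 0 < d <= 1 -> `|derive1 (gpatch2 lam g kap d b i) u| <= C2 i * d /\
  (u < d * (2 * tau) \/ d * (tpi - 2 * tau) < u -> forall k, (k <= n.+1)%N -> `|derive1n k (gpatch2 lam g kap d b i) u| <= C2 i * d).
  by rewrite /C2; case: cid2.
have [C3 C30 HC3] := window_close (fun l => g l 0) tpi Clam.
have [d /andP[d0 dl1] /and5P[da db dc dd /andP[de _]]] := @small_pos R [:: (\sum_i C2 i, r); (C3, eta2); (tpi, d1); (tpi, kap); (tpi, P / 2)]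
  ltac:(by rewrite /= r0 eta20 d10 kap0 divr_gt0).
rewrite /= in da db dc dd de.
have C2r i : C2 i * d <= r.
  by apply: le_trans (ltW da); rewrite ler_wpM2r ?(ltW d0)// (bigD1 i)//= lerDl sumr_ge0.
have d01 : 0 < d <= 1 by rewrite d0.
(* One order more than the curve, because [reparam] asks for a derivative of [u] of class
   C^(n+1). *)
have [u [Cu uper ud uwin ubd]] : exists u : R -> R, [/\ Ck n.+2 u, forall t, u (t + tpi) = u t + P,
    forall t : R, derivable u t 1 /\ d <= derive1 u t,
    forall t, tau < t < tpi - tau -> u t = d * t &
    forall t, `|t| <= pi -> d * t - (P - d * tpi) <= u t <= d * t].
  apply: time_change => //; first by rewrite tau1; clear -tau1 tau2 p0; lra.
  by rewrite mulrC; clear -de P0; lra.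
pose G := Gam lam g P d1 kap d b; pose A i s := G i (u s).
have CG i : Ck n.+1 (G i) by exact: (Ck_Gam Clam tau0 lam_out Dg Cb b0 d10 d1b kap0 kapP d0).
have CA i : Ck n.+1 (A i) by exact: (Ck_comp (CkW Cu) (CG i)).
have Aper i t : A i (t + tpi) = A i t by rewrite /A uper; exact: Gam_per.
(* Here [u] is linear and [A] is the Taylor polynomial in weighted powers, so [window_curv]
   applies. *)
have claim1 t : tau < t < tpi - tau -> gs_ok n (jet A t) /\
    forall k, (1 <= k <= n)%N -> `|curv (jet A t) k - sg k t| < eps0.
  move=> /andP[t1 t2].
  have near i : {near t, A i =1 fun x => \sum_(l < n.+2) d ^+ l * g l 0 0 i * wpow lam 0 l x}.
    apply: (@near_lt_eq _ _ _ (Num.min (t - tau) (tpi - tau - t))) => [|y]; first by rewrite lt_min !subr_gt0 t1.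
    rewrite lt_min !ltr_norml => /andP[/andP[y1 y2] /andP[y3 y4]].
    rewrite /A uwin; last by clear -y1 y2 y3 y4; apply/andP; lra.
    by apply: (Gam_window Clam tau0 lam_out Dg b0 b1 d10 d1b kap0 kapP d0 dc dd de); clear -y1 y2 y3 y4 tau1; apply/andP; lra.
  pose w j : 'rV[R]_n.+1 := \row_i \sum_(l < n.+2) d ^+ (l - j) * g l 0 0 i * wpow lam j l t.
  have [U [HO dO] H] := gW 0.
  have ht : 0 <= t <= tpi by clear -t1 t2 tau1; apply/andP; lra.
  have [okw cw] : gs_ok n w /\ forall k, (1 <= k <= n)%N -> `|curv w k - curv W k| < e2.
    apply: (Heta w U HO dO) => k i hk; have [_ kn] := andP hk; rewrite mxE.
    have h1 := HC3 d t i k d01 ht kn; have h2 := H k i hk.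
    set S := \sum_(_ < _) _ in h1 *; set Z := (_ *m U) 0 i in h2 *.
    by have := ler_distD (g k 0 0 i) S Z; clear -h1 h2 db eta23 eta20; lra.
  have [ok cv] := window_curv (g := fun l => g l 0) n1 Clam lam0 (fun k hk => lpos k t hk) d0 near okw.
  split=> [//|k hk]; rewrite (cv k hk).
  have h1 := cw k hk; have h2 := lc k t hk ht; have h3 := HM k (andP hk).2 t ht.
  rewrite (cW k hk) in h1; rewrite -/w; move: (curv w k) h1 => x h1.
  have -> : lam k t * x - sg k t = lam k t * (x - c k) + (lam k t * c k - sg k t) by ring.
  apply: le_lt_trans (ler_normD _ _) _; rewrite normrM.
  have : `|lam k t| * `|x - c k| <= M * e2 by apply: ler_pM => //; exact: ltW.
  by rewrite /e in Me2 h2 *; clear -Me2 h2; lra.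
(* [3 / 2 * tau] lies between [tau], where [u] becomes linear, and [2 * tau], where the weights
   start to vary, so that the two claims overlap. Here the jets of the patched curve are close to
   rotated model jets, and [reparam] removes [u]. *)
have claim2 t : `|t| <= 3 / 2 * tau -> gs_ok n (jet A t) /\
    forall k, (1 <= k <= n)%N -> `|curv (jet A t) k - sg k t| < eps0.
  move=> ht; have htp : `|t| <= pi by clear -ht tau1 tau2 p0; lra.
  have /andP[u1 u2] := ubd t htp; set s := u t in u1 u2 *.
  have [z hz] := near_int s P0.
  have [t1 t2] : - (3 / 2 * tau) <= t /\ t <= 3 / 2 * tau by move: ht; rewrite ler_norml => /andP.
  (* For [z >= 0] the bound [u t <= d * t] keeps the reduced parameter to the left of the varying
     weights; for [z <= -1] the lower bound on [u t] keeps it to the right. *)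
  have hx : s - P * z%:~R < d * (2 * tau) \/ d * (tpi - 2 * tau) < s - P * z%:~R.
    have [z0|z0] := leP 0 z.
      left; have h1 : 0 <= P * z%:~R by rewrite mulr_ge0 ?ler0z// ltW.
      have h2 : d * t < d * (2 * tau) by rewrite ltr_pM2l//; clear -t2 tau1; lra.
      by clear -h1 h2 u2; lra.
    right; have h1 : P * z%:~R <= P * -1.
      by rewrite ler_pM2l// -[-1]/((-1)%:~R) ler_int; clear -z0; lia.
    have h2 : d * (tpi - 2 * tau) < d * (t + tpi) by rewrite ltr_pM2l//; clear -t1 tau1; lra.
    by clear -h1 h2 u1; lra.
  have [U [HO dO] H] := gW s.
  have jets k i : (1 <= k <= n.+1)%N -> `|jet G s k 0 i - (W k *m U) 0 i| < eta.
    move=> hk; have [_ kn] := andP hk.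
    rewrite mxE (Gam_jet Clam tau0 lam_out Dg Cb b0 d10 d1b kap0 kapP d0 i hz kn).
    have h1 := q1s i (s - P * z%:~R) k kn.
    have h2 := le_trans ((HC2 i d (s - P * z%:~R) d01).2 hx k kn) (C2r i).
    have h3 := H k i hk; set Z := (_ *m U) 0 i in h3 *.
    move: (derive1n k (gpatch1 g d1 b i) _) (derive1n k (gpatch2 lam g kap d b i) _) h1 h2 => x y h1 h2.
    have -> : g k s 0 i + (x + y) - Z = (g k s 0 i - Z) + (x + y) by ring.
    have := ler_normD (g k s 0 i - Z) (x + y); have := ler_normD x y; clear -h1 h2 h3 r1 eta23; lra.
  have [ok cv] := Heta (jet G s) U HO dO jets.
  have [okA cA] := reparam n1 CG Cu.2 (fun s => is_derive_of (ud s).1) (lt_le_trans d0 (ud t).2) ok.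
  split=> [//|k hk]; have -> : curv (jet A t) k = curv (jet G s) k := cA k hk.
  have h1 := cv k hk; rewrite (cW k hk) in h1.
  have h2 : `|c k - sg k t| <= e by apply: cc => //; clear -ht tau1; lra.
  by have := ler_distD (c k) (curv (jet G s) k) (sg k t); rewrite /e in e2e h2; clear -h1 h2 e2e; lra.
exists A; split=> //.
  move=> t; have [z hz] := near_int t (@tpi_gt0 R); set x := t - tpi * z%:~R in hz.
  have -> : t = x + tpi * z%:~R by rewrite subrK.
  rewrite (jet_periodic Aper).
  have sgx k : sg k (x + tpi * z%:~R) = sg k x by exact: (periodicz (sper k)).
  suff [ok H] : gs_ok n (jet A x) /\ forall k, (1 <= k <= n)%N -> `|curv (jet A x) k - sg k x| < eps0.
    by split=> // k hk; rewrite sgx; exact: H.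
  have [h|h] := leP `|x| (3 / 2 * tau); first exact: claim2.
  move: hz h; rewrite ler_norml ltr_normr => /andP[x1 x2] /orP[h|h].
    by apply: claim1; clear -x1 x2 h tau1 tau2 tp p0; apply/andP; lra.
  have [ok H] : gs_ok n (jet A (x + tpi)) /\ forall k, (1 <= k <= n)%N -> `|curv (jet A (x + tpi)) k - sg k (x + tpi)| < eps0.
    by apply: claim1; clear -x1 x2 h tau1 tau2 tp p0; apply/andP; lra.
  have := jet_periodic Aper x 1; rewrite mulr1 => E; rewrite E in ok H.
  by split=> // k hk; rewrite -(sper k); exact: H.
pose p i s := qper P 0 (gpatch1 g d1 b i) s + qper P 0 (gpatch2 lam g kap d b i) s.
have C1p i : Ck 1 (p i).
  apply: (@Ck_le _ 1 n.+1) => //; apply: CkD.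
    exact: (Ck_per1 Dg Cb b0 d10 d1b).
  exact: (Ck_per2 g Clam tau0 lam_out Cb b0 kap0 kapP d0 i).
have pper i s : p i (s + P) = p i s by rewrite /p !qper_shift// !addr0.
have Dp i (s : R) : is_derive s 1 (p i) (derive1 (p i) s) by apply: is_derive_of; case: (C1p i).
have pL i s : `|derive1 (p i) s| <= r * 2.
  have [z hz] := near_int s P0.
  have h1 := q1s i (s - P * z%:~R) 1%N isT.
  have h2 := le_trans (HC2 i d (s - P * z%:~R) d01).1 (C2r i).
  have E := patch_jet Clam tau0 lam_out Dg Cb b0 d10 d1b kap0 kapP d0 i hz (isT : (1 <= n.+1)%N).
  have -> : derive1 (p i) s = derive1 (gpatch1 g d1 b i) (s - P * z%:~R) + derive1 (gpatch2 lam g kap d b i) (s - P * z%:~R) := E.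
  apply: le_trans (ler_normD _ _) _.
  by rewrite mulr_natr mulr2n lerD.
exact: (embed_lift P0 mu0 d0 (@tpi_gt0 R) gper Hmu pper Dp pL r2 uper (fun s => is_derive_of (ud s).1) (fun s => (ud s).2)).
Qed.
End Approx.

(** * From coordinates to row vectors, and the theorem *)

Section Rows.
Context {R : realType}.

Lemma derive1n_row n m (a : 'I_n.+1 -> R -> R) : (forall i, Ck m (a i)) ->
  forall k, (k <= m)%N -> derive1n k (fun t => \row_i a i t) = fun t => jet a t k.
Proof.
move=> Ca; elim=> [_|k IH km]; first by apply/funext => t; apply/rowP => i; rewrite !mxE.
rewrite derive1nS IH ?(ltnW km)//; apply/funext => t.
have D : is_derive t 1 (fun t => jet a t k) (jet a t k.+1).
  apply/is_derive_rowP => i; rewrite mxE.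
  rewrite (_ : (fun x => _) = derive1n k (a i)); last by apply/funext => x; rewrite mxE.
  by apply: is_derive_of; have [H _] := (CkP _ _).1 (Ca i); exact: H.
by rewrite derive1E; case: D.
Qed.

Lemma differentiable_row n m (a : 'I_n.+1 -> R -> R) : (forall i, Ck m (a i)) ->
  differentiable_C m (fun t => \row_i a i t).
Proof.
move=> Ca; have E := derive1n_row Ca; split=> [j t jm|].
  rewrite E ?(ltnW jm)//; apply/derivable_rowP => i.
  rewrite (_ : (fun x => _) = derive1n j (a i)); last by apply/funext => x; rewrite mxE.
  by have [H _] := (CkP _ _).1 (Ca i); exact: H.
rewrite E// => t; apply/cvg_ballP => e e0.
have H i : \forall x \near t, ball (derive1n m (a i) t) e (derive1n m (a i) x).
  by have [_ H] := (CkP _ _).1 (Ca i); move/cvg_ballP : (H t); apply.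
have H' : \forall x \near t, forall i, ball (derive1n m (a i) t) e (derive1n m (a i) x).
  exact: (@filter_forall _ _ (fun i x => ball (derive1n m (a i) t) e (derive1n m (a i) x)) (nbhs t) _ H).
apply: filterS H' => x Hx.
by split=> // i j; rewrite ord1 !mxE; exact: Hx.
Qed.

Lemma enorm_n1 m (v : 'rV[R]_m) : enorm v <= n1 v.
Proof.
have n0 : 0 <= n1 v by exact: n1_ge0.
rewrite /enorm -(ger0_norm n0) -sqrtr_sqr ler_wsqrtr// /dotv expr2 {1}/n1 mulr_suml.
apply: ler_sum => i _; rewrite -expr2 -real_normK ?num_real// expr2.
by rewrite ler_wpM2l// n1_coord.
Qed.

(** A vanishing right side of the lower bound gives injectivity, a small one continuity of the
    inverse; the integer [z] is the number of turns in both. *)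
Lemma row_embedding n (a : 'I_n.+1 -> R -> R) (m : R) : 0 < m ->
  (forall t, derive1 (fun t => \row_i a i t) t != 0) ->
  (forall t t', exists z : int, m * `|t' - t - (pi *+ 2) * z%:~R| <= \sum_i `|a i t' - a i t|) ->
  circle_embedding (fun t => \row_i a i t).
Proof.
move=> m0 a0 H; split=> // [t u tu|t U /nbhs_ballP[r /= r0 rU]].
  have [z hz] := H t u; exists z.
  move: hz; rewrite big1 => [|i _].
    rewrite pmulr_rle0// normr_le0 subr_eq0 subr_eq addrC mulrzr => /eqP ->.
    by [].
  by have /rowP/(_ i) := tu; rewrite !mxE => ->; rewrite subrr normr0.
have n0 : 0 < n.+1%:R :> R by rewrite ltr0n.
apply/nbhs_ballP; exists (m * r / n.+1%:R) => /= [|y hy u uy]; first by rewrite !(divr_gt0, mulr_gt0).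
have [z hz] := H t u; exists (- z); apply: rU; rewrite /ball /= distrC.
have -> : u + (pi *+ 2) *~ (- z) - t = u - t - (pi *+ 2) * z%:~R by rewrite mulrNz mulrzr addrAC.
rewrite -(ltr_pM2l m0); apply: le_lt_trans hz _.
have -> : m * r = \sum_(i < n.+1) (m * r / n.+1%:R).
  by rewrite sumr_const card_ord -[RHS]mulr_natr divfK// gt_eqF.
apply: ltr_sum => [|i _]; first by apply/hasP; exists ord0 => //; rewrite mem_index_enum.
by have := hy.2 0 i; rewrite -uy /ball /= !mxE distrC.
Qed.

End Rows.

Theorem theorem1p1 (R : realType) (n : nat) (hn : (1 <= n)%N)
    (s : R -> 'rV[R]_n) (hs : curvature_like s) (eps : R) (heps : 0 < eps) :
  exists alpha : R -> 'rV[R]_n.+1,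
    [/\ closed_frenet_curve alpha,
        holonomic_approximation eps s alpha &
        circle_embedding alpha].
Proof.
case: n hn s hs => // n hn s [sper scont spos].
pose sg k t := s t 0 (inord k.-1).
have n0 : 0 < n.+2%:R :> R by rewrite ltr0n.
have csg k : continuous (sg k).
  move=> t; apply: (@continuous_comp _ _ _ s (fun v : 'rV[R]_n.+1 => v 0 (inord k.-1)) t (scont t)).
  exact: coord_continuous.
have psg k t : sg k (t + pi *+ 2) = sg k t by rewrite /sg sper.
have gsg k t : (1 <= k < n.+1)%N -> 0 < sg k t.
  by move=> /andP[k1 kn]; apply: spos; rewrite inordK prednK// ltnW.
(* With [n.+1] curvatures, errors below [eps / n.+2] add up to strictly less than [eps]. *)
have [a [Ca aper acurv [m m0 Hm]]] := approx_coords hn (divr_gt0 heps n0) csg psg gsg.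
have E := derive1n_row Ca; set alpha := fun t => _ in E.
have J t : gs_ok n.+1 (fun k => derive1n k alpha t) /\
    forall k, (1 <= k <= n.+1)%N -> curv (fun k => derive1n k alpha t) k = curv (jet a t) k.
  (* Rotation by the identity: the derivatives of [alpha] are known to agree with [jet a t] only up
     to the order of differentiability. *)
  apply: (@curv_orth _ _ _ (jet a t) 1%:M); rewrite ?trmx1 ?mulmx1 ?det1//; last by case: (acurv t).
  by move=> k /andP[_ kn]; rewrite E// mulmx1.
exists alpha; split.
- split; [|exact: differentiable_row|by move=> t; exact: gs_ok_row_free (J t).1].
  by move=> t; apply/rowP => i; rewrite !mxE aper.
- exists (fun t => \row_(i < n.+1) curv (fun k => derive1n k alpha t) i.+1); split.
    by apply: curvature_map => // [|t]; [exact: differentiable_row|exact: (J t).1].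
  move=> t; apply: le_lt_trans (enorm_n1 _) _.
  have lt : \sum_(i < n.+1) eps / n.+2%:R < eps.
    by rewrite sumr_const card_ord -[ltLHS]mulr_natr mulrAC ltr_pdivrMr// ltr_pM2l// ltr_nat.
  apply: (le_lt_trans _ lt); apply: ler_sum => i _; rewrite !mxE (J t).2; last exact: (ltn_ord i).
  have := (acurv t).2 i.+1; rewrite /sg /= inord_val distrC => H; apply/ltW/H; exact: (ltn_ord i).
- apply: (row_embedding m0 _ Hm) => x; exact: gs_ok_neq0 (J x).1 isT.
Qed.
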